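(* Let $(X,d,\mu)$ be a locally complete and separable metric measure space, where $\mu$ is a Borel measure on $X$ with $0<\mu(B)<\infty$ for every ball $B=B(x,r)$, $x\in X$, $0<r<\infty$, and let $p\in(1,\infty)$. Then the map $E\mapsto\mathrm{Cap}_p(E)$, for $E\subset X$, is a Choquet capacity.
   Context: A metric space is locally complete if every point has a neighborhood that is complete in the restricted metric (equivalently, $X$ is an open subset of its completion). For a rectifiable curve $\gamma$, $\int_\gamma g\,ds$ is the usual path integral, defined via the constant-speed parametrization of $\gamma$ on $[0,1]$. A Borel function $g:X\to[0,\infty]$ is an upper gradient of $f:X\to[-\infty,\infty]$ if for all rectifiable curves $\gamma:[0,1]\to X$ one has $|f(\gamma(1))-f(\gamma(0))|\le\int_\gamma g\,ds$, where the left-hand side is interpreted as $\infty$ if it has the form $|\infty-\infty|$ or $|-\infty-(-\infty)|$. Let $\mathcal D(f)$ be the set of upper gradients of $f$. $N^{1,p}(X)$ is the collection of all (pointwise defined) functions $f\in L^p(X)$ that have an upper gradient $g\in L^p(X)$, with seminorm $$\|f\|_{N^{1,p}(X)}=\Big(\|f\|_{L^p(X)}^p+\inf_{g\in\mathcal D(f)}\|g\|_{L^p(X)}^p\Big)^{1/p}.$$ For $E\subset X$, $\mathrm{Cap}_p(E)=\inf\{\|u\|_{N^{1,p}(X)}^p : u\in N^{1,p}(X),\ u|_E\ge 1\}$ (with $\inf\emptyset=\infty$). A functional $I$ from the power set of $X$ to $[0,\infty]$ is a Choquet capacity if: (1) $A\subset B\subset X$ implies $I(A)\le I(B)$; (2)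 for every increasing sequence $(A_n)_{n\in\mathbb N}$ of subsets of $X$, $\lim_{n\to\infty}I(A_n)=I(\bigcup_n A_n)$; (3) for every decreasing sequence $(K_n)_{n\in\mathbb N}$ of compact subsets of $X$, $\lim_{n\to\infty}I(K_n)=I(\bigcap_n K_n)$. *)

(* Defs.v *)
From HB Require Import structures.
From mathcomp Require Import all_boot all_order all_algebra.
From mathcomp Require Import all_classical all_reals all_analysis.
From mathcomp Require Import measurable_realfun.

Set Implicit Arguments.
Unset Strict Implicit.
Unset Printing Implicit Defensive.

Import Order.TTheory GRing.Theory Num.Theory.
Import numFieldNormedType.Exports.

Local Open Scope classical_set_scope.
Local Open Scope ring_scope.

(* A measurableType carries a default element, so the Borel sigma-algebra is
   available on nonempty metric spaces only. *)
#[short(type="pointedMetricType")]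
HB.structure Definition PointedMetric (K : numDomainType) :=
  { M of PseudoPointedMetric K M & Metric K M }.

Notation borelType X := (g_sigma_algebraType (@open X)).

Section metric_space.
Context {R : realType} {X : metricType R}.
Implicit Type A : set X.

Definition complete_set A := forall F : set_system X,
  ProperFilter F -> F A -> cauchy F -> exists2 x, A x & F --> x.

Definition locally_complete := forall x : X, exists2 A, nbhs x A & complete_set A.

Definition separable_space := exists2 D : set X, countable D & dense D.

End metric_space.
Arguments locally_complete {R} X.
Arguments separable_space {R} X.

(* A curve on [0, 1] is a function on R whose values outside `[0, 1] are
   irrelevant. *)
Section curves.
Context {R : realType} {X : metricType R}.
Implicit Types (gamma : R -> X) (g : X -> \bar R) (a b t : R) (s : seq R).
Local Open Scope ereal_scope.

Definition partition_length gamma a b s : R :=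
  let F := gamma \o nth b (a :: s) in
  (\sum_(0 <= n < size s) mdist (F n) (F n.+1))%R.

Definition curve_length gamma a b : \bar R :=
  ereal_sup [set (partition_length gamma a b s)%:E | s in itv_partition a b].

Definition rectifiable gamma :=
  {within `[0%R, 1%R], continuous gamma} /\ curve_length gamma 0 1 < +oo.

(* The point gamma s, where s is the first parameter at which the arc traversed
   so far has length t * curve_length gamma 0 1. *)
Definition constant_speed gamma t : X :=
  gamma (inf [set s : R | s \in `[0%R, 1%R] /\
                t%:E * curve_length gamma 0 1 <= curve_length gamma 0 s]).

(* The metric speed of the constant-speed parametrization is the length of
   gamma. *)
Definition path_integral gamma g : \bar R :=
  curve_length gamma 0 1 *
  \int[lebesgue_measure]_(t in `[0%R, 1%R]) g (constant_speed gamma t).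

End curves.

Section sobolev.
Context {R : realType} {X : pointedMetricType R}.
Variables (mu : {measure set (borelType X) -> \bar R}) (p : R).
Implicit Types (f g u : borelType X -> \bar R) (E : set X).
Local Open Scope ereal_scope.

(* In \bar R both +oo - +oo and -oo - -oo are -oo, of absolute value +oo: this
   is the usual convention for upper gradients. *)
Definition upper_gradient f g :=
  [/\ measurable_fun [set: borelType X] g, (forall x, 0 <= g x) &
      forall gamma : R -> X, rectifiable gamma ->
        `|f (gamma 1%R) - f (gamma 0%R)| <= path_integral gamma g].

(* Measurability with respect to the completion of mu. *)
Definition mu_measurable f :=
  exists2 h : borelType X -> \bar R,
    measurable_fun [set: borelType X] h & {ae mu, forall x, f x = h x}.

(* The integral of a nonnegative function is the supremum of the integrals of
   the Borel simple functions below it; for a mu_measurable function it is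
   therefore the integral with respect to the completion of mu. *)
Definition Lp f := mu_measurable f /\ 'N[mu]_p%:E[f] < +oo.

Definition N1p f := Lp f /\ exists2 g, upper_gradient f g & Lp g.

Definition N1p_norm f : \bar R :=
  ('N[mu]_p%:E[f] `^ p +
   ereal_inf [set 'N[mu]_p%:E[g] `^ p | g in upper_gradient f]) `^ p^-1.

Definition Cap E : \bar R :=
  ereal_inf [set N1p_norm u `^ p |
    u in [set u | N1p u /\ forall x, E x -> 1 <= u x]].

End sobolev.

Definition choquet_capacity {R : realType} {T : topologicalType}
    (I : set T -> \bar R) :=
  [/\ forall A, (0 <= I A)%E,
      forall A B, A `<=` B -> (I A <= I B)%E,
      forall A : (set T)^nat, (forall n, A n `<=` A n.+1) ->
        I (A n) @[n --> \oo] --> I (\bigcup_n A n) &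
      forall K : (set T)^nat, (forall n, compact (K n)) ->
        (forall n, K n.+1 `<=` K n) ->
        I (K n) @[n --> \oo] --> I (\bigcap_n K n)].

(* Main.v *)
(* Increasing sets: let m be the limit of Cap(A_n), assumed finite, and let
   (u_j, g_j) be almost optimal pairs for a subsequence. The midpoint of two
   consecutive pairs still competes for the smaller set, so its energy is nearly
   m; by uniform convexity of t^p the positive parts of the increments of u_j^p
   and g_j^p are then summable with small sum. Hence (sup_j u_j, sup_j g_j)
   competes for the union at almost no extra cost; no weak compactness is needed.

   Decreasing compact sets: if K is compact then Cap(K) is the infimum of Cap(W)
   over open W containing K. Given (u, g) competing for K, pick lower
   semicontinuous majorants phi of u (close to u off a set D of small measure)
   and gt of g, on a closed neighborhood N of K covered by finitely many complete
   sets. The function v(x) = min(1, inf_c (phi(end of c) + int_c gt)), over curves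
   c in N starting at x, is at least u and has upper gradient gt along curves in N.
   Enlarging gt so that it is bounded below and large off finite unions of small
   balls makes minimizing sequences of curves converge along an ultrafilter, so v
   is lower semicontinuous, and {v > 1 - delta} is open and contains K. Finally
   (1 - delta) v - delta - 4 rho, with rho a Lipschitz cutoff, exceeds u only in D,
   so the maximum w of the two has an upper gradient that differs from gt (in N)
   and g (outside N) only on D, where it is bounded by a constant multiple of the
   slope of rho; rescaling w gives the competitor for W. *)

From HB Require Import structures.
Require Import Defs.
From mathcomp Require Import all_boot all_order all_algebra.
From mathcomp Require Import all_classical all_reals all_analysis.
From mathcomp Require Import measurable_realfun.
From mathcomp Require Import ring lra.
Set Implicit Arguments.
Unset Strict Implicit.
Unset Printing Implicit Defensive.
Import Order.TTheory GRing.Theory Num.Theory.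
Import numFieldNormedType.Exports.
Local Open Scope classical_set_scope.
Local Open Scope ring_scope.

(** * Integrals *)

(** Functions in [N1p] need not be continuous and [X] need not be proper, so neither quasicontinuity
    nor Arzela-Ascoli is at hand; the value function supplies the semicontinuity, which also makes
    it Borel although it is an infimum over curves. The difficulty is that the cutoff has a large
    slope, while the energy may grow only a little. The factor [1 - delta] frees a fraction [delta]
    of the gradient, and [(1 - delta) gt + delta b] is at most the maximum of [gt] and [b]. With
    [delta b] the slope of [4 rho], the cutoff is paid by raising the gradient to [b] on a set
    containing the points where the obstacle exceeds [u]; its measure is chosen after [b] is known.
    Since the slope is paid only there, two global gradients cannot be combined, and the gluing is
    carried out along each curve. Competitors are measurable only for the completion of [mu]. Their
    integrals are compared by a monotonicity that asks for no measurability, or through Borel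
    versions off a null set. Null sets cannot be neglected along curves, so pointwise inequalities
    between functions are kept everywhere. *)

Section nonmeasurable_integrals.
Context d (T : measurableType d) (R : realType).
Implicit Types (mu : {measure set T -> \bar R}) (f g : T -> \bar R).
Local Open Scope ereal_scope.
Import HBNNSimple.

(** The integral of a nonnegative function is a supremum over simple functions below it, so
    monotonicity survives without measurability. *)
Lemma ge0_le_integral_nomeas mu f g : (forall x, 0 <= f x) ->
  (forall x, f x <= g x) -> \int[mu]_x f x <= \int[mu]_x g x.
Proof.
move=> f0 fg; have g0 x : 0 <= g x by exact: le_trans (fg x).
rewrite !ge0_integralTE//; apply: le_ereal_sup => _ [h /= hf <-].
by exists h => // x; exact: le_trans (fg x).
Qed.

Lemma ge0_integral_mrestr mu (D : set T) (mD : measurable D) f :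
  measurable_fun setT f -> (forall x, 0 <= f x) ->
  \int[mrestr mu mD]_x f x = \int[mu]_(x in D) f x.
Proof.
move=> mf f0; rewrite [LHS](@ge0_negligible_integral _ _ _ _ _ (~` D))//; last 2 first.
- exact: measurableC.
- by rewrite /= /mrestr setICl measure0.
rewrite setDE setCK setTI; apply: eq_measure_integral => A mA AD.
by rewrite /mrestr; congr (mu _); apply/setIidPl.
Qed.

Lemma measurable_fun_if_in (D : set T) f g : measurable D ->
  measurable_fun setT f -> measurable_fun setT g ->
  measurable_fun setT (fun x => if x \in D then f x else g x).
Proof.
move=> mD mf mg; apply: measurable_fun_if => //; last 2 first.
- exact: measurable_funTS.
- exact: measurable_funTS.
apply: (measurable_fun_bool true) => /=; rewrite setTI [X in measurable X](_ : _ = D)//.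
by apply/seteqP; split => x /=; [move/set_mem|move/mem_set].
Qed.

(* The set [N] is used to discard a null set on which [f] may fail to be
   measurable. *)
Lemma ge0_integral_eq_off mu f h (N : set T) : measurable N -> mu N = 0 ->
  (forall x, 0 <= f x) -> (forall x, 0 <= h x) -> measurable_fun setT h ->
  (forall x, ~ N x -> f x = h x) -> \int[mu]_x f x = \int[mu]_x h x.
Proof.
move=> mN N0 f0 h0 mh fh; apply/eqP; rewrite eq_le; apply/andP; split.
(* On [N] the Borel function is raised to [+oo] for one inequality and lowered to 0 for the
   other. *)
- pose k x := if x \in N then +oo else h x.
  have mk : measurable_fun setT k by exact: measurable_fun_if_in.
  have k0 x : 0 <= k x by rewrite /k; case: ifP.
  apply: (@le_trans _ _ (\int[mu]_x k x)).
    apply: ge0_le_integral_nomeas => // x; rewrite /k; case: ifPn => [_|/negP].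
      exact: leey.
    by rewrite in_setE => /fh ->.
  rewrite le_eqVlt; apply/orP; left; apply/eqP/ge0_ae_eq_integral => //.
  exists N; split => // x /= H; apply: contrapT => Nx; apply: H => _.
  by rewrite /k memNset.
- pose k x := if x \in N then 0 else h x.
  have mk : measurable_fun setT k by exact: measurable_fun_if_in.
  have k0 x : 0 <= k x by rewrite /k; case: ifP.
  apply: (@le_trans _ _ (\int[mu]_x k x)); last first.
    apply: ge0_le_integral_nomeas => // x; rewrite /k; case: ifPn => [_//|/negP].
    by rewrite in_setE => /fh ->.
  rewrite le_eqVlt; apply/orP; left; apply/eqP/ge0_ae_eq_integral => //.
  exists N; split => // x /= H; apply: contrapT => Nx; apply: H => _.
  by rewrite /k memNset.
Qed.

End nonmeasurable_integrals.

Section lebesgue_comparison.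
Context {R : realType}.
Local Open Scope ereal_scope.
Local Notation leb := (@lebesgue_measure R).

(** Lebesgue measure is an infimum over countable covers by half-open intervals, so a bound on these
    passes to all measurable sets by subadditivity of [nu]. *)
Lemma le_scale_lebesgue (nu : {measure set (measurableTypeR R) -> \bar R})
    (C : R) : (0 <= C)%R ->
  (forall a b, (a <= b)%R -> nu `]a, b]%classic <= (C * (b - a))%:E) ->
  forall A, measurable A -> nu A <= C%:E * leb A.
Proof.
move=> C0 nuC A mA.
(* The cover argument divides by [C], so [C = 0] is treated apart, exhausting the line by bounded
   intervals. *)
have [C00|CN0] := eqVneq C 0%R.
  rewrite C00 mul0e.
  pose F k : set (measurableTypeR R) := A `&` `](- k%:R)%R, k%:R%R]%classic.
  have mF k : measurable (F k) by apply: measurableI => //; exact: measurable_itv.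
  have AF : A `<=` \bigcup_k F k.
    move=> x Ax; exists (Num.truncn `|x|).+1 => //; split => //=.
    have : (`|x| < (Num.truncn `|x|).+1%:R)%R by exact: truncnS_gt.
    by rewrite in_itv/= ltr_norml => /andP[-> /ltW ->].
  apply: (le_trans (measure_sigma_subadditive nu mF mA AF)).
  rewrite eseries0// => k _ _; apply/eqP; rewrite eq_le measure_ge0 andbT.
  apply: (@le_trans _ _ (nu `](- k%:R)%R, k%:R%R]%classic)).
    apply: le_measure; [by rewrite inE|by rewrite inE; exact: measurable_itv|].
    exact: subIsetr.
  by have := @nuC (- k%:R)%R k%:R%R; rewrite C00 mul0r; apply; rewrite ge0_cp.
have Cp : (0 < C)%R by rewrite lt_def CN0.
rewrite muleC -lee_pdivrMr//.
rewrite /lebesgue_measure /lebesgue_stieltjes_measure /measure_extension /mu_ext.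
apply: le_ereal_inf_tmp => _ [F [mF AF] <-].
rewrite lee_pdivrMr// muleC -nneseriesZl//.
apply: (@le_trans _ _ (\sum_(0 <= k <oo) nu (F k))).
  apply: measure_sigma_subadditive => // k; exact: sub_sigma_algebra.
apply: lee_nneseries => // k _.
have [[x y] _ <-] := mF k; rewrite /=.
have [xy|yx] := leP x y; last by rewrite set_itv_ge ?measure0 ?wlength0 ?mule0 ?bnd_simp -?leNgt ?ltW.
by rewrite wlength_itv_bnd// /idfun -EFinM; exact: nuC.
Qed.

(* The one-sided change of variables [k s'(t) <= C]; it needs no regularity of
   [s], and also covers translations, dilations and reflections. *)
Lemma ge0_le_integral_substitution (s : R -> R) (D D' : set (measurableTypeR R))
    (k C : R) (f : R -> \bar R) : (0 <= k)%R -> (0 <= C)%R ->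
  measurable D -> measurable D' -> measurable_fun D s ->
  (forall t, D t -> D' (s t)) -> measurable_fun D' f ->
  (forall t, D' t -> 0 <= f t) ->
  (forall x y, (x <= y)%R ->
    k%:E * leb (D `&` s @^-1` `]x, y]%classic) <= (C * (y - x))%:E) ->
  k%:E * \int[leb]_(t in D) f (s t) <= C%:E * \int[leb]_(t in D') f t.
Proof.
move=> k0 C0 mD mD' ms sD mf f0 H.
(* [s] is extended by a default value off [D], which [mrestr leb mD] does not see. The hypothesis
   bounds [k] times the push-forward of that measure on half-open intervals. *)
have mS : @measurable_fun _ _ (measurableTypeR R) (measurableTypeR R) setT (s \_ D)
  by exact/(measurable_restrictT _ _).1.
pose Sm := isMeasurableFun.Build _ _ _ _ _ mS.
pose S : {mfun measurableTypeR R >-> measurableTypeR R} := HB.pack (s \_ D) Sm.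
pose push : {measure set (measurableTypeR R) -> \bar R} :=
  pushforward (mrestr leb mD) S.
pose nu := mscale (NngNum k0) (push mS).
have nuE A : measurable A -> nu A = k%:E * leb (D `&` s @^-1` A).
  move=> mA; rewrite /nu /mscale/= /pushforward /mrestr; congr (_ * leb _).
  by apply/seteqP; split => x []; rewrite /S /patch/=; [move=> + Dx|move=> Dx];
    rewrite mem_set.
have nule A : measurable A -> nu A <= mscale (NngNum C0) leb A.
  move=> mA; rewrite [leRHS]/mscale/=; apply: le_scale_lebesgue => // a b ab.
  rewrite -[leLHS]/(nu `]a, b]%classic) nuE; first exact: H.
  exact: measurable_itv.
have mg : measurable_fun setT (f \_ D') by exact/(measurable_restrictT _ _).1.
have g0 x : 0 <= (f \_ D') x by apply: erestrict_ge0.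
have := ge0_le_measure_integral nule measurableT g0 mg.
rewrite (@ge0_integral_mscale _ _ _ leb setT measurableT)//=.
rewrite -[in leRHS](integral_mkcond D' f) => H1; apply: le_trans H1.
rewrite ge0_integral_mscale//= lee_wpmul2l//.
rewrite (ge0_integral_pushforward mS)//.
rewrite preimage_setT ge0_integral_mrestr//; last 2 first.
- exact: (measurableT_comp mg mS).
- by move=> x; exact: g0.
rewrite le_eqVlt; apply/orP; left; apply/eqP/eq_integral => t /set_mem Dt.
by rewrite /= /patch (mem_set Dt) mem_set//; exact: sD.
Qed.

End lebesgue_comparison.

(** * Uniform convexity of powers *)

Section power_inequality.
Context {R : realType}.
Variable p : R.
Hypothesis p1 : 1 < p.

Let p0 : 0 < p. Proof. exact: lt_trans p1. Qed.

Let ler_p (a b : R) : 0 <= a -> a <= b -> a `^ p <= b `^ p.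
Proof.
move=> a0 ab; apply: ge0_ler_powR => //; first exact: ltW.
by rewrite nnegrE (le_trans a0).
Qed.

(** The gap in midpoint convexity of the [p]-th power between the points 1 and [t]. *)
Definition convexity_defect (t : R) := (1 + t `^ p) / 2 - ((1 + t) / 2) `^ p.

(** The derivative is [p / 2] times [c ^ (p - 1) - ((1 + c) / 2) ^ (p - 1)], negative since [c] lies
    below [(1 + c) / 2]. The point 0 is left out because [powR] is differentiated at positive points
    only. *)
Lemma convexity_defect_decr (x y : R) : 0 < x -> x < y -> y <= 1 ->
  convexity_defect y < convexity_defect x.
Proof.
move=> x0 xy y1.
pose dpsi c : R := (p * c `^ (p - 1)) / 2 - p * ((1 + c) / 2) `^ (p - 1) * 2^-1.
have dE (c : R) : 0 < c -> is_derive c 1 convexity_defect (dpsi c).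
  move=> c0.
  have d1 : is_derive c 1 (fun t : R => t `^ p) (p * c `^ (p - 1)) by exact: is_derive1_powR.
  have d3 : is_derive c 1 (fun t : R => (1 + t) / 2) 2^-1.
    by apply: is_derive_eq; rewrite !scaler0 !add0r /GRing.scale/= mulr1.
  have c2 : 0 < (1 + c) / 2 by rewrite divr_gt0// addr_gt0.
  have d2 : is_derive c 1 (fun t : R => ((1 + t) / 2) `^ p)
      (p * ((1 + c) / 2) `^ (p - 1) * 2^-1).
    have d := is_derive1_powR p c2.
    exact: (@is_derive1_comp _ (fun t : R => t `^ p) (fun t : R => (1 + t) / 2)).
  rewrite /convexity_defect /dpsi.
  apply: is_derive_eq; rewrite !scaler0 !add0r /GRing.scale/=. ring.
have [| |c] := @MVT _ convexity_defect dpsi x y xy.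
- by move=> c; rewrite in_itv/= => /andP[xc _]; apply: dE; exact: lt_trans xc.
- apply: derivable_within_continuous => c; rewrite in_itv/= => /andP[xc _].
  by have [] := dE c (lt_le_trans x0 xc).
rewrite in_itv/= => /andP[xc cy] E; rewrite -subr_lt0 E.
rewrite pmulr_llt0 ?subr_gt0// /dpsi -mulrA -[X in _ - X]mulrA -mulrBr.
rewrite pmulr_rlt0// subr_lt0 ltr_pM2r ?invr_gt0//.
apply: gt0_ltr_powR; rewrite ?subr_gt0// ?nnegrE; lra.
Qed.

(** Near [t = 1] the left side is at most [e]; away from 1 the defect is bounded below by a positive
    number, whose inverse serves as [C]. *)
Lemma convexity_defect_bound (e : R) : 0 < e -> exists2 C, 0 < C &
  forall t : R, 0 <= t <= 1 -> 0 <= convexity_defect t /\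
    1 - t `^ p <= e * (1 + t `^ p) + C * convexity_defect t.
Proof.
move=> e0.
have d1 : convexity_defect 1 = 0.
  by rewrite /convexity_defect powR1 (_ : (1 + 1) / 2 = 1) ?powR1 ?subrr//; lra.
have d0 : 0 < convexity_defect 0.
  rewrite /convexity_defect powR0 ?gt_eqF// addr0 mul1r subr_gt0.
  have h : 0 <= (2^-1 : R) by rewrite invr_ge0.
  rewrite -(mulr_powRB1 h p0) -[ltRHS]mulr1 ltr_pM2l ?invr_gt0//.
  suff : 2^-1 `^ (p - 1) < 1 `^ (p - 1) by rewrite powR1.
  apply: gt0_ltr_powR.
  - by rewrite subr_gt0.
  - by rewrite nnegrE.
  - by rewrite nnegrE.
  - by rewrite invf_lt1// ltr1n.
have dp (t : R) : 0 < t -> t < 1 -> 0 < convexity_defect t.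
  by move=> t0 t1; rewrite -d1; exact: convexity_defect_decr.
have dge0 (t : R) : 0 <= t <= 1 -> 0 <= convexity_defect t.
  move=> /andP[]; rewrite le_eqVlt => /predU1P[<- _|t0]; first exact: ltW.
  rewrite le_eqVlt => /predU1P[->|t1]; first by rewrite d1.
  exact/ltW/dp.
have [e1|e1] := leP 1 e.
  exists 1 => // t t01; split; first exact: dge0.
  have := dge0 t t01; have := powR_ge0 t p => H1 H2.
  have : (e - 1) * (1 + t `^ p) >= 0 by rewrite mulr_ge0; lra.
  lra.
pose t0 := (1 - e) `^ p^-1.
have t00 : 0 < t0 by rewrite powR_gt0; lra.
have t0p : t0 `^ p = 1 - e by rewrite -powRrM mulVf ?gt_eqF// powRr1; lra.
have t01 : t0 < 1.
  rewrite ltNge; apply/negP => h.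
  have : 1 `^ p <= t0 `^ p by apply: ler_p => //; exact: ltW.
  rewrite powR1 t0p; lra.
(* Monotonicity is available on []0, 1]], so the value at 0 enters the minimum separately. *)
pose m := Num.min (convexity_defect 0) (convexity_defect t0).
have m0 : 0 < m by rewrite lt_min d0 dp.
exists m^-1; first by rewrite invr_gt0.
move=> t /[dup] t01' /andP[tge0 tle1]; split; first exact: dge0.
have tp := powR_ge0 t p.
have dt := dge0 t t01'.
have [tt0|t0t] := ltP t t0.
  have : m <= convexity_defect t.
    move: tge0; rewrite le_eqVlt => /predU1P[<-|tp0]; first by rewrite ge_min lexx.
    rewrite ge_min; apply/orP; right; apply: ltW.
    by apply: convexity_defect_decr => //; exact: ltW.
  move=> H; have : 1 <= m^-1 * convexity_defect t by rewrite ler_pdivlMl// mulr1.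
  have : 0 <= e * (1 + t `^ p) by rewrite mulr_ge0; lra.
  lra.
have : t0 `^ p <= t `^ p by apply: ler_p => //; exact: ltW.
rewrite t0p => H.
have : 0 <= e * t `^ p by rewrite mulr_ge0// ltW.
have : 0 <= m^-1 * convexity_defect t by rewrite mulr_ge0// invr_ge0 ltW.
lra.
Qed.

(** Homogeneity reduces it to the defect at [t = a / b]; for [b < a] the positive part vanishes and
    symmetry applies. The midpoint term stands on the left, so that no possibly infinite quantity is
    subtracted once the inequality is integrated. *)
Lemma powR_midpoint_bound (e : R) : 0 < e -> exists2 C, 0 < C &
  forall a b : R, 0 <= a -> 0 <= b ->
  Num.max 0 (b `^ p - a `^ p) + C * ((a + b) / 2) `^ p <=
  (e + C / 2) * (a `^ p + b `^ p).
Proof.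
move=> e0; have [C C0 H] := convexity_defect_bound e0; exists C => // a b a0 b0.
wlog ab : a b a0 b0 / a <= b => [K|].
  have [|/ltW ba] := leP a b; first exact: K.
  have := K b a b0 a0 ba; rewrite (addrC b) (addrC (b `^ p)).
  apply: le_trans; rewrite lerD2r.
  have h : b `^ p <= a `^ p by apply: ler_p => //; exact: ltW.
  by rewrite le_max; apply/orP; left; rewrite ge_max lexx subr_le0 h.
have abp : a `^ p <= b `^ p by apply: ler_p => //; exact: ltW.
rewrite (max_idPr _) ?subr_ge0//.
move: b0; rewrite le_eqVlt => /predU1P[b0|b0].
  have -> : a = 0 by apply/eqP; rewrite eq_le a0 andbT b0.
  by rewrite -b0 !addr0 mul0r powR0 ?gt_eqF// subrr addr0 !mulr0 addr0.
have t01 : 0 <= a / b <= 1 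
  by apply/andP; split; [apply: divr_ge0 => //; exact: ltW|rewrite ler_pdivrMr// mul1r].
have [D0 D] := H _ t01.
have bp : 0 < b `^ p by exact: powR_gt0.
have aE : a `^ p = b `^ p * (a / b) `^ p.
  rewrite -powRM; last by case/andP: t01.
    by rewrite mulrC divfK// gt_eqF.
  exact: ltW.
have mE : ((a + b) / 2) `^ p = b `^ p * ((1 + a / b) / 2) `^ p.
  rewrite -powRM; last by case/andP: t01 => ? ?; rewrite divr_ge0// addr_ge0.
    by congr (_ `^ p); field; rewrite gt_eqF.
  exact: ltW.
rewrite aE mE; move: D; rewrite /convexity_defect.
set B := b `^ p; set T := (a / b) `^ p; set M := (_ / 2) `^ p => D.
have : B * (1 - T) <= B * (e * (1 + T) + C * ((1 + T) / 2 - M)) by rewrite ler_wpM2l// ltW.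
lra.
Qed.

Local Open Scope ereal_scope.

Lemma poweR_midpoint_bound (e : R) : (0 < e)%R -> exists2 C, (0 < C)%R &
  forall a b : \bar R, 0 <= a -> 0 <= b ->
  maxe 0 (b `^ p - a `^ p) + C%:E * ((a + b) * 2^-1%:E) `^ p <=
  (e + C / 2)%:E * (a `^ p + b `^ p).
Proof.
move=> e0; have [C C0 H] := powR_midpoint_bound e0; exists C => // a b a0 b0.
have cp : 0 < (e + C / 2)%:E by rewrite lte_fin addr_gt0// divr_gt0.
have pN0 : p != 0%R by rewrite gt_eqF.
have pNy (x : \bar R) : x `^ p != -oo.
  by rewrite gt_eqF// (lt_le_trans (ltNyr 0) (poweR_ge0 _ _)).
have [->|aN] := eqVneq a +oo.
  by rewrite poweRyr// [in leRHS]addye// [leRHS]gt0_muley// leey.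
have [->|bN] := eqVneq b +oo.
  by rewrite poweRyr// [in leRHS]addey// [leRHS]gt0_muley// leey.
have af : a \is a fin_num by rewrite ge0_fin_numE// lt_neqAle aN leey.
have bf : b \is a fin_num by rewrite ge0_fin_numE// lt_neqAle bN leey.
rewrite -(fineK af) -(fineK bf) -EFinD -EFinM !poweR_EFin.
rewrite -EFin_max -!EFinD -EFinM lee_fin; apply: H; exact: fine_ge0.
Qed.

End power_inequality.

(** * Rectifiable curves *)

Section length.
Context {R : realType} {X : metricType R}.
Implicit Types (gamma : R -> X) (a b c : R) (s : seq R).

Lemma partition_length_nil gamma a b : partition_length gamma a b [::] = 0.
Proof. by rewrite /partition_length/= big_nil. Qed.

Lemma partition_length_cons gamma a b x s :
  partition_length gamma a b (x :: s) =
  mdist (gamma a) (gamma x) + partition_length gamma x b s.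
Proof. by rewrite /partition_length /= big_nat_recl. Qed.

Lemma partition_length_cat gamma a b c s1 s2 : last a s1 = c ->
  partition_length gamma a b (s1 ++ s2) =
  partition_length gamma a c s1 + partition_length gamma c b s2.
Proof.
elim: s1 a => [a/= ->|x s1 ih a /= l]; first by rewrite partition_length_nil add0r.
by rewrite !partition_length_cons ih// addrA.
Qed.

Lemma partition_length_ge gamma a b s : itv_partition a b s ->
  mdist (gamma a) (gamma b) <= partition_length gamma a b s.
Proof.
elim: s a => [a /itv_partition_nil ->|x s ih a abs].
  by rewrite mdistxx partition_length_nil.
rewrite partition_length_cons (le_trans (metric_triangle _ (gamma x) _))//.
by rewrite lerD2l ih//; exact: itv_partition_cons abs.
Qed.

Lemma itv_partition_exists a b : a <= b -> exists s, itv_partition a b s.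
Proof.
rewrite le_eqVlt => /predU1P[->|ab].
  by exists [::]; split => //=.
by exists [:: b]; exact: itv_partition1.
Qed.

Lemma partition_length_split gamma a b c s : a <= c -> c <= b ->
  itv_partition a b s -> exists s1 s2,
    [/\ itv_partition a c s1, itv_partition c b s2 &
     partition_length gamma a b s <=
     partition_length gamma a c s1 + partition_length gamma c b s2].
Proof.
elim: s a => [a ac cb ab|x s ih a ac cb abs].
  have /eqP eab := itv_partition_nil ab.
  have ea : a = c.
    by apply/eqP; rewrite eq_le ac (eqP eab) cb.
  exists [::], [::]; rewrite -ea; split => //.
  by rewrite !partition_length_nil addr0.
have xb := itv_partition_cons abs.
have ax : a < x by case: abs => /= /andP[].
move: ac; rewrite le_eqVlt => /predU1P[<-|ac].
  exists [::], (x :: s); split => //.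
  by rewrite partition_length_nil add0r.
have [cx|xc] := ltP c x.
  exists [:: c], (x :: s); split.
  - exact: itv_partition1.
  - by case: abs => /= /andP[_ p] l; split => //=; rewrite cx.
  - rewrite !partition_length_cons partition_length_nil addr0 addrA lerD2r.
    exact: metric_triangle.
have [s1 [s2 [H1 H2 H3]]] := ih x xc cb xb.
exists (x :: s1), s2; split => //.
  by case: H1 => /= p l; split => //=; rewrite ax.
by rewrite !partition_length_cons -addrA lerD2l.
Qed.

Local Open Scope ereal_scope.

Lemma partition_length_le gamma a b s : itv_partition a b s ->
  (partition_length gamma a b s)%:E <= curve_length gamma a b.
Proof. by move=> abs; apply: ereal_sup_ubound; exists s. Qed.

Lemma curve_length_ge gamma a b : (a <= b)%R ->
  (mdist (gamma a) (gamma b))%:E <= curve_length gamma a b.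
Proof.
move=> /itv_partition_exists[s abs]; apply: le_trans (partition_length_le gamma abs).
by rewrite lee_fin partition_length_ge.
Qed.

Lemma curve_length_ge0 gamma a b : (a <= b)%R -> 0 <= curve_length gamma a b.
Proof.
by move=> ab; apply: le_trans (curve_length_ge gamma ab); rewrite lee_fin mdist_ge0.
Qed.

Lemma curve_lengthxx gamma a : curve_length gamma a a = 0.
Proof.
apply/eqP; rewrite eq_le curve_length_ge0// andbT.
apply: ge_ereal_sup => _ [s /itv_partitionxx -> <-].
by rewrite partition_length_nil.
Qed.

Lemma curve_lengthD gamma a b c : (a <= c)%R -> (c <= b)%R ->
  curve_length gamma a b = curve_length gamma a c + curve_length gamma c b.
Proof.
move=> ac cb; apply/eqP; rewrite eq_le; apply/andP; split.
  apply: ge_ereal_sup => _ [s abs <-].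
  have [s1 [s2 [H1 H2 H3]]] := partition_length_split gamma ac cb abs.
  apply: (@le_trans _ _ (partition_length gamma a c s1 +
    partition_length gamma c b s2)%:E); first by rewrite lee_fin.
  by rewrite EFinD leeD// partition_length_le.
have H s1 s2 : itv_partition a c s1 -> itv_partition c b s2 ->
    (partition_length gamma a c s1)%:E + (partition_length gamma c b s2)%:E <=
    curve_length gamma a b.
  move=> p1 p2; rewrite -EFinD -(@partition_length_cat _ _ _ c)//; last first.
    by case: p1 => _ /eqP.
  by apply: partition_length_le; exact: itv_partition_cat p1 p2.
have [s1 p1] := itv_partition_exists ac.
have K s2 : itv_partition c b s2 ->
    curve_length gamma a c <= curve_length gamma a b - (partition_length gamma c b s2)%:E.
  move=> p2; apply: ge_ereal_sup => _ [s' p' <-].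
  by rewrite leeBrDr// H.
have [->|Lfin] := eqVneq (curve_length gamma a b) +oo; first exact: leey.
have fac : curve_length gamma a c \is a fin_num.
  rewrite ge0_fin_numE ?curve_length_ge0//.
  have [s2 p2] := itv_partition_exists cb.
  by apply: le_lt_trans (K _ p2) _; rewrite lteBlDr//= ltey.
rewrite -leeBrDl//; apply: ge_ereal_sup => _ [s2 p2 <-].
by rewrite leeBrDl// -leeBrDr// K.
Qed.

Lemma curve_length_lip gamma (L : R) a b : (0 <= L)%R -> (a <= b)%R ->
  (forall u v, a <= u <= b -> a <= v <= b ->
     mdist (gamma u) (gamma v) <= L * `|u - v|)%R ->
  curve_length gamma a b <= (L * (b - a))%:E.
Proof.
move=> L0 ab H; apply: ge_ereal_sup => _ [s abs <-]; rewrite lee_fin.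
elim: s a ab H abs => [a ab _ _|x s ih a ab H abs].
  by rewrite partition_length_nil mulr_ge0// subr_ge0.
have xb := itv_partition_cons abs.
have xb' := itv_partition_le xb.
have ax : (a < x)%R by case: abs => /= /andP[].
rewrite partition_length_cons.
have -> : (L * (b - a) = L * (x - a) + L * (b - x))%R by ring.
apply: lerD.
  rewrite (le_trans (H _ _ _ _))//; rewrite ?lexx ?ab ?(ltW ax)//.
  by rewrite distrC ger0_norm// subr_ge0 ltW.
apply: ih => // u v /andP[u1 u2] /andP[v1 v2].
by apply: H; rewrite ?u2 ?v2 ?andbT; apply/ltW/(lt_le_trans ax).
Qed.

(** The last chord of a partition is cut at a point [w] close to [b], at a cost below [e] by
    continuity at [b]. With its mirror image below, this says that arc length does not jump. *)
Lemma curve_length_left gamma a b (M : R) : (a < b)%R ->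
  (forall e, 0 < e -> exists2 d, 0 < d & forall u, a <= u <= b -> b - d < u ->
     mdist (gamma u) (gamma b) < e)%R ->
  (forall u, (a <= u < b)%R -> curve_length gamma a u <= M%:E) ->
  curve_length gamma a b <= M%:E.
Proof.
move=> ab cont H; apply: ge_ereal_sup => _ [s abs <-]; rewrite lee_fin.
apply/ler_addgt0Pr => e e0; have [d d0 D] := cont e e0.
case/lastP: s abs => [/itv_partition_nil eab|s y [p /eqP]].
  by move: ab; rewrite eab ltxx.
rewrite last_rcons => yb; subst y.
move: p; rewrite rcons_path => /andP[p lb].
set z := last a s in lb *.
have az : (a <= z)%R.
  by apply: (@itv_partition_le _ _ _ _ s); split => //.
pose w := Num.max ((z + b) / 2)%R (b - d / 2)%R.
have wb : (w < b)%R by rewrite gt_max; apply/andP; split; lra.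
have zw : (z < w)%R by rewrite lt_max; apply/orP; left; lra.
have dw : (b - d < w)%R by rewrite lt_max; apply/orP; right; lra.
have aw : (a <= w)%R by apply: le_trans (ltW zw).
have := H w; rewrite aw wb => /(_ isT).
have pw : itv_partition a w (rcons s w).
  by split; rewrite ?rcons_path ?p//= last_rcons.
move=> /(le_trans (partition_length_le gamma pw)).
rewrite lee_fin -!cats1 !(@partition_length_cat _ _ _ z)// !partition_length_cons.
rewrite !partition_length_nil !addr0 => H1.
have := D w; rewrite aw (ltW wb) => /(_ isT dw).
have := metric_triangle (gamma z) (gamma w) (gamma b); lra.
Qed.

Lemma curve_length_right gamma a b (M : R) : (a < b)%R ->
  (forall e, 0 < e -> exists2 d, 0 < d & forall u, a <= u <= b -> u < a + d ->
     mdist (gamma u) (gamma a) < e)%R ->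
  (forall u, (a < u <= b)%R -> curve_length gamma u b <= M%:E) ->
  curve_length gamma a b <= M%:E.
Proof.
move=> ab cont H; apply: ge_ereal_sup => _ [s abs <-]; rewrite lee_fin.
apply/ler_addgt0Pr => e e0; have [d d0 D] := cont e e0.
case: s abs => [/itv_partition_nil eab|y s abs].
  by move: ab; rewrite eab ltxx.
have yb := itv_partition_cons abs.
have yb' := itv_partition_le yb.
have ay : (a < y)%R by case: abs => /= /andP[].
pose w := Num.min ((a + y) / 2)%R (a + d / 2)%R.
have aw : (a < w)%R by rewrite lt_min; apply/andP; split; lra.
have wy : (w < y)%R by rewrite gt_min; apply/orP; left; lra.
have dw : (w < a + d)%R by rewrite gt_min; apply/orP; right; lra.
have wb : (w <= b)%R by apply: le_trans (ltW wy) _.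
have := H w; rewrite aw wb => /(_ isT).
have pw : itv_partition w b (y :: s).
  by case: yb => p l; split => //=; rewrite wy.
move=> /(le_trans (partition_length_le gamma pw)).
rewrite lee_fin !partition_length_cons => H1.
have := D w; rewrite (ltW aw) wb => /(_ isT dw).
rewrite metric_sym.
have := metric_triangle (gamma a) (gamma w) (gamma y); lra.
Qed.

End length.

(** * The constant-speed parametrization *)

Section constant_speed.
Context {R : realType} {X : metricType R}.
Variable gamma : R -> X.
Hypothesis gamma_rect : rectifiable gamma.
Local Open Scope ereal_scope.

Let cont (t e : R) : (0 <= t <= 1)%R -> (0 < e)%R -> exists2 d, (0 < d)%R &
  forall s, (0 <= s <= 1)%R -> (`|t - s| < d)%R -> (mdist (gamma s) (gamma t) < e)%R.
Proof.
move=> t01 e0; case: gamma_rect => /subspace_continuousP /(_ t) H _.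
have {}H : gamma @ within `[0%R, 1%R] (nbhs t) --> gamma t by apply: H; rewrite /= in_itv.
have : nbhs (gamma t) (ball (gamma t) e) by exact: nbhsx_ballx.
move=> /H; rewrite /nbhs/= /within/= => /nbhs_ballP[d /= d0 dP].
exists d => // s s01 st; rewrite metric_sym.
have /dP : ball t d s by [].
by rewrite /= in_itv/= => /(_ s01); rewrite ballEmdist.
Qed.

Let Lam := fine (curve_length gamma 0 1).

Let LamE : curve_length gamma 0 1 = Lam%:E.
Proof.
rewrite /Lam fineK// ge0_fin_numE ?curve_length_ge0//.
by case: gamma_rect.
Qed.

Let ell s := fine (curve_length gamma 0 s).

Let ellE (s : R) : (0 <= s <= 1)%R -> curve_length gamma 0 s = (ell s)%:E.
Proof.
move=> /andP[s0 s1]; rewrite /ell fineK// ge0_fin_numE ?curve_length_ge0//.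
case: gamma_rect => _; apply: le_lt_trans.
by rewrite (curve_lengthD gamma s0 s1) leeDl// curve_length_ge0.
Qed.

Let Lam_ge0 : (0 <= Lam)%R.
Proof. by rewrite -lee_fin -LamE curve_length_ge0. Qed.

Let ell_itv (s t : R) : (0 <= s)%R -> (s <= t)%R -> (t <= 1)%R ->
  curve_length gamma s t = (ell t - ell s)%:E.
Proof.
move=> s0 st t1; have t0 := le_trans s0 st; have s1 := le_trans st t1.
have := curve_lengthD gamma s0 st; rewrite !ellE ?t0 ?s0//.
case: (curve_length gamma s t) => // r; rewrite -EFinD => -[->].
by rewrite addrAC subrr add0r.
Qed.

Let ell1 : ell 1 = Lam. Proof. by []. Qed.
Let ell0 : ell 0 = 0%R. Proof. by rewrite /ell curve_lengthxx. Qed.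

Let ell_nd (s t : R) : (0 <= s)%R -> (s <= t)%R -> (t <= 1)%R -> (ell s <= ell t)%R.
Proof.
by move=> s0 st t1; rewrite -subr_ge0 -lee_fin -ell_itv// curve_length_ge0.
Qed.

(** The parameter inside [constant_speed]: a generalized inverse of the normalized arc length. It
    may jump where [gamma] rests, but it is nondecreasing, hence measurable. *)
Definition arc_inv t : R := inf [set s : R | s \in `[0%R, 1%R] /\
                t%:E * curve_length gamma 0 1 <= curve_length gamma 0 s].

Lemma constant_speedE t : constant_speed gamma t = gamma (arc_inv t).
Proof. by []. Qed.

Let S t : set R := [set s : R | s \in `[0%R, 1%R] /\
                t%:E * curve_length gamma 0 1 <= curve_length gamma 0 s].

Let SP (t s : R) : S t s <-> (0 <= s <= 1)%R /\ (t * Lam <= ell s)%R.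
Proof.
rewrite /S/= in_itv/= LamE -EFinM; split => -[H1]; rewrite ellE// lee_fin => H2;
  by split.
Qed.

Let S1 (t : R) : (0 <= t <= 1)%R -> S t 1%R.
Proof. by move=> /andP[t0 t1]; apply/SP; rewrite ler01 lexx ell1; split=> //; exact: ler_piMl. Qed.

Let Slb (t : R) : lbound (S t) 0%R.
Proof. by move=> s /SP[/andP[]]. Qed.

Lemma arc_inv_itv (t : R) : (0 <= t <= 1)%R -> (0 <= arc_inv t <= 1)%R.
Proof.
move=> t01; apply/andP; split.
  by apply: lb_le_inf; [exists 1%R; exact: S1|exact: Slb].
by apply: ge_inf; [exists 0%R; exact: Slb|exact: S1].
Qed.

Let arc_inv_lt (t s : R) : (0 <= t <= 1)%R -> (0 <= s)%R -> (s < arc_inv t)%R ->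
  (ell s < t * Lam)%R.
Proof.
move=> t01 s0 st; rewrite ltNge; apply/negP => H.
have /andP[_ st1] := arc_inv_itv t01.
have : (arc_inv t <= s)%R.
  apply: ge_inf; first by exists 0%R; exact: Slb.
  by apply/SP; rewrite s0 (le_trans (ltW st)).
by rewrite leNgt st.
Qed.

Let arc_inv_gt (t s : R) : (0 <= t <= 1)%R -> (s <= 1)%R -> (arc_inv t < s)%R ->
  (t * Lam <= ell s)%R.
Proof.
move=> t01 s1 ts.
have [y /SP[/andP[y0 y1] yS] ys] : exists2 y, S t y & (y < s)%R.
  by apply: inf_lt => //; exists 1%R; exact: S1.
by apply: (le_trans yS); apply: ell_nd => //; exact: ltW.
Qed.

(** Every parameter before [arc_inv t] has arc length below the target and every later one at least
    the target; since arc length does not jump, equality holds at [arc_inv t]. *)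
Lemma ell_arc_inv (t : R) : (0 <= t <= 1)%R ->
  curve_length gamma 0 (arc_inv t) = (t * fine (curve_length gamma 0 1))%:E.
Proof.
move=> t01; have /andP[i0 i1] := arc_inv_itv t01.
have /andP[t0 t1] := t01.
have tL0 : (0 <= t * Lam)%R by rewrite mulr_ge0.
have tL1 : (t * Lam <= Lam)%R by exact: ler_piMl.
apply/eqP; rewrite eq_le; apply/andP; split.
  have [ip|ip] := ltP 0%R (arc_inv t); last first.
    have -> : arc_inv t = 0%R by apply/eqP; rewrite eq_le ip.
    by rewrite curve_lengthxx lee_fin.
  apply: curve_length_left => //.
    move=> e e0; have [d d0 D] := cont (arc_inv_itv t01) e0.
    exists d => // u /andP[u0 u1] ud; apply: D.
      by rewrite u0 (le_trans u1).
    by rewrite ger0_norm ?subr_ge0//; lra.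
  move=> u /andP[u0 u1]; rewrite ellE ?u0 ?(le_trans (ltW u1))//.
  by rewrite lee_fin ltW// arc_inv_lt.
rewrite (ellE (arc_inv_itv t01)) lee_fin -/Lam.
have : curve_length gamma (arc_inv t) 1 <= (Lam - t * Lam)%:E.
  have [ip|ip] := ltP (arc_inv t) 1%R; last first.
    have -> : arc_inv t = 1%R by apply/eqP; rewrite eq_le ip i1.
    by rewrite curve_lengthxx lee_fin; lra.
  apply: curve_length_right => //.
    move=> e e0; have [d d0 D] := cont (arc_inv_itv t01) e0.
    exists d => // u /andP[u0 u1] ud; apply: D.
      by rewrite u1 (le_trans i0).
    by rewrite distrC ger0_norm ?subr_ge0//; lra.
  move=> u /andP[u0 u1]; rewrite ell_itv//; last by rewrite (le_trans i0)// ltW.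
  by rewrite lee_fin ell1 lerD2l lerN2 arc_inv_gt.
by rewrite ell_itv// lee_fin ell1 lerD2l lerN2.
Qed.

Let ellA (t : R) : (0 <= t <= 1)%R -> ell (arc_inv t) = (t * Lam)%R.
Proof.
by move=> t01; apply/EFin_inj; rewrite -ellE ?arc_inv_itv// ell_arc_inv.
Qed.

Lemma arc_inv_nd (s t : R) : (0 <= s)%R -> (s <= t)%R -> (t <= 1)%R ->
  (arc_inv s <= arc_inv t)%R.
Proof.
move=> s0 st t1.
have t01 : (0 <= t <= 1)%R by rewrite t1 (le_trans s0).
have s01 : (0 <= s <= 1)%R by rewrite s0 (le_trans st).
apply: ge_inf; first by exists 0%R; exact: Slb.
by apply/SP; rewrite arc_inv_itv// ellA//; split => //; rewrite ler_wpM2r.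
Qed.

Let constant_speed_lip1 (s t : R) : (0 <= s)%R -> (s <= t)%R -> (t <= 1)%R ->
  (mdist (constant_speed gamma s) (constant_speed gamma t) <= Lam * `|s - t|)%R.
Proof.
move=> s0 st t1.
have t01 : (0 <= t <= 1)%R by rewrite t1 (le_trans s0).
have s01 : (0 <= s <= 1)%R by rewrite s0 (le_trans st).
have st' := arc_inv_nd s0 st t1.
have := curve_length_ge gamma st'.
have /andP[a0 a1] := arc_inv_itv s01.
have /andP[b0 b1] := arc_inv_itv t01.
rewrite ell_itv// lee_fin !ellA// => /le_trans; apply.
by rewrite distrC ger0_norm ?subr_ge0// mulrBr ![(Lam * _)%R]mulrC.
Qed.

Lemma constant_speed_lip (s t : R) : (0 <= s <= 1)%R -> (0 <= t <= 1)%R ->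
  (mdist (constant_speed gamma s) (constant_speed gamma t) <=
   fine (curve_length gamma 0 1) * `|s - t|)%R.
Proof.
move=> /andP[s0 s1] /andP[t0 t1]; have [st|/ltW ts] := leP s t.
  exact: constant_speed_lip1.
by rewrite metric_sym distrC; exact: constant_speed_lip1.
Qed.

Lemma constant_speed0 : constant_speed gamma 0 = gamma 0%R.
Proof.
rewrite constant_speedE; congr gamma; apply/eqP.
rewrite eq_le; have /andP[-> _] : (0 <= arc_inv 0 <= 1)%R.
  by rewrite arc_inv_itv// lexx ler01.
rewrite andbT; apply: ge_inf; first by exists 0%R; exact: Slb.
by apply/SP; rewrite lexx ler01 mul0r ell0.
Qed.

(** [arc_inv 1] lies before 1 if [gamma] rests at its end; the points agree because the remaining
    arc has length 0. *)
Lemma constant_speed1 : constant_speed gamma 1 = gamma 1%R.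
Proof.
rewrite constant_speedE; apply: mdist_positivity.
have i1 : (0 <= (1 : R) <= 1)%R by rewrite ler01 lexx.
have /andP[a0 a1] := arc_inv_itv i1.
apply/eqP; rewrite eq_le mdist_ge0 andbT -lee_fin.
apply: le_trans (curve_length_ge gamma a1) _.
by rewrite ell_itv// ellA// ell1 mul1r subrr.
Qed.

(** For the change of variables by [arc_inv]: the preimage of an interval is confined by the arc
    lengths at its end points, clamped to [[0, 1]]. *)
Lemma arc_inv_oc (x y t : R) : (0 <= t <= 1)%R -> (x <= y)%R ->
  `]x, y]%classic (arc_inv t) ->
  (ell (Num.max 0 (Num.min x 1)) <= t * Lam <= ell (Num.max 0 (Num.min y 1)))%R.
Proof.
move=> t01 xy; rewrite /= in_itv/= => /andP[xt ty].
have /andP[a0 a1] := arc_inv_itv t01.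
rewrite -ellA//; apply/andP; split; apply: ell_nd => //.
- by rewrite le_max lexx.
- by rewrite ge_max a0 ge_min ltW.
- by rewrite le_max le_min ty a1 orbT.
- by rewrite ge_max ler01 ge_min lexx orbT.
Qed.

End constant_speed.

(** * Lipschitz curves and their path integrals *)

Section lipschitz_curves.
Context {R : realType} {X : pointedMetricType R}.
Implicit Types (c : R -> X) (g : borelType X -> \bar R) (L a b : R).
Local Notation leb := (@lebesgue_measure R).

(** The bound is asked on the whole line, so that reparametrizations compose without side
    conditions; a curve on an interval is extended by constants through [clamp]. *)
Definition lipschitz_curve L c :=
  forall s t, mdist (c s) (c t) <= L * `|s - t|.

Definition clamp a b t : R := Num.max a (Num.min t b).

Lemma clamp_itv a b t : a <= b -> a <= clamp a b t <= b.
Proof. by move=> ab; rewrite /clamp le_max lexx ge_max ab ge_min lexx orbT. Qed.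

Lemma clamp_id a b t : a <= t <= b -> clamp a b t = t.
Proof.
by move=> /andP[at' tb]; rewrite /clamp (min_idPl tb) (max_idPr at').
Qed.

Lemma clamp_nd a b : {homo clamp a b : s t / s <= t}.
Proof.
move=> s t st; rewrite /clamp; have [] := leP s b; have [] := leP t b => ? ?;
 repeat (match goal with |- context [Num.max ?x ?y] => case: (leP x y) => ? end); lra.
Qed.

Lemma clamp_lip a b s t : `|clamp a b s - clamp a b t| <= `|s - t|.
Proof.
wlog st : s t / s <= t.
  move=> H; have [/H//|/ltW/H] := leP s t.
  by rewrite distrC (distrC t).
rewrite (distrC (clamp a b s)) (distrC s) !ger0_norm ?subr_ge0 ?clamp_nd//.
rewrite /clamp; have [] := leP s b; have [] := leP t b => ? ?;
 repeat (match goal with |- context [Num.max ?x ?y] => case: (leP x y) => ? end); lra.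
Qed.

Lemma lipschitz_curve_ge0 L c : lipschitz_curve L c -> 0 <= L.
Proof.
move=> /(_ 0 1); rewrite sub0r normrN normr1 mulr1; apply: le_trans.
exact: mdist_ge0.
Qed.

Lemma lipschitz_curve_comp L M (s : R -> R) c : lipschitz_curve L c ->
  (forall x y, `|s x - s y| <= M * `|x - y|) -> lipschitz_curve (L * M) (c \o s).
Proof.
move=> lc ls x y; rewrite -mulrA; apply: le_trans (lc _ _) _.
by apply: ler_wpM2l => //; exact: lipschitz_curve_ge0 lc.
Qed.

Lemma lipschitz_curve_clamp L a b c : lipschitz_curve L c ->
  lipschitz_curve L (c \o clamp a b).
Proof.
move=> /lipschitz_curve_comp H; rewrite -(mulr1 L); apply: H => x y.
by rewrite mul1r clamp_lip.
Qed.

Lemma lipschitz_curve_cont L c : lipschitz_curve L c -> continuous c.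
Proof.
move=> lc t; apply/cvg_ballP => e e0; have L0 := lipschitz_curve_ge0 lc.
have L1 : 0 < L + 1 by lra.
near=> s; rewrite ballEmdist/=; apply: le_lt_trans (lc t s) _.
apply: (@le_lt_trans _ _ ((L + 1) * `|t - s|)).
  by apply: ler_wpM2r => //; lra.
rewrite -ltr_pdivlMl//.
near: s; apply/nbhs_ballP; exists ((L + 1)^-1 * e) => /=.
  by apply: mulr_gt0; rewrite ?invr_gt0.
by move=> s.
Unshelve. all: by end_near. Qed.

Lemma continuous_borel c : continuous c ->
  measurable_fun [set: measurableTypeR R] (c : R -> borelType X).
Proof.
move=> cc; apply: (@measurability _ _ _ (borelType X) _ _ (@open X)) => //.
move=> _ [A oA <-]; rewrite setTI; apply: open_measurable.
by apply: open_comp => // x _; exact: cc.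
Qed.

Lemma measurable_comp_curve L c g D : lipschitz_curve L c ->
  measurable_fun [set: borelType X] g ->
  measurable_fun (D : set (measurableTypeR R)) (g \o c).
Proof.
move=> lc mg; apply: measurable_funTS.
apply: measurableT_comp => //.
exact: continuous_borel (lipschitz_curve_cont lc).
Qed.

Local Open Scope ereal_scope.

Lemma lipschitz_curve_length L c : lipschitz_curve L c ->
  curve_length c 0 1 <= L%:E.
Proof.
move=> lc; rewrite -[L]mulr1 -[X in (_ * X)%:E]subr0.
apply: curve_length_lip => //; exact: lipschitz_curve_ge0 lc.
Qed.

Lemma lipschitz_curve_rectifiable L c : lipschitz_curve L c -> rectifiable c.
Proof.
move=> lc; split; last exact: le_lt_trans (lipschitz_curve_length lc) (ltry _).
by apply: continuous_subspaceT; exact: lipschitz_curve_cont lc.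
Qed.

Let clampE (t : R) : t \in `[0%R, 1%R] -> clamp 0 1 t = t.
Proof. by rewrite in_itv/= => /clamp_id. Qed.

Lemma measurable_arc_inv c : rectifiable c ->
  measurable_fun (`[0%R, 1%R] : set (measurableTypeR R)) (arc_inv c).
Proof.
move=> rc; have : measurable_fun [set: measurableTypeR R] (arc_inv c \o clamp 0 1).
  apply: nondecreasing_measurable => // s t st.
  have /andP[? ?] := clamp_itv s (@ler01 R).
  have /andP[? ?] := clamp_itv t (@ler01 R).
  by apply: arc_inv_nd => //; exact: clamp_nd.
move=> m; have := measurable_funTS (D := `[0%R, 1%R]%classic : set (measurableTypeR R)) m.
apply: eq_measurable_fun => t.
by rewrite inE/= => /clampE ->.
Qed.

(** The constant-speed integrand is [g (c (arc_inv c t))], and the arc of [c] over [[x, y]] has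
    length at most [L (y - x)]. This yields the one-sided hypothesis of
    [ge0_le_integral_substitution], so speed at most [L] may replace arc length in upper bounds. *)
Lemma path_integral_lipschitz L c g : lipschitz_curve L c ->
  measurable_fun [set: borelType X] g -> (forall x, 0 <= g x) ->
  path_integral c g <= L%:E * \int[leb]_(t in `[0%R, 1%R]) g (c t).
Proof.
move=> lc mg g0; have rc := lipschitz_curve_rectifiable lc.
have fl : curve_length c 0 1 = (fine (curve_length c 0 1))%:E.
  by rewrite fineK// ge0_fin_numE ?curve_length_ge0//; case: rc.
rewrite /path_integral fl.
have L0 := lipschitz_curve_ge0 lc.
apply: (@ge0_le_integral_substitution _ (arc_inv c) `[0%R, 1%R] `[0%R, 1%R]
  _ L (g \o c)) => //.
- by rewrite fine_ge0// curve_length_ge0.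
- exact: measurable_arc_inv.
- by move=> t /=; rewrite !in_itv/=; exact: arc_inv_itv.
- exact: (@measurable_comp_curve L c g _ lc mg).
- by move=> t _; exact: g0.
- move=> x y xy; set Lam := fine _.
  have Lam0 : (0 <= Lam)%R by rewrite fine_ge0// curve_length_ge0.
  pose x' := clamp 0 1 x; pose y' := clamp 0 1 y.
  pose ell s := fine (curve_length c 0 s).
  have /andP[x0 x1] : (0 <= x' <= 1)%R := clamp_itv x (@ler01 R).
  have /andP[y0 y1] : (0 <= y' <= 1)%R := clamp_itv y (@ler01 R).
  have xy' : (x' <= y')%R by exact: clamp_nd.
  have [->|LamN0] := eqVneq Lam 0%R.
    by rewrite mul0e lee_fin mulr_ge0// subr_ge0.
  have Lamp : (0 < Lam)%R by rewrite lt_def LamN0.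
  apply: (@le_trans _ _ (Lam%:E * leb `[(ell x' / Lam)%R, (ell y' / Lam)%R]%classic)).
    apply: lee_wpmul2l; first by rewrite lee_fin.
    apply: le_measure; rewrite ?inE.
    - apply: (measurable_arc_inv rc) => //; exact: measurable_itv.
    - exact: measurable_itv.
    - move=> t /= [+ txy]; rewrite !in_itv/= => t01.
      have := arc_inv_oc rc t01 xy txy; rewrite -/Lam -/(clamp 0 1 x) -/(clamp 0 1 y).
      by rewrite ler_pdivrMr// ler_pdivlMr.
  rewrite lebesgue_measure_itv/=.
  case: ifPn => _; last by rewrite mule0 lee_fin mulr_ge0// subr_ge0.
  rewrite -EFinD -EFinM lee_fin.
  have -> : (Lam * (ell y' / Lam - ell x' / Lam) = ell y' - ell x')%R by field.
  have lx := curve_length_lip L0 xy' (fun u v _ _ => lc u v).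
  have := curve_lengthD c x0 xy'.
  have elE s : (0 <= s)%R -> (s <= 1)%R -> curve_length c 0 s = (ell s)%:E.
    move=> s0 s1; rewrite /ell fineK// ge0_fin_numE ?curve_length_ge0//.
    case: rc => _; apply: le_lt_trans.
    by rewrite (curve_lengthD c s0 s1) leeDl// curve_length_ge0.
  rewrite !elE// => E; move: lx; rewrite -(@leeD2lE _ (ell x')%:E)// -E -EFinD lee_fin.
  have := clamp_lip 0 1 y x; rewrite -/x' -/y' !ger0_norm ?subr_ge0//.
  by move=> /(ler_wpM2l L0); lra.
Qed.

(** Rescaling the arc to [[0, 1]] turns the upper gradient inequality into one about a plain
    integral in the parameter. *)
Lemma arc_upper_gradient u g L c a b :
  upper_gradient u g -> lipschitz_curve L c -> (a <= b)%R ->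
  `|u (c b) - u (c a)| <= L%:E * \int[leb]_(t in `[a, b]) g (c t).
Proof.
move=> [mg g0 ug] lc ab; have L0 := lipschitz_curve_ge0 lc.
pose s t : R := (a + t * (b - a))%R.
have ls : lipschitz_curve (L * (b - a)) (c \o s).
  apply: lipschitz_curve_comp => // x y; rewrite /s.
  have -> : (a + x * (b - a) - (a + y * (b - a)) = (b - a) * (x - y))%R by ring.
  by rewrite normrM ger0_norm ?subr_ge0.
have := ug (c \o s) (lipschitz_curve_rectifiable ls).
rewrite /= /s mul0r addr0 mul1r [(a + (b - a))%R]addrC subrK => /le_trans; apply.
apply: (le_trans (path_integral_lipschitz ls mg g0)).
apply: (@ge0_le_integral_substitution _ s `[0%R, 1%R] `[a, b] (L * (b - a)) L (g \o c)) => //.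
- by rewrite mulr_ge0// subr_ge0.
- apply: measurable_funTS; apply: continuous_measurable_fun => x.
  by apply: cvgD; [exact: cvg_cst|apply: cvgMl; exact: cvg_id].
- move=> t /=; rewrite !in_itv/= => /andP[t0 t1]; rewrite /s; apply/andP; split.
    by rewrite lerDl mulr_ge0// subr_ge0.
  by rewrite -lerBrDl ler_piMl// subr_ge0.
- exact: (@measurable_comp_curve L c g _ lc mg).
- by move=> t _; exact: g0.
- move=> x y xy; have [->|abN] := eqVneq a b.
    by rewrite subrr mulr0 mul0e lee_fin mulr_ge0// subr_ge0.
  have ba0 : (0 < b - a)%R by rewrite subr_gt0 lt_neqAle abN.
  apply: (@le_trans _ _ ((L * (b - a))%:E * leb `]((x - a) / (b - a))%R, ((y - a) / (b - a))%R]%classic)).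
    apply: lee_wpmul2l; first by rewrite lee_fin mulr_ge0// ltW.
    apply: le_measure; rewrite ?inE.
    - apply: measurableI => //; rewrite -[X in measurable X]setTI.
      have ms : measurable_fun [set: measurableTypeR R] s.
        apply: continuous_measurable_fun => z.
        by apply: cvgD; [exact: cvg_cst|apply: cvgMl; exact: cvg_id].
      by apply: ms => //; exact: measurable_itv.
    - exact: measurable_itv.
    - move=> t [_]; rewrite /= !in_itv/= /s ltr_pdivrMr// ler_pdivlMr//.
      by rewrite ltrBlDl lerBrDl.
  rewrite lebesgue_measure_itv/=.
  case: ifPn => _; last by rewrite mule0 lee_fin mulr_ge0// subr_ge0.
  rewrite -EFinD -EFinM lee_fin le_eqVlt; apply/orP; left; apply/eqP; field.
  by rewrite subr_eq0 eq_sym.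
Qed.

(** Conversely, an upper gradient inequality need be tested only on Lipschitz curves: the
    constant-speed parametrization, extended by constants, is one, and it attains the path
    integral. *)
Lemma constant_speed_curve gamma : rectifiable gamma ->
  exists c L, [/\ lipschitz_curve L c, c 0%R = gamma 0%R, c 1%R = gamma 1%R &
    forall g, path_integral gamma g =
       L%:E * \int[leb]_(t in `[0%R, 1%R]) g (c t)].
Proof.
move=> rg; exists (constant_speed gamma \o clamp 0 1), (fine (curve_length gamma 0 1)).
split.
- move=> s t; apply: le_trans (constant_speed_lip rg _ _) _; rewrite ?clamp_itv//.
  apply: ler_wpM2l; last exact: clamp_lip.
  by rewrite fine_ge0// curve_length_ge0.
- by rewrite /= clamp_id ?lexx ?ler01// constant_speed0.
- by rewrite /= clamp_id ?lexx ?ler01// constant_speed1.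
- move=> g; rewrite /path_integral fineK; last first.
    by rewrite ge0_fin_numE ?curve_length_ge0//; case: rg.
  congr (_ * _); apply: eq_integral => t; rewrite inE/= => /clampE.
  by rewrite /= => ->.
Qed.

End lipschitz_curves.

(** * Lower semicontinuous majorants *)

Section lower_semicontinuity.
Context {R : realType} {X : topologicalType}.
Implicit Types f g : X -> \bar R.
Local Open Scope ereal_scope.

Lemma lower_semicontinuousD f g : (forall x, 0 <= f x) -> (forall x, 0 <= g x) ->
  lower_semicontinuous f -> lower_semicontinuous g ->
  lower_semicontinuous (fun x => f x + g x).
Proof.
move=> f0 g0 lf lg x a.
have [fy|fx] := eqVneq (f x) +oo.
  move=> _; have [|V nV VP] := lf x a; first by rewrite fy ltry.
  by exists V => // y /VP /lt_le_trans; apply; rewrite leeDl.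
have [gy|gx] := eqVneq (g x) +oo.
  move=> _; have [|V nV VP] := lg x a; first by rewrite gy ltry.
  by exists V => // y /VP /lt_le_trans; apply; rewrite leeDr.
have ff : f x \is a fin_num by rewrite ge0_fin_numE// lt_neqAle fx leey.
have gf : g x \is a fin_num by rewrite ge0_fin_numE// lt_neqAle gx leey.
move: (lf x) (lg x); rewrite -(fineK ff) -(fineK gf); set r := fine _; set s := fine _.
rewrite -EFinD lte_fin => Hf Hg ars.
(* The gap [r + s - a] is shared equally: the two thresholds add up to [a]. *)
have [|V nV VP] := Hf ((a + r - s) / 2)%R; first by rewrite lte_fin; lra.
have [|W nW WP] := Hg ((a + s - r) / 2)%R; first by rewrite lte_fin; lra.
exists (V `&` W); first exact: filterI.
move=> y [/VP vy /WP wy].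
have -> : a%:E = ((a + r - s) / 2)%:E + ((a + s - r) / 2)%:E.
  by rewrite -EFinD; congr (_%:E); lra.
exact: lteD.
Qed.

Lemma lower_semicontinuous_cst (a : \bar R) : lower_semicontinuous (fun _ : X => a).
Proof. by move=> x b ba; exists setT => //; exact: filterT. Qed.

Lemma lower_semicontinuous_indic (U : set X) (k : R) : open U -> (0 <= k)%R ->
  lower_semicontinuous (fun x => (k * \1_U x)%:E).
Proof.
move=> oU k0 x a; have [xU|xU] := pselect (U x).
  rewrite indicE mem_set// mulr1 => ak; exists U; first exact: open_nbhs_nbhs.
  by move=> y Uy; rewrite indicE mem_set// mulr1.
rewrite indicE memNset// mulr0 lte_fin => a0; exists setT; first exact: filterT.
by move=> y _; rewrite lte_fin (lt_le_trans a0)// mulr_ge0.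
Qed.

Lemma lower_semicontinuous_sum (f : nat -> X -> \bar R) n :
  (forall k x, 0 <= f k x) ->
  (forall k, lower_semicontinuous (f k)) ->
  lower_semicontinuous (fun x => \sum_(0 <= k < n) f k x).
Proof.
move=> f0 lf; elim: n => [|n ih].
  by under eq_fun do rewrite big_nil; exact: lower_semicontinuous_cst.
under eq_fun do rewrite big_nat_recr//=.
by apply: lower_semicontinuousD => // x; exact: sume_ge0.
Qed.

Lemma lower_semicontinuous_nneseries (f : nat -> X -> \bar R) :
  (forall k x, 0 <= f k x) -> (forall k, lower_semicontinuous (f k)) ->
  lower_semicontinuous (fun x => \sum_(0 <= k <oo) f k x).
Proof.
move=> f0 lf x a afx.
have [n an] : exists n, a%:E < \sum_(0 <= k < n) f k x.
  apply: contrapT => /forallNP H.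
  move: afx; apply/negP; rewrite -leNgt.
  apply: lime_le; first by apply: is_cvg_nneseries.
  by apply: nearW => n; rewrite leNgt; apply/negP; exact: H.
have [V nV VP] := lower_semicontinuous_sum (n := n) f0 lf an.
exists V => // y /VP /lt_le_trans; apply.
exact: nneseries_lim_ge.
Qed.

Lemma lower_semicontinuous_poweR f (r : R) : (0 < r)%R -> (forall x, 0 <= f x) ->
  lower_semicontinuous f -> lower_semicontinuous (fun x => f x `^ r).
Proof.
move=> r0 f0 lf x a; have [a0 _|a0] := ltP a 0%R.
  exists setT; first exact: filterT.
  by move=> y _; apply: lt_le_trans (poweR_ge0 _ _); rewrite lte_fin.
have aE : a%:E = ((a `^ r^-1)%:E `^ r)%E.
  by rewrite poweR_EFin -powRrM mulVf ?gt_eqF// powRr1.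
have H y : (a%:E < f y `^ r) = ((a `^ r^-1)%:E < f y).
  rewrite aE !ltNge; congr (~~ _).
  apply/idP/idP => [h|h].
    have i0 : (0 <= r^-1)%R by rewrite invr_ge0 ltW.
    have := gt0_ler_poweR i0 (x := f y `^ r) (y := ((a `^ r^-1)%:E) `^ r).
    rewrite !in_itv/= !poweR_ge0 !leey => /(_ isT).
    rewrite lee_fin powR_ge0 => /(_ isT h).
    by rewrite -powRrM -poweRrM mulfV ?gt_eqF// poweRe1// powRr1// powR_ge0.
  apply: gt0_ler_poweR => //; rewrite ?in_itv/= ?leey ?f0 ?lee_fin ?powR_ge0//.
  exact: ltW.
by rewrite H => /lf[V nV VP]; exists V => // y /VP; rewrite H.
Qed.

End lower_semicontinuity.

(** * Lipschitz inf-convolutions *)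

Section lipschitz_regularization.
Context {R : realType} {X : metricType R}.
Variable f : X -> \bar R.
Hypothesis f0 : forall x, (0 <= f x)%E.

Let F (k : nat) y : R := fine (Order.min (f y) k%:R%:E).

Let FE k y : (F k y)%:E = Order.min (f y) k%:R%:E.
Proof.
rewrite /F fineK// ge0_fin_numE; last by rewrite le_min f0 lee_fin ler0n.
by rewrite gt_min ltry orbT.
Qed.

Let F_ge0 k y : 0 <= F k y.
Proof. by rewrite -lee_fin FE le_min f0 lee_fin ler0n. Qed.

Let F_lek k y : F k y <= k%:R.
Proof. by rewrite -lee_fin FE ge_min lexx orbT. Qed.

Let F_lef k y : ((F k y)%:E <= f y)%E.
Proof. by rewrite FE ge_min lexx. Qed.

(** The Pasch-Hausdorff envelope of [f] truncated at [k]. The truncation keeps it real, and bounded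
    by [k], where [f] is infinite. *)
Definition lip_reg (k : nat) (x : X) : R := inf [set F k y + k%:R * mdist x y | y in setT].

Let S_inf k x : has_inf [set F k y + k%:R * mdist x y | y in setT].
Proof.
split; first by exists (F k x + k%:R * mdist x x); exists x.
by exists 0 => _ [y _ <-]; rewrite addr_ge0// mulr_ge0// mdist_ge0.
Qed.

Let lip_reg_le_add k x y : lip_reg k x <= F k y + k%:R * mdist x y.
Proof. by apply: ge_inf; [case: (S_inf k x)|exists y]. Qed.

Let lip_reg_lb k x a : (forall y, a <= F k y + k%:R * mdist x y) -> a <= lip_reg k x.
Proof.
by move=> H; apply: lb_le_inf => [|_ [y _ <-]//]; case: (S_inf k x).
Qed.

Lemma lip_reg_lt k x a : lip_reg k x < a ->
  exists y, (Order.min (f y) k%:R%:E + (k%:R * mdist x y)%:E < a%:E)%E.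
Proof.
move=> /(inf_lt (proj1 (S_inf k x)))[_ [y _ <-]] h; exists y.
by rewrite -FE -EFinD lte_fin.
Qed.

Lemma lip_reg_ge0 k x : 0 <= lip_reg k x.
Proof. by apply: lip_reg_lb => y; rewrite addr_ge0// mulr_ge0// mdist_ge0. Qed.

Lemma lip_reg_le_nat k x : lip_reg k x <= k%:R.
Proof.
by apply: le_trans (lip_reg_le_add k x x) _; rewrite mdistxx mulr0 addr0.
Qed.

Lemma lip_reg_le k x : ((lip_reg k x)%:E <= f x)%E.
Proof.
apply: le_trans (F_lef k x); rewrite lee_fin.
by apply: le_trans (lip_reg_le_add k x x) _; rewrite mdistxx mulr0 addr0.
Qed.

Let lip_reg_lip1 k x y : lip_reg k x <= lip_reg k y + k%:R * mdist x y.
Proof.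
rewrite -lerBlDr; apply: lip_reg_lb => z; rewrite lerBlDr.
apply: le_trans (lip_reg_le_add k x z) _; rewrite -addrA lerD2l -mulrDr.
by apply: ler_wpM2l => //; rewrite addrC; exact: metric_triangle.
Qed.

Lemma lip_reg_lip k x y : `|lip_reg k x - lip_reg k y| <= k%:R * mdist x y.
Proof.
rewrite ler_norml; have := lip_reg_lip1 k x y; have := lip_reg_lip1 k y x.
by rewrite metric_sym; set D := _ * _; lra.
Qed.

Lemma lip_reg_nd x : nondecreasing_seq (lip_reg ^~ x).
Proof.
move=> m n mn; apply: lip_reg_lb => y; apply: le_trans (lip_reg_le_add m x y) _.
apply: lerD; last by rewrite ler_wpM2r ?mdist_ge0// ler_nat.
rewrite -lee_fin !FE le_min ge_min lexx/= ge_min.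
by apply/orP; right; rewrite lee_fin ler_nat.
Qed.

Lemma lip_reg_sup x a : lower_semicontinuous f -> (a%:E < f x)%E ->
  exists k, a <= lip_reg k x.
Proof.
move=> lf afx; have [a0|a0] := leP a 0.
  by exists 0%N; apply: le_trans a0 (lip_reg_ge0 _ _).
have [V /nbhs_ballP[r /= r0 rV] VP] := lf x a afx.
(* Inside the ball the truncation level [k] must reach [a]; outside it, the penalty [k r] must. *)
exists (maxn (Num.truncn a).+1 (Num.truncn (a / r)).+1).
set k := maxn _ _.
have ka : a <= k%:R.
  by apply: (ltW (lt_le_trans (truncnS_gt _) _)); rewrite ler_nat leq_maxl.
have kr : a <= k%:R * r.
  rewrite -ler_pdivrMr//.
  by apply: (ltW (lt_le_trans (truncnS_gt _) _)); rewrite ler_nat leq_maxr.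
apply: lip_reg_lb => y; have [xy|xy] := ltP (mdist x y) r.
  have /VP/ltW afy : V y by apply: rV; rewrite ballEmdist.
  rewrite -[a]addr0; apply: lerD; last by rewrite mulr_ge0// mdist_ge0.
  by rewrite -lee_fin FE le_min afy lee_fin.
apply: (le_trans kr); rewrite -[leLHS]add0r lerD//.
by rewrite ler_wpM2l.
Qed.

Lemma lip_reg_cvg x : lower_semicontinuous f ->
  (lip_reg k x)%:E @[k --> \oo] --> f x.
Proof.
move=> lf.
have nd : nondecreasing_seq (fun k => (lip_reg k x)%:E).
  by move=> m n mn; rewrite lee_fin; exact: lip_reg_nd.
suff -> : f x = ereal_sup (range (fun k => (lip_reg k x)%:E)).
  exact: ereal_nondecreasing_cvgn.
apply/eqP; rewrite eq_le; apply/andP; split; last first.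
  by apply: ge_ereal_sup => _ [k _ <-]; exact: lip_reg_le.
rewrite leNgt; apply/negP; set S := ereal_sup _ => Sf.
have S0 : (0 <= S)%E.
  apply: (@le_trans _ _ (lip_reg 0 x)%:E); first by rewrite lee_fin lip_reg_ge0.
  by apply: ereal_sup_ubound; exists 0%N.
have Sfin : S \is a fin_num by rewrite ge0_fin_numE// (lt_le_trans Sf)// leey.
have [a Sa af] : exists2 a : R, (S < a%:E)%E & (a%:E < f x)%E.
  move: Sf; rewrite -(fineK Sfin); case: (f x) => [r||]//.
    rewrite lte_fin => sr; exists ((fine S + r) / 2); rewrite lte_fin; lra.
  by move=> _; exists (fine S + 1); rewrite ?ltry// lte_fin; lra.
have [k ak] := lip_reg_sup lf af.
have : (a%:E <= S)%E.
  apply: (@le_trans _ _ (lip_reg k x)%:E); first by rewrite lee_fin.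
  by apply: ereal_sup_ubound; exists k.
by rewrite leNgt Sa.
Qed.

End lipschitz_regularization.

(** * Regularity of finite Borel measures *)

Section outer_regularity.
Context {R : realType} {X : pointedMetricType R}.
Variable nu : {finite_measure set (borelType X) -> \bar R}.
Local Open Scope ereal_scope.

Lemma open_borel (U : set X) : open U -> measurable (U : set (borelType X)).
Proof. by move=> oU; exact: sub_sigma_algebra. Qed.

Lemma closed_borel (C : set X) : closed C -> measurable (C : set (borelType X)).
Proof.
by move=> cC; rewrite -[C]setCK; apply: measurableC; apply: open_borel; exact: closed_openC.
Qed.

Lemma lower_semicontinuous_borel (f : X -> \bar R) : lower_semicontinuous f ->
  measurable_fun [set: borelType X] (f : borelType X -> \bar R).
Proof.
move=> /lower_semicontinuousP lf.
apply: (measurability _ (ErealGenOInfty.measurableE R)) => // _ [_ [a ->] <-].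
rewrite setTI; apply: open_borel.
rewrite (_ : _ @^-1` _ = [set x | a%:E < f x])//.
by apply/seteqP; split => x /=; rewrite in_itv/= andbT.
Qed.

Let regular (A : set (borelType X)) := forall e : R, (0 < e)%R ->
  exists C U : set X, [/\ closed C, open U, C `<=` A, A `<=` U & nu (U `\` C) < e%:E].

(** The regularizations of the indicator of [U] play the role of the distance to its complement:
    their closed superlevel sets increase to [U]. *)
Let regular_open U : open U -> regular U.
Proof.
move=> oU e e0.
pose f : X -> \bar R := fun x => (1 * \1_U x)%:E.
have f0 x : 0 <= f x by rewrite lee_fin mul1r.
have lf : lower_semicontinuous f by exact: lower_semicontinuous_indic.
pose C k := [set x | (2^-1 <= lip_reg f k x)%R].
have cC k : closed (C k).
  rewrite -[C k]setCK; apply: open_closedC; rewrite openE => x /= /negP.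
  rewrite -ltNge => xk; apply/nbhs_ballP.
  exists ((2^-1 - lip_reg f k x) / k.+1%:R)%R => /=.
    by rewrite divr_gt0// subr_gt0.
  move=> y; rewrite ballEmdist/= ltr_pdivlMr// => xy; apply/negP; rewrite -ltNge.
  have := lip_reg_lip f0 k x y; rewrite ler_norml => /andP[+ _].
  have : (k%:R * mdist x y <= mdist x y * k.+1%:R)%R.
    by rewrite mulrC ler_wpM2l ?mdist_ge0// ler_nat.
  lra.
have CU k : C k `<=` U.
  move=> x /= kx; apply: contrapT => Ux.
  have fx : f x = 0 by rewrite /f indicE memNset// mulr0.
  move: (lip_reg_le f0 k x); rewrite fx lee_fin. move: kx; rewrite /C/=; lra.
have nC : \bigcap_k (U `\` C k) = set0.
  apply/seteqP; split => // x H; have [Ux _] := H 0%N I.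
  have [|k Hk] := @lip_reg_sup _ _ f f0 x 2^-1 lf.
    by rewrite /f indicE mem_set// mulr1 lte_fin; lra.
  by have [_] := H k I.
have : nu (U `\` C k) @[k --> \oo] --> nu (\bigcap_k (U `\` C k)).
  have mUC k : measurable (U `\` C k : set (borelType X)).
    by apply: measurableD; [exact: open_borel|exact: closed_borel].
  apply: nonincreasing_cvg_mu => //.
  - by rewrite ltey_eq fin_num_measure.
  - exact: bigcapT_measurable.
  - move=> m n mn; apply/subsetPset => x /= [Ux /negP nx]; split => //; apply/negP.
    rewrite -!ltNge in nx *; apply: le_lt_trans nx; exact: lip_reg_nd.
rewrite nC measure0 => /fine_cvgP[_ /cvgrPdist_lt /(_ e e0)[N _ /(_ N (leqnn N))]].
rewrite /= sub0r normrN ger0_norm ?fine_ge0// => He.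
exists (C N), U; split => //.
rewrite -[nu _]fineK ?lte_fin//; apply: fin_num_measure.
by apply: measurableD; [exact: open_borel|exact: closed_borel].
Qed.

Let regular_setC A : regular A -> regular (~` A).
Proof.
move=> rA e e0; have [C [U [cC oU CA AU H]]] := rA e e0.
exists (~` U), (~` C); split; [exact: open_closedC|exact: closed_openC|
  exact: subsetC|exact: subsetC|].
by rewrite setDE setCK setIC -setDE.
Qed.

Let regular_bigcup (A : nat -> set (borelType X)) :
  (forall n, regular (A n)) -> regular (\bigcup_n A n).
Proof.
move=> rA e e0.
have en n : (0 < (e / 2 / (2 ^ n.+1)%:R))%R by rewrite !divr_gt0// ltr0n expn_gt0.
have /choice[CU CUP] : forall n, exists CU : set X * set X,
    [/\ closed CU.1, open CU.2, CU.1 `<=` A n, A n `<=` CU.2 &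
     nu (CU.2 `\` CU.1) < (e / 2 / (2 ^ n.+1)%:R)%:E].
  by move=> n; have [C [U H]] := rA n _ (en n); exists (C, U).
pose U := \bigcup_n (CU n).2.
(* A countable union of closed sets need not be closed. Finite unions are used, and since [nu] is
   finite the measures of [U] minus these decrease to a limit that is at most [e / 2]. *)
pose C N := \big[setU/set0]_(n < N) (CU n).1.
have CE N : C N = \bigcup_(n < N) (CU n).1.
  by rewrite /C (bigcup_mkord N (fun n => (CU n).1)).
have oU : open U by apply: bigcup_open => n _; case: (CUP n).
have cC N : closed (C N).
  by apply: closed_bigsetU => n _; case: (CUP n).
have mC n : measurable ((CU n).1 : set (borelType X)).
  by apply: closed_borel; case: (CUP n).
have mU n : measurable ((CU n).2 : set (borelType X)).
  by apply: open_borel; case: (CUP n).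
have mD n : measurable ((CU n).2 `\` (CU n).1 : set (borelType X)).
  exact: measurableD (mU n) (mC n).
have mUC N : measurable (U `\` C N : set (borelType X)).
  by apply: measurableD; [exact: open_borel|exact: closed_borel].
have : nu (U `\` C k) @[k --> \oo] --> nu (\bigcap_k (U `\` C k)).
  apply: nonincreasing_cvg_mu => //.
  - by rewrite ltey_eq fin_num_measure.
  - exact: bigcapT_measurable.
  - move=> m n mn; apply/subsetPset; apply: setDS => x.
    rewrite !CE => -[i /= im ?]; exists i => //=; exact: leq_trans im mn.
set L := nu (\bigcap_k _).
have LE : L <= (e / 2)%:E.
  apply: (@le_trans _ _ (nu (\bigcup_n ((CU n).2 `\` (CU n).1)))).
    apply: le_measure; rewrite ?inE.
    - exact: bigcapT_measurable.
    - by apply: bigcupT_measurable => n; exact: mD.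
    - move=> x H; have [[n _ nx] _] := H 0%N I; exists n => //; split => // Cx.
      have [_] := H n.+1 I; apply; rewrite CE.
      by exists n => //=.
  apply: (@le_trans _ _ (\sum_(0 <= n <oo) nu ((CU n).2 `\` (CU n).1))).
    apply: measure_sigma_subadditive => //.
    - by apply: bigcupT_measurable => n; exact: mD.
  apply: (@le_trans _ _ (\sum_(0 <= n <oo) (e / 2 / (2 ^ n.+1)%:R)%:E)).
    by apply: lee_nneseries => // n _; apply: ltW; case: (CUP n).
  by apply: epsilon_trick0; rewrite divr_ge0// ltW.
have Lfin : L \is a fin_num by rewrite fin_num_measure//; exact: bigcapT_measurable.
rewrite -(fineK Lfin) => /fine_cvgP[_ /cvgrPdist_lt].
have e20 : (0 < e / 2)%R by rewrite divr_gt0.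
move=> /(_ _ e20)[N _ /(_ N (leqnn N))] /=; rewrite distrC => H.
exists (C N), U; split => //.
- rewrite CE => x [n _ nx]; exists n => //.
  by case: (CUP n) => _ _ + _ _; apply.
- by move=> x [n _ nx]; exists n => //; case: (CUP n) => _ _ _ + _; apply.
- rewrite -[nu _]fineK ?fin_num_measure// lte_fin.
  move: LE; rewrite -(fineK Lfin) lee_fin => LE.
  move: H; rewrite ltr_norml => /andP[_]; lra.
Qed.

Lemma borel_regular A : measurable A -> regular A.
Proof.
apply: smallest_sub; last exact: regular_open.
split.
- apply: regular_open; exact: open0.
- by move=> B rB; rewrite setTD; exact: regular_setC.
- exact: regular_bigcup.
Qed.

Lemma borel_outer_regular (A : set (borelType X)) (e : R) : measurable A -> (0 < e)%R ->
  exists U : set X, [/\ open U, A `<=` U & nu (U `\` A) < e%:E].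
Proof.
move=> mA e0; have [C [U [cC oU CA AU H]]] := borel_regular mA e0.
exists U; split => //; apply: le_lt_trans H; apply: le_measure; rewrite ?inE.
- by apply: measurableD => //; exact: open_borel.
- by apply: measurableD; [exact: open_borel|exact: closed_borel].
- exact: setDS.
Qed.

End outer_regularity.

(** * The Vitali-Caratheodory theorem *)

Section lsc_majorant.
Context {R : realType} {X : pointedMetricType R}.
Variable nu : {finite_measure set (borelType X) -> \bar R}.
Local Open Scope ereal_scope.

(** Layer cake: the sum of [t] times the indicators of the sets [f > k t] rounds [f] up to a
    multiple of [t]. Replacing each set by a slightly larger open one gives lower semicontinuity,
    and [D] collects the differences. *)
Lemma lsc_majorant (f : borelType X -> \bar R) (e d : R) :
  measurable_fun setT f -> (forall x, 0 <= f x) -> (0 < e)%R -> (0 < d)%R ->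
  exists (h : X -> \bar R) (D : set (borelType X)),
    [/\ lower_semicontinuous h, forall x, f x <= h x, measurable D,
        nu D <= e%:E /\ (forall x, ~ D x -> h x <= f x + d%:E) &
        \int[nu]_x h x <= \int[nu]_x f x + e%:E].
Proof.
move=> mf f0 e0 d0.
pose M := fine (nu setT).
have M0 : (0 <= M)%R by exact: fine_ge0.
have ME : nu setT = M%:E by rewrite fineK// fin_num_measure.
(* Rounding up costs at most [d] pointwise and [t M <= e / 2] in the integral. The open supersets
   cost [t e' <= e / 2], and [e' <= e] bounds the measure of [D]. *)
pose t := Num.min d (e / 2 / (M + 1))%R.
have t0 : (0 < t)%R by rewrite lt_min d0 !divr_gt0//; lra.
pose e' := Num.min e (e / 2 / t)%R.
have e'0 : (0 < e')%R by rewrite lt_min e0 !divr_gt0.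
pose A (k : nat) : set (borelType X) := [set x | (k%:R * t)%:E < f x].
have mA k : measurable (A k).
  rewrite -[A k]setTI (_ : A k = f @^-1` `](k%:R * t)%:E, +oo[); last first.
    by apply/seteqP; split => x /=; rewrite in_itv/= andbT.
  by apply: mf => //; exact: emeasurable_itv.
have en n : (0 < (e' / (2 ^ n.+1)%:R))%R by rewrite divr_gt0// ltr0n expn_gt0.
have /choice[U UP] := fun k => borel_outer_regular nu (mA k) (en k).
have oU k : open (U k) by case: (UP k).
have mU k : measurable (U k : set (borelType X)) by exact: open_borel.
have AU k : A k `<=` U k by case: (UP k).
have mD k : measurable (U k `\` A k : set (borelType X)) := measurableD (mU k) (mA k).
pose h (x : X) := \sum_(0 <= k <oo) (t * \1_(U k) x)%:E.
pose hA (x : X) := \sum_(0 <= k <oo) (t * \1_(A k) x)%:E.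
pose hD (x : X) := \sum_(0 <= k <oo) (t * \1_(U k `\` A k) x)%:E.
have ti0 (B : nat -> set X) k x : (0 <= (t * \1_(B k) x)%:E).
  by rewrite lee_fin mulr_ge0// ltW.
have hE x : h x = hA x + hD x.
  rewrite /h /hA /hD -(@nneseriesD _ (fun k => (t * \1_(A k) x)%:E)
    (fun k => (t * \1_(U k `\` A k) x)%:E)); last 2 first.
  - by move=> *; exact: ti0.
  - by move=> k *; exact: (ti0 (fun k => U k `\` A k)).
  apply: eq_eseriesr => k _; rewrite -EFinD -mulrDr; congr (t * _)%:E.
  rewrite !indicE; have [xU|xU] := pselect (U k x); last first.
    by rewrite !memNset ?addr0// => [[]//|/AU].
  have [xA|xA] := pselect (A k x).
    by rewrite (mem_set xU) (mem_set xA) memNset ?addr0// => -[].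
  by rewrite (mem_set xU) (memNset xA) mem_set ?add0r.
have hD0 x : 0 <= hD x.
  by apply: nneseries_ge0 => k _ _; exact: (ti0 (fun k => U k `\` A k)).
have hA_le x : hA x <= f x + t%:E.
  have [->|fx] := eqVneq (f x) +oo; first by rewrite addye// leey.
  have : f x \is a fin_num by rewrite ge0_fin_numE// lt_neqAle fx leey.
  move=> /fineK fE; set r := fine (f x) in fE.
  apply: lime_le; first by apply: is_cvg_nneseries => k _ _; exact: ti0.
  apply: nearW => n; rewrite -fE -EFinD sumEFin lee_fin.
  have r0 : (0 <= r)%R by exact: fine_ge0.
  suff : (\sum_(0 <= k < n) t * \1_(A k) x <= Num.min (n%:R * t) (r + t))%R.
    by rewrite le_min => /andP[].
  elim: n => [|n ih]; first by rewrite big_nil mul0r le_min lexx addr_ge0// ltW.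
  rewrite big_nat_recr//= indicE; have [xA|xA] := pselect (A n x).
    rewrite mem_set// mulr1; move: ih; rewrite !le_min => /andP[H1 H2].
    have nr : (n%:R * t < r)%R by move: xA; rewrite /A/= -fE lte_fin.
    have -> : (n.+1%:R * t = n%:R * t + t)%R by rewrite -natr1 mulrDl mul1r.
    by apply/andP; split; lra.
  rewrite memNset// mulr0 addr0; apply: (le_trans ih).
  rewrite le_min !ge_min lexx orbT andbT; apply/orP; left.
  by rewrite ler_wpM2r ?ler_nat// ltW.
have hf x : f x <= h x.
  have [fy|fx] := leP (f x) (h x) => //.
  have hx0 : 0 <= h x by apply: nneseries_ge0 => k _ _; exact: ti0.
  have hfin : h x \is a fin_num by rewrite ge0_fin_numE// (lt_le_trans fx) ?leey.
  pose n := (Num.truncn (fine (h x) / t)).+1.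
  have : (n%:R * t)%:E <= h x.
    apply: (@le_trans _ _ (\sum_(0 <= k < n) (t * \1_(U k) x)%:E)).
      rewrite sumEFin lee_fin big_nat.
      rewrite (eq_bigr (fun=> t)); last first.
        move=> k /andP[_ kn]; rewrite indicE mem_set ?mulr1//; apply: AU => /=.
        apply: le_lt_trans fx; rewrite -(fineK hfin) lee_fin -ler_pdivlMr//.
        rewrite ltnS in kn.
        apply: (@le_trans _ _ (Num.truncn (fine (h x) / t))%:R%R).
          by rewrite ler_nat.
        by rewrite truncn_le; apply: divr_ge0; [exact: fine_ge0|exact: ltW].
      by rewrite -big_nat big_const_nat subn0 iter_addr_0 mulr_natl.
    apply: nneseries_lim_ge => k _ _; exact: ti0.
  rewrite -(fineK hfin) lee_fin -ler_pdivlMr// leNgt.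
  by rewrite truncnS_gt.
exists h, (\bigcup_k (U k `\` A k)); split => //.
- by apply: lower_semicontinuous_nneseries => // k; apply: lower_semicontinuous_indic => //; exact: ltW.
- by apply: bigcupT_measurable => k; exact: mD.
- split.
    apply: (@le_trans _ _ (\sum_(0 <= n <oo) nu (U n `\` A n))).
      apply: measure_sigma_subadditive => //.
      by apply: bigcupT_measurable => n; exact: mD.
    apply: (@le_trans _ _ (\sum_(0 <= n <oo) (e' / (2 ^ n.+1)%:R)%:E)).
      by apply: lee_nneseries => // n _; apply: ltW; case: (UP n).
    apply: (@le_trans _ _ e'%:E); first by apply: epsilon_trick0; exact: ltW.
    by rewrite lee_fin ge_min lexx.
  move=> x Dx; rewrite hE (_ : hD x = 0) ?adde0.
    by apply: (le_trans (hA_le x)); rewrite leeD2l// lee_fin ge_min lexx.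
  apply: eseries0 => k _ _; rewrite indicE memNset ?mulr0// => ?.
  by apply: Dx; exists k.
- have mI (B : nat -> set (borelType X)) k : measurable (B k) ->
      measurable_fun [set: borelType X] (fun x => (t * \1_(B k) x)%:E).
    by move=> mB; apply/measurable_EFinP; apply: measurable_funM => //; exact: measurable_indic.
  have mhD : measurable_fun [set: borelType X] hD.
    apply: ge0_emeasurable_sum => [k x *|k *].
      exact: (ti0 (fun k => U k `\` A k)).
    exact: (mI (fun k => U k `\` A k)).
  apply: (@le_trans _ _ (\int[nu]_x ((f x + t%:E) + hD x))).
    apply: ge0_le_integral_nomeas => x.
      by apply: nneseries_ge0 => k _ _; exact: ti0.
    by rewrite hE leeD2r.
  rewrite ge0_integralD//; last 2 first.
  - by move=> x _; rewrite adde_ge0// lee_fin ltW.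
  - exact: emeasurable_funD.
  rewrite ge0_integralD//; last by move=> x _; rewrite lee_fin ltW.
  have IE : \int[nu]_x t%:E = t%:E * M%:E by rewrite integral_cst// -ME.
  rewrite -addeA leeD2l// IE.
  have -> : \int[nu]_x hD x = \sum_(0 <= k <oo) (t%:E * nu (U k `\` A k)).
    rewrite /hD integral_nneseries//; last 2 first.
    - by move=> k; exact: (mI (fun k => U k `\` A k)).
    - by move=> k x _; exact: (ti0 (fun k => U k `\` A k)).
    apply: eq_eseriesr => k _; under eq_integral do rewrite EFinM.
    rewrite ge0_integralZl//; last 2 first.
    - by apply/measurable_EFinP; exact: measurable_indic.
    - by rewrite lee_fin ltW.
    by rewrite integral_indic// setIT.
  rewrite nneseriesZl//.
  have : \sum_(0 <= k <oo) nu (U k `\` A k) <= e'%:E.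
    apply: (@le_trans _ _ (\sum_(0 <= n <oo) (e' / (2 ^ n.+1)%:R)%:E)).
      by apply: lee_nneseries => // n _; apply: ltW; case: (UP n).
    by apply: epsilon_trick0; exact: ltW.
  have t0' : 0 <= t%:E by rewrite lee_fin ltW.
  move=> /(lee_wpmul2l t0') H; apply: (le_trans (leeD2l _ H)).
  rewrite -!EFinM -EFinD lee_fin.
  have : (t * M <= e / 2)%R.
    apply: (@le_trans _ _ (e / 2 / (M + 1) * M)%R).
      by rewrite ler_wpM2r// ge_min lexx orbT.
    rewrite -mulrA ler_piMr//; first by rewrite divr_ge0// ltW.
    by rewrite mulrC ler_pdivrMr; lra.
  have : (t * e' <= e / 2)%R.
    rewrite mulrC -ler_pdivlMr//; by rewrite ge_min lexx orbT.
  lra.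
Qed.

End lsc_majorant.

(** * Energy and increasing sets *)

Section admissible.
Context {R : realType} {X : pointedMetricType R}.
Variables (mu : {measure set (borelType X) -> \bar R}) (p : R).
Hypothesis p1 : 1 < p.
Local Open Scope ereal_scope.
Implicit Types (u : X -> R) (g : borelType X -> \bar R) (E : set X).

Let p0 : (0 < p)%R. Proof. exact: lt_trans p1. Qed.
Let pN0 : p != 0%R. Proof. by rewrite gt_eqF. Qed.

Definition energy u g : \bar R :=
  \int[mu]_x (u x)%:E `^ p + \int[mu]_x g x `^ p.

(** Truncated competitors. Integrability is not recorded: it follows from finiteness of the
    energy. *)
Definition admissible E u g :=
  [/\ (forall x, 0 <= u x <= 1)%R, (forall x, E x -> u x = 1%R),
      mu_measurable mu (EFin \o u) & upper_gradient (EFin \o u) g].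

Lemma energy_ge0 u g : 0 <= energy u g.
Proof. by apply: adde_ge0; apply: integral_ge0 => x _; exact: poweR_ge0. Qed.

Lemma LnormE f : 'N[mu]_p%:E[f] `^ p = \int[mu]_x `|f x| `^ p.
Proof. by rewrite powR_Lnorm. Qed.

Lemma Lnorm_ltyE f : \int[mu]_x `|f x| `^ p < +oo -> 'N[mu]_p%:E[f] < +oo.
Proof. by rewrite -LnormE; exact: lty_poweRy. Qed.

(** Values of [u] above 1 are allowed, for the sake of the rescaled competitor on an open set. If
    the energy is infinite the bound is trivial; otherwise its finiteness gives membership in
    [N1p]. *)
Lemma Cap_le_energy E u g : (forall x, 0 <= u x)%R -> (forall x, E x -> 1 <= u x)%R ->
  mu_measurable mu (EFin \o u) -> upper_gradient (EFin \o u) g ->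
  Cap mu p E <= energy u g.
Proof.
move=> u0 u1 mu_u ug; have [mg g0 _] := ug.
have [->|EN] := eqVneq (energy u g) +oo; first exact: leey.
have fin : energy u g < +oo by rewrite lt_neqAle EN leey.
have uE : \int[mu]_x `|(EFin \o u) x| `^ p = \int[mu]_x (u x)%:E `^ p.
  by apply: eq_integral => x _ /=; rewrite ger0_norm.
have gE : \int[mu]_x `|g x| `^ p = \int[mu]_x g x `^ p.
  by apply: eq_integral => x _ /=; rewrite gee0_abs.
have fu : \int[mu]_x (u x)%:E `^ p < +oo.
  apply: le_lt_trans fin; rewrite leeDl//.
  by apply: integral_ge0 => x _; exact: poweR_ge0.
have fg : \int[mu]_x g x `^ p < +oo.
  apply: le_lt_trans fin; rewrite leeDr//.
  by apply: integral_ge0 => x _; exact: poweR_ge0.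
have N1u : N1p mu p (EFin \o u).
  split; first by split => //; apply: Lnorm_ltyE; rewrite uE.
  exists g => //; split; last by apply: Lnorm_ltyE; rewrite gE.
  by exists g => //; exact: aeW.
apply: (@le_trans _ _ (N1p_norm mu p (EFin \o u) `^ p)).
  by apply: ereal_inf_lbound; exists (EFin \o u) => //; split => // x /u1; rewrite lee_fin.
rewrite /N1p_norm -poweRrM mulVf// poweRe1; last first.
  apply: adde_ge0; first exact: poweR_ge0.
  by apply: le_ereal_inf_tmp => _ [h _ <-]; exact: poweR_ge0.
rewrite LnormE uE; apply: leeD => //.
by apply: ereal_inf_lbound; exists g => //; rewrite LnormE gE.
Qed.

Let trunc01 (x : \bar R) : \bar R := mine 1 (maxe 0 x).

Let trunc01_fin x : (fine (trunc01 x))%:E = trunc01 x.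
Proof.
rewrite fineK// ge0_fin_numE; first by rewrite /trunc01 gt_min ltry.
by rewrite /trunc01 le_min lee01 le_max lexx.
Qed.

Let trunc01_dist x y : `|trunc01 x - trunc01 y| <= `|x - y|.
Proof.
move: x y => [x| |] [y| |] //=; rewrite ?leey// /trunc01 -?EFin_max -?EFin_min.
by rewrite -!EFinB lee_fin; have [] := leP 0%R x; have [] := leP 0%R y => ? ?;
  repeat (match goal with |- context [Num.min ?a ?b] => case: (leP a b) => ? end);
  repeat (match goal with |- context [`|?a|%R] => case: (ger0P a) => ? end); lra.
Qed.

(** Truncation to [[0, 1]] keeps the upper gradient, also at infinite values of [u], where the
    inequality for [u] already has left side [+oo]. *)
Lemma Cap_lt_energy E M : Cap mu p E < M ->
  exists u g, admissible E u g /\ energy u g < M.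
Proof.
move=> /ereal_inf_lt[_ [u [[[mu_u Lu] [g0 ug0 _]] u1] <-]].
rewrite /N1p_norm -poweRrM mulVf// poweRe1; last first.
  apply: adde_ge0; first exact: poweR_ge0.
  by apply: le_ereal_inf_tmp => _ [h _ <-]; exact: poweR_ge0.
have Afin : 'N[mu]_p%:E[u] `^ p \is a fin_num.
  by rewrite ge0_fin_numE ?poweR_ge0//; exact: poweR_lty.
rewrite -lteBrDl// => /ereal_inf_lt[_ [g ug <-]]; rewrite lteBrDl// => H.
exists (fine \o (trunc01 \o u)), g.
have vE x : (EFin \o (fine \o (trunc01 \o u))) x = trunc01 (u x).
  by rewrite /= trunc01_fin.
split; last first.
  apply: le_lt_trans H; rewrite !LnormE; apply: leeD.
    apply: ge0_le_integral_nomeas => x; first exact: poweR_ge0.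
    rewrite -[(_)%:E]/((EFin \o (fine \o (trunc01 \o u))) x) vE.
    apply: gt0_ler_poweR; rewrite ?in_itv/= ?leey ?andbT.
    - exact: ltW.
    - by rewrite /trunc01 le_min lee01 le_max lexx.
    - exact: abse_ge0.
    - rewrite /trunc01 ge_min; apply/orP; right.
      by rewrite ge_max abse_ge0 lee_abs.
  have [_ gpos _] := ug.
  by apply: ge0_le_integral_nomeas => x; [exact: poweR_ge0|rewrite gee0_abs].
split.
- move=> x; rewrite -!lee_fin; have /= -> := vE x.
  by rewrite /trunc01 le_min lee01 le_max lexx/= ge_min lexx.
- move=> x /u1 ux; apply: EFin_inj.
  rewrite -[LHS]/((EFin \o (fine \o (trunc01 \o u))) x) vE /trunc01.
  have u0 : 0 <= u x by apply: le_trans ux.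
  by rewrite (max_idPr u0) (min_idPl ux).
- case: mu_u => h mh uh; exists (trunc01 \o h).
    apply: measurableT_comp => //; rewrite /trunc01.
    apply: measurable_mine; first exact: measurable_cst.
    apply: measurable_maxe; first exact: measurable_cst.
    exact: measurable_id.
  by apply: filterS uh => x ux; rewrite vE ux.
- have [mg gpos Hg] := ug; split => // gam rg.
  rewrite !vE; apply: le_trans (trunc01_dist _ _) _; exact: Hg.
Qed.

Lemma path_integral_le gam g1 g2 : (forall x, 0 <= g1 x) ->
  (forall x, g1 x <= g2 x) -> path_integral gam g1 <= path_integral gam g2.
Proof.
move=> g0 g12; apply: lee_wpmul2l; first exact: curve_length_ge0.
rewrite integral_mkcond [leRHS]integral_mkcond; apply: ge0_le_integral_nomeas => t.
  by apply: erestrict_ge0.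
by rewrite /patch; case: ifP.
Qed.

Lemma path_integral_ge0 gam g : (forall x, 0 <= g x) -> 0 <= path_integral gam g.
Proof.
by move=> g0; apply: mule_ge0; [exact: curve_length_ge0|exact: integral_ge0].
Qed.

Lemma admissible_midpoint E E1 E2 u1 u2 g1 g2 : E `<=` E1 -> E `<=` E2 ->
  admissible E1 u1 g1 -> admissible E2 u2 g2 ->
  admissible E (fun x => (u1 x + u2 x) / 2)%R (fun x => (g1 x + g2 x) * 2^-1%:E).
Proof.
move=> EE1 EE2 [b1 e1 m1 [mg1 g10 ug1]] [b2 e2 m2 [mg2 g20 ug2]].
split.
- by move=> x; have /andP[? ?] := b1 x; have /andP[? ?] := b2 x; apply/andP; split; lra.
- by move=> x Ex; rewrite (e1 _ (EE1 _ Ex)) (e2 _ (EE2 _ Ex)); lra.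
- case: m1 => h1 mh1 H1; case: m2 => h2 mh2 H2.
  exists (fun x => (h1 x + h2 x) * 2^-1%:E).
    apply: emeasurable_funM; last exact: measurable_cst.
    exact: emeasurable_funD.
  by apply: filterS2 H1 H2 => x /= <- <-.
- split.
  + apply: emeasurable_funM; last exact: measurable_cst.
    exact: emeasurable_funD.
  + by move=> x; rewrite mule_ge0// adde_ge0.
  + move=> gam rg; have := ug1 _ rg; have := ug2 _ rg.
    have [c [L [lc c0 c1 PE]]] := constant_speed_curve rg.
    have L0 := lipschitz_curve_ge0 lc.
    rewrite !PE => H2 H1.
    rewrite ge0_integralZr//; last 2 first.
    - have mg12 : measurable_fun setT (fun x => g1 x + g2 x) by exact: emeasurable_funD.
      exact: (measurable_comp_curve lc mg12).
    - by move=> t _; rewrite adde_ge0.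
    rewrite ge0_integralD//; last 2 first.
    - exact: (measurable_comp_curve lc mg1).
    - exact: (measurable_comp_curve lc mg2).
    rewrite muleA ge0_muleDr; [|exact: integral_ge0..].
    rewrite -EFinB /=.
    have -> : ((u1 (gam 1) + u2 (gam 1)) / 2 - (u1 (gam 0) + u2 (gam 0)) / 2 =
       ((u1 (gam 1) - u1 (gam 0)) + (u2 (gam 1) - u2 (gam 0))) / 2)%R by lra.
    rewrite normrM (ger0_norm (_ : 0 <= 2^-1)%R) ?invr_ge0// EFinM.
    apply: lee_wpmul2r; first by rewrite lee_fin.
    by apply: le_trans (leeD H1 H2); rewrite lee_fin ler_normD.
Qed.

Lemma mu_measurable_version u : (forall x, 0 <= u x)%R -> mu_measurable mu (EFin \o u) ->
  exists (h : borelType X -> \bar R) (N : set (borelType X)),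
    [/\ measurable_fun setT h, forall x, 0 <= h x, measurable N, mu N = 0 &
        forall x, ~ N x -> (u x)%:E = h x].
Proof.
move=> u0 [h mh [N [mN N0 HN]]]; exists (fun x => maxe 0 (h x)), N; split => //.
- apply: measurable_maxe => //; exact: measurable_cst.
- by move=> x; rewrite le_max lexx.
- move=> x Nx; have <- : (EFin \o u) x = h x by apply: contrapT => H; apply: Nx; exact: HN.
  by rewrite max_r ?lee_fin.
Qed.

Lemma energy_version u g (h : borelType X -> \bar R) (N : set (borelType X)) :
  (forall x, 0 <= u x)%R -> (forall x, 0 <= h x) -> measurable_fun setT h ->
  measurable N -> mu N = 0 -> (forall x, ~ N x -> (u x)%:E = h x) ->
  energy u g = \int[mu]_x h x `^ p + \int[mu]_x g x `^ p.
Proof.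
move=> u0 h0 mh mN N0 uh; congr (_ + _).
apply: (ge0_integral_eq_off mN N0).
- by move=> x; exact: poweR_ge0.
- by move=> x; exact: poweR_ge0.
- exact: (measurableT_comp (measurable_poweR p) mh).
- by move=> x /uh ->.
Qed.

Lemma measurable_poweR_comp (f : borelType X -> \bar R) :
  measurable_fun setT f -> measurable_fun setT (fun x => f x `^ p).
Proof. by move=> mf; exact: (measurableT_comp (measurable_poweR p) mf). Qed.

Let excess (f1 f2 : borelType X -> \bar R) x := maxe 0 (f2 x `^ p - f1 x `^ p).

Let measurable_excess f1 f2 : measurable_fun setT f1 -> measurable_fun setT f2 ->
  measurable_fun setT (excess f1 f2).
Proof.
move=> m1 m2; apply: measurable_maxe; first exact: measurable_cst.
by apply: emeasurable_funB; exact: measurable_poweR_comp.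
Qed.

Let excess_ge0 f1 f2 x : 0 <= excess f1 f2 x.
Proof. by rewrite /excess le_max lexx. Qed.

(** Telescoping: at each point the [p]-th power of [f k] is at most that of [f 0] plus the positive
    increments in between, a bound that passes to the supremum. *)
Let integral_sup_power (f : nat -> borelType X -> \bar R) :
  (forall k x, 0 <= f k x) -> (forall k, measurable_fun setT (f k)) ->
  \int[mu]_x (ereal_sup (range (f ^~ x))) `^ p <=
  \int[mu]_x (f 0%N x) `^ p + \sum_(0 <= k <oo) \int[mu]_x excess (f k) (f k.+1) x.
Proof.
move=> f0 mf.
rewrite -integral_nneseries//; last first.
  by move=> k; exact: measurable_excess.
rewrite -ge0_integralD//; last 4 first.
- by move=> x _; exact: poweR_ge0.
- exact: measurable_poweR_comp.
- by move=> x _; apply: nneseries_ge0 => k _ _; exact: excess_ge0.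
- by apply: ge0_emeasurable_sum => [k x *|k *]; [exact: excess_ge0|exact: measurable_excess].
apply: ge0_le_integral_nomeas => x; first exact: poweR_ge0.
set S := (_ + _).
have S0 : 0 <= S.
  by apply: adde_ge0; [exact: poweR_ge0|apply: nneseries_ge0 => k _ _; exact: excess_ge0].
have fS k : f k x `^ p <= S.
  apply: (@le_trans _ _ (f 0%N x `^ p + \sum_(0 <= i < k) excess (f i) (f i.+1) x)).
    elim: k => [|k ih]; first by rewrite big_nil adde0.
    rewrite big_nat_recr//= addeA.
    apply: le_trans (leeD2r _ ih); rewrite /excess.
    (* Subtracting [+oo] always gives [-oo], so the excess vanishes if [f k x] is infinite; the
       induction hypothesis then makes the right side infinite. *)
    have [->|kN] := eqVneq (f k x `^ p) +oo.
      by rewrite addye ?leey// gt_eqF// (lt_le_trans (ltNyr 0))// le_max lexx.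
    have kf : f k x `^ p \is a fin_num.
      by rewrite ge0_fin_numE ?poweR_ge0// lt_neqAle kN leey.
    by rewrite -leeBlDl// le_max lexx orbT.
  apply: leeD2l; apply: nneseries_lim_ge => i _ _; exact: excess_ge0.
have SE : S = (S `^ p^-1) `^ p by rewrite -poweRrM mulVf// poweRe1.
rewrite SE; apply: gt0_ler_poweR; rewrite ?in_itv/= ?leey ?andbT ?poweR_ge0//.
- exact: ltW.
- by apply: le_ereal_sup_tmp; exists (f 0%N x) => //; exists 0%N.
- apply: ge_ereal_sup => _ [k _ <-].
  have -> : f k x = (f k x `^ p) `^ p^-1 by rewrite -poweRrM mulfV// poweRe1.
  apply: gt0_ler_poweR; rewrite ?in_itv/= ?leey ?andbT ?poweR_ge0//.
  by rewrite invr_ge0 ltW.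
Qed.

Lemma Cap_ge0 E : 0 <= Cap mu p E.
Proof. by apply: le_ereal_inf_tmp => _ [u _ <-]; exact: poweR_ge0. Qed.

Lemma Cap_le E1 E2 : E1 `<=` E2 -> Cap mu p E1 <= Cap mu p E2.
Proof.
move=> E12; apply: le_ereal_inf => _ [u [N1u u1] <-]; exists u => //.
by split => // x /E12; exact: u1.
Qed.

Lemma Cap_le_admissible E u g : admissible E u g -> Cap mu p E <= energy u g.
Proof.
move=> [u01 u1 mu_u ug]; apply: Cap_le_energy => //.
- by move=> x; case/andP: (u01 x).
- by move=> x /u1 ->.
Qed.

Lemma admissible_sup (A : nat -> set X) (u : nat -> X -> R)
    (g : nat -> borelType X -> \bar R) :
  (forall j, admissible (A j) (u j) (g j)) ->
  admissible (\bigcup_j A j) (fun x => fine (ereal_sup (range (fun j => (u j x)%:E))))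
    (fun x => ereal_sup (range (g ^~ x))).
Proof.
move=> adm.
have u01 j x : (0 <= u j x <= 1)%R by case: (adm j).
have S01 x : 0 <= ereal_sup (range (fun j => (u j x)%:E)) <= 1.
  apply/andP; split.
    apply: le_ereal_sup_tmp; exists (u 0%N x)%:E; first by exists 0%N.
    by rewrite lee_fin; case/andP: (u01 0%N x).
  by apply: ge_ereal_sup => _ [j _ <-]; rewrite lee_fin; case/andP: (u01 j x).
set U := fun x => fine _.
have UE x : (U x)%:E = ereal_sup (range (fun j => (u j x)%:E)).
  rewrite /U fineK//; case/andP: (S01 x) => s0 s1.
  by rewrite ge0_fin_numE// (le_lt_trans s1)// ltry.
have uU j x : (u j x <= U x)%R.
  by rewrite -lee_fin UE; apply: ereal_sup_ubound; exists j.
have gG j x : g j x <= ereal_sup (range (g ^~ x)) by apply: ereal_sup_ubound; exists j.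
have g0 j x : 0 <= g j x by case: (adm j) => _ _ _ [].
have mG : measurable_fun [set: borelType X] (fun x => ereal_sup (range (g ^~ x))).
  have := @measurable_fun_esups _ _ _ setT g _ 0%N.
  rewrite (_ : (fun x => esups (g ^~ x) 0%N) = (fun x => ereal_sup (range (g ^~ x)))).
    by apply => j; case: (adm j) => _ _ _ [].
  apply/funext => x; rewrite /esups /sdrop; congr ereal_sup.
  by apply/seteqP; split => [_ [n _ <-]|_ [n _ <-]]; exists n.
split.
- by move=> x; rewrite -!lee_fin UE.
- move=> x [j _ Ajx]; apply/eqP; rewrite eq_le -{1}lee_fin UE.
  case/andP: (S01 x) => _ ->/=; apply: le_trans (uU j x).
  by case: (adm j) => _ ->.
- have /choice[h hP] : forall j, exists h : borelType X -> \bar R,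
      measurable_fun setT h /\ {ae mu, forall x, (u j x)%:E = h x}.
    by move=> j; case: (adm j) => _ _ [h mh uh] _; exists h.
  exists (fun x => esups (h ^~ x) 0%N).
    by apply: measurable_fun_esups => j; case: (hP j).
  have : {ae mu, forall x, forall j, (u j x)%:E = h j x}.
    by apply: ae_foralln => j; case: (hP j).
  move=> [N [mN N0 HN]]; exists N; split => // x Hx; apply: HN => /= H; apply: Hx.
  rewrite /= UE /esups /sdrop; congr ereal_sup.
  by apply/seteqP; split => [_ [n _ <-]|_ [n _ <-]]; exists n => //; rewrite H.
- split => //; first by move=> x; exact: le_trans (gG 0%N x).
  move=> gam rg; set I := path_integral _ _.
  have [->|IN] := eqVneq I +oo; first exact: leey.
  have I0 : 0 <= I by apply: path_integral_ge0 => x; exact: le_trans (gG 0%N x).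
  have If : I \is a fin_num by rewrite ge0_fin_numE// lt_neqAle IN leey.
  have H j : (`|u j (gam 1) - u j (gam 0)| <= fine I)%R.
    rewrite -lee_fin (fineK If).
    have [_ _ _ [_ _ ug]] := adm j; apply: (le_trans (ug _ rg)).
    exact: path_integral_le.
  have K a b : (forall j, (`|u j a - u j b| <= fine I)%R) -> (U a <= U b + fine I)%R.
    move=> H'; rewrite -lee_fin UE; apply: ge_ereal_sup => _ [j _ <-].
    rewrite lee_fin; have := H' j; have := uU j b; rewrite ler_norml => ? /andP[]; lra.
  rewrite /= -(fineK If) lee_fin ler_norml.
  have := K _ _ H; have := K (gam 0%R) (gam 1%R).
  have H' j : (`|u j (gam 0) - u j (gam 1)| <= fine I)%R by rewrite distrC.
  by move=> /(_ H'); lra.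
Qed.

(** The midpoint inequality is integrated for the functions and for the gradients; the midpoint pair
    competes for [E], so its energy is at least [Cap mu p E]. The Borel versions [h1], [h2] give
    access to additivity of the integral. *)
Let energy_excess (e C : R) E E1 E2 u1 u2 g1 g2 (h1 h2 : borelType X -> \bar R)
    (N1 N2 : set (borelType X)) :
  (0 < C)%R -> (0 < e)%R ->
  (forall a b, 0 <= a -> 0 <= b ->
    maxe 0 (b `^ p - a `^ p) + C%:E * ((a + b) * 2^-1%:E) `^ p <=
    (e + C / 2)%:E * (a `^ p + b `^ p)) ->
  E `<=` E1 -> E `<=` E2 -> admissible E1 u1 g1 -> admissible E2 u2 g2 ->
  measurable_fun setT h1 -> measurable_fun setT h2 ->
  (forall x, 0 <= h1 x) -> (forall x, 0 <= h2 x) ->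
  measurable N1 -> measurable N2 -> mu N1 = 0 -> mu N2 = 0 ->
  (forall x, ~ N1 x -> (u1 x)%:E = h1 x) -> (forall x, ~ N2 x -> (u2 x)%:E = h2 x) ->
  \int[mu]_x excess h1 h2 x + \int[mu]_x excess g1 g2 x + C%:E * Cap mu p E <=
  (e + C / 2)%:E * (energy u1 g1 + energy u2 g2).
Proof.
move=> C0 e0 HC EE1 EE2 a1 a2 mh1 mh2 h10 h20 mN1 mN2 N10 N20 uh1 uh2.
have am := admissible_midpoint EE1 EE2 a1 a2.
have CapE := Cap_le_admissible am.
have [b1 _ _ [mg1 g10 _]] := a1; have [b2 _ _ [mg2 g20 _]] := a2.
have cp : (0 <= e + C / 2)%R by rewrite addr_ge0 ?divr_ge0// ltW.
have mid (f1 f2 : borelType X -> \bar R) : measurable_fun setT f1 -> measurable_fun setT f2 ->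
    (forall x, 0 <= f1 x) -> (forall x, 0 <= f2 x) ->
    \int[mu]_x excess f1 f2 x + C%:E * \int[mu]_x ((f1 x + f2 x) * 2^-1%:E) `^ p <=
    (e + C / 2)%:E * (\int[mu]_x f1 x `^ p + \int[mu]_x f2 x `^ p).
  move=> m1 m2 f10 f20.
  have mm : measurable_fun setT (fun x => ((f1 x + f2 x) * 2^-1%:E) `^ p).
    apply: measurable_poweR_comp; apply: emeasurable_funM; last exact: measurable_cst.
    exact: emeasurable_funD.
  rewrite -ge0_integralZl//; last 2 first.
  - by move=> x _; exact: poweR_ge0.
  - by rewrite lee_fin ltW.
  rewrite -ge0_integralD//; last 3 first.
  - exact: measurable_excess.
  - by move=> x _; rewrite mule_ge0 ?poweR_ge0// lee_fin ltW.
  - by apply: emeasurable_funM => //; exact: measurable_cst.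
  rewrite -[in leRHS]ge0_integralD//; last 4 first.
  - by move=> x _; exact: poweR_ge0.
  - exact: measurable_poweR_comp.
  - by move=> x _; exact: poweR_ge0.
  - exact: measurable_poweR_comp.
  rewrite -ge0_integralZl//; last 2 first.
  - by apply: emeasurable_funD; exact: measurable_poweR_comp.
  - by move=> x _; rewrite adde_ge0 ?poweR_ge0.
  apply: ge0_le_integral_nomeas => x; last exact: HC.
  by rewrite adde_ge0 ?excess_ge0// mule_ge0 ?poweR_ge0// lee_fin ltW.
have E1E := energy_version g1 (fun x => proj1 (andP (b1 x))) h10 mh1 mN1 N10 uh1.
have E2E := energy_version g2 (fun x => proj1 (andP (b2 x))) h20 mh2 mN2 N20 uh2.
have EmE : energy (fun x => (u1 x + u2 x) / 2)%R (fun x => (g1 x + g2 x) * 2^-1%:E) =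
    \int[mu]_x ((h1 x + h2 x) * 2^-1%:E) `^ p + \int[mu]_x ((g1 x + g2 x) * 2^-1%:E) `^ p.
  apply: (@energy_version _ _ _ (N1 `|` N2)).
  - by move=> x; have /andP[? ?] := b1 x; have /andP[? ?] := b2 x; lra.
  - by move=> x; rewrite mule_ge0// adde_ge0.
  - apply: emeasurable_funM; last exact: measurable_cst.
    exact: emeasurable_funD.
  - exact: measurableU.
  - apply/eqP; rewrite eq_le measure_ge0 andbT.
    apply: (@le_trans _ _ (mu N1 + mu N2)); last by rewrite N10 N20 adde0.
    exact: measureU2.
  - by move=> x /not_orP[/uh1 <- /uh2 <-]; rewrite EFinM EFinD.
move: CapE; rewrite EmE => CapE.
apply: (@le_trans _ _ (\int[mu]_x excess h1 h2 x + \int[mu]_x excess g1 g2 x +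
  C%:E * (\int[mu]_x ((h1 x + h2 x) * 2^-1%:E) `^ p + \int[mu]_x ((g1 x + g2 x) * 2^-1%:E) `^ p))).
  by apply: leeD2l; apply: lee_wpmul2l => //; rewrite lee_fin ltW.
rewrite ge0_muleDr; [|by apply: integral_ge0 => x _; exact: poweR_ge0..].
rewrite addeACA; apply: le_trans (leeD (mid _ _ mh1 mh2 h10 h20) (mid _ _ mg1 mg2 g10 g20)) _.
rewrite -ge0_muleDr; [|by apply: adde_ge0; apply: integral_ge0 => x _; exact: poweR_ge0..].
by rewrite E1E E2E addeACA.
Qed.

Let excess_choice (m : R) (eta : R) : (0 <= m)%R -> (0 < eta)%R -> exists s : R,
  (0 < s)%R /\ forall t : R, (0 < t <= s)%R ->
    forall E E1 E2 u1 u2 g1 g2 (h1 h2 : borelType X -> \bar R)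
      (N1 N2 : set (borelType X)),
  E `<=` E1 -> E `<=` E2 -> admissible E1 u1 g1 -> admissible E2 u2 g2 ->
  measurable_fun setT h1 -> measurable_fun setT h2 ->
  (forall x, 0 <= h1 x) -> (forall x, 0 <= h2 x) ->
  measurable N1 -> measurable N2 -> mu N1 = 0 -> mu N2 = 0 ->
  (forall x, ~ N1 x -> (u1 x)%:E = h1 x) -> (forall x, ~ N2 x -> (u2 x)%:E = h2 x) ->
  (m - t)%:E <= Cap mu p E -> energy u1 g1 <= (m + t)%:E -> energy u2 g2 <= (m + t)%:E ->
  \int[mu]_x excess h1 h2 x + \int[mu]_x excess g1 g2 x <= eta%:E.
Proof.
move=> m0 eta0.
(* Energies at most [m + t] and capacity at least [m - t] leave an excess of at most
   [2 e (m + t) + 2 C t]. First [e], then the bound on [t], which depends on [C], make each term at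
   most [eta / 2]. *)
pose e := (eta / (4 * (m + 1)))%R.
have e0 : (0 < e)%R by rewrite divr_gt0// mulr_gt0//; lra.
have [C C0 HC] := poweR_midpoint_bound p1 e0.
exists (Num.min 1 (eta / (4 * C)))%R; split.
  by rewrite lt_min ltr01 divr_gt0// mulr_gt0.
move=> t /andP[t0]; rewrite le_min => /andP[t1 tC] E E1 E2 u1 u2 g1 g2 h1 h2 N1 N2.
move=> H1 H2 H3 H4 H5 H6 H7 H8 H9 H10 H11 H12 H13 H14 HE J1 J2.
have := energy_excess C0 e0 HC H1 H2 H3 H4 H5 H6 H7 H8 H9 H10 H11 H12 H13 H14.
set S := (X in X + _ <= _) => HS.
have cp : (0 <= e + C / 2)%R by apply: addr_ge0; [exact: ltW|apply: divr_ge0 => //; exact: ltW].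
have : S + (C * (m - t))%:E <= ((e + C / 2) * (2 * (m + t)))%:E.
  apply: (@le_trans _ _ (S + C%:E * Cap mu p E)).
    by apply: leeD2l; rewrite EFinM; apply: lee_wpmul2l => //; rewrite lee_fin ltW.
  apply: (le_trans HS); rewrite EFinM; apply: lee_wpmul2l => //.
  have -> : (2 * (m + t) = (m + t) + (m + t))%R by ring.
  by rewrite EFinD; exact: leeD.
rewrite -leeBrDr// -EFinB => /le_trans; apply; rewrite lee_fin.
have -> : ((e + C / 2) * (2 * (m + t)) - C * (m - t) = e * (2 * (m + t)) + 2 * (C * t))%R by field.
have : (C * t <= eta / 4)%R.
  rewrite mulrC -ler_pdivlMr//; apply: (le_trans tC).
  by rewrite invfM mulrA.
have : (e * (2 * (m + t)) <= eta / 2)%R.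
  apply: (@le_trans _ _ (e * (2 * (m + 1)))%R).
    by apply: ler_wpM2l; [exact: ltW|lra].
  by rewrite /e le_eqVlt; apply/orP; left; apply/eqP; field; lra.
lra.
Qed.

Lemma Cap_bigcup_le (A : nat -> set X) (m : R) :
  (forall n, A n `<=` A n.+1) -> (forall n, Cap mu p (A n) <= m%:E) ->
  (forall t, (0 < t)%R -> exists n, (m - t)%:E <= Cap mu p (A n)) ->
  Cap mu p (\bigcup_n A n) <= m%:E.
Proof.
move=> Ainc Am mA.
have m0 : (0 <= m)%R by rewrite -lee_fin; exact: le_trans (Cap_ge0 _) (Am 0%N).
have Ale i j : (i <= j)%N -> A i `<=` A j.
  move=> /subnK <-; elim: (j - i)%N => // k ih; rewrite addSn.
  exact: subset_trans ih (Ainc _).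
apply/lee_addgt0Pr => eta eta0.
pose en k := (eta / 2 / (2 ^ k.+1)%:R)%R.
have en0 k : (0 < en k)%R by rewrite /en !divr_gt0// ltr0n expn_gt0.
have /choice[s sP] := fun k => excess_choice m0 (en0 k).
(* [tau] decreases, stays below [s] and starts below [eta / 2]: the first energy uses half of [eta],
   the increments, bounded by [en], the other half. *)
pose fix tau (k : nat) : R := if k is k'.+1 then Num.min (tau k') (s k) else
  Num.min (eta / 2)%R (s 0%N).
have tau0 k : (0 < tau k)%R.
  elim: k => [|k ih] /=; first by rewrite lt_min (sP 0%N).1 divr_gt0.
  by rewrite lt_min ih (sP k.+1).1.
have taus k : (tau k <= s k)%R by case: k => [|k] /=; rewrite ge_min lexx orbT.
have tauS k : (tau k.+1 <= tau k)%R by rewrite /= ge_min lexx.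
have /choice[N0 N0P] : forall k, exists n, (m - tau k)%:E <= Cap mu p (A n).
  by move=> k; exact: mA.
(* [k <= N k] makes the subsequence exhaust the union. It need not be monotone, so consecutive pairs
   are compared on the smaller of their two sets. *)
pose N k := maxn (N0 k) k.
have NP k : (m - tau k)%:E <= Cap mu p (A (N k)).
  by apply: le_trans (N0P k) _; apply: Cap_le; apply: Ale; exact: leq_maxl.
have /choice[ug ugP] : forall k, exists ug : (X -> R) * (borelType X -> \bar R),
    admissible (A (N k)) ug.1 ug.2 /\ energy ug.1 ug.2 < (m + tau k)%:E.
  move=> k; have [|u [g [H1 H2]]] := @Cap_lt_energy (A (N k)) (m + tau k)%:E.
    by apply: le_lt_trans (Am _) _; rewrite lte_fin ltrDl.
  by exists (u, g).
pose u k := (ug k).1; pose g k := (ug k).2.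
have adm k : admissible (A (N k)) (u k) (g k) by case: (ugP k).
have ene k : energy (u k) (g k) <= (m + tau k)%:E by apply: ltW; case: (ugP k).
have u0 k x : (0 <= u k x)%R by case: (adm k) => /(_ x) /andP[].
have g0 k x : 0 <= g k x by case: (adm k) => _ _ _ [].
have mg k : measurable_fun setT (g k) by case: (adm k) => _ _ _ [].
have /choice[hN hNP] : forall k, exists hN : (borelType X -> \bar R) * set (borelType X),
    [/\ measurable_fun setT hN.1, forall x, 0 <= hN.1 x, measurable hN.2, mu hN.2 = 0 &
        forall x, ~ hN.2 x -> (u k x)%:E = hN.1 x].
  move=> k; case: (adm k) => _ _ mu_u _.
  by have [h [Nk H]] := mu_measurable_version (u0 k) mu_u; exists (h, Nk).
pose h k := (hN k).1; pose Nn k := (hN k).2.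
have mh k : measurable_fun setT (h k) by case: (hNP k).
have h0 k x : 0 <= h k x by case: (hNP k) => _ + _ _ _; apply.
have mN k : measurable (Nn k) by case: (hNP k).
have N00 k : mu (Nn k) = 0 by case: (hNP k).
have uh k x : ~ Nn k x -> (u k x)%:E = h k x by case: (hNP k) => _ _ _ _; apply.
have exk k : \int[mu]_x excess (h k) (h k.+1) x + \int[mu]_x excess (g k) (g k.+1) x <= (en k)%:E.
  have [sk Hk] := sP k.
  apply: (Hk (tau k) _ (A (minn (N k) (N k.+1))) (A (N k)) (A (N k.+1))
    (u k) (u k.+1) (g k) (g k.+1) _ _ (Nn k) (Nn k.+1)) => //.
  - by rewrite tau0 taus.
  - by apply: Ale; exact: geq_minl.
  - by apply: Ale; exact: geq_minr.
  - exact: uh.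
  - exact: uh.
  - have [_|_] := leqP (N k) (N k.+1); first exact: NP.
    by apply: le_trans (NP k.+1); rewrite lee_fin lerD2l lerN2.
  - by apply: le_trans (ene k.+1) _; rewrite lee_fin lerD2l.
have admS := admissible_sup adm.
have bcE : \bigcup_n A n `<=` \bigcup_k A (N k).
  by move=> x [n _ Anx]; exists n => //; apply: (Ale n) Anx; exact: leq_maxr.
apply: (le_trans (Cap_le bcE)); apply: (le_trans (Cap_le_admissible admS)).
have U01 x : 0 <= ereal_sup (range (fun j => (u j x)%:E)) <= 1.
  apply/andP; split.
    apply: le_ereal_sup_tmp; exists (u 0%N x)%:E; first by exists 0%N.
    by rewrite lee_fin.
  by apply: ge_ereal_sup => _ [j _ <-]; rewrite lee_fin; case: (adm j) => /(_ x) /andP[].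
rewrite (@energy_version _ _ (fun x => esups (h ^~ x) 0%N) (\bigcup_k Nn k)); last first.
- move=> x Nx; have [US0 US1] := andP (U01 x); rewrite fineK; last first.
    by rewrite ge0_fin_numE// (le_lt_trans US1)// ltry.
  rewrite /esups /sdrop; congr ereal_sup.
  have H n : (u n x)%:E = h n x by apply: uh => Nnx; apply: Nx; exists n.
  by apply/seteqP; split => [_ [n _ <-]|_ [n _ <-]]; exists n => //; rewrite H.
- apply/eqP; rewrite eq_le measure_ge0 andbT.
  apply: (le_trans (measure_sigma_subadditive mu mN _ _)) => //.
    exact: bigcupT_measurable.
  by rewrite eseries0// => k _ _; exact: N00.
- exact: bigcupT_measurable.
- exact: measurable_fun_esups.
- move=> x; apply: le_ereal_sup_tmp; exists (h 0%N x) => //; by exists 0%N.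
- by move=> x; apply: fine_ge0; case/andP: (U01 x).
have hE x : esups (h ^~ x) 0%N = ereal_sup (range (h ^~ x)).
  rewrite /esups /sdrop; congr ereal_sup.
  by apply/seteqP; split => [_ [n _ <-]|_ [n _ <-]]; exists n.
under [X in X + _ <= _]eq_integral => x _ do rewrite hE.
apply: (le_trans (leeD (integral_sup_power h0 mh) (integral_sup_power g0 mg))).
rewrite addeACA -(energy_version (g 0%N) (u0 0%N) (h0 0%N) (mh 0%N) (mN 0%N) (N00 0%N) (uh 0%N)).
rewrite -nneseriesD//; last 2 first.
- by move=> k _ _; apply: integral_ge0 => x _; exact: excess_ge0.
- by move=> k _ _; apply: integral_ge0 => x _; exact: excess_ge0.
have -> : (eta = eta / 2 + eta / 2)%R by field.
rewrite EFinD addeA; apply: leeD.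
  apply: (le_trans (ene 0%N)); rewrite -EFinD lee_fin lerD2l /=.
  by rewrite ge_min lexx.
apply: (@le_trans _ _ (\sum_(0 <= k <oo) (en k)%:E)).
  apply: lee_nneseries => [k _ _|k _]; last exact: exk.
  by apply: adde_ge0; apply: integral_ge0 => x _; exact: excess_ge0.
by apply: epsilon_trick0; rewrite divr_ge0// ltW.
Qed.

End admissible.

(** * The obstacle function *)

Section value_function.
Context {R : realType} {X : pointedMetricType R}.
Variables (N : set X) (phi gt : X -> \bar R).
Hypothesis phi0 : forall x, (0 <= phi x)%E.
Hypothesis gt0 : forall x, (0 <= gt x)%E.
Hypothesis mgt : measurable_fun [set: borelType X] (gt : borelType X -> \bar R).
Local Notation leb := (@lebesgue_measure R).

(** Speed at most 1 and a free duration [T] replace arc length: unlike a constant-speed condition,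
    this passes to pointwise limits. *)
Definition curve_in (x : X) (c : R -> X) (T : R) :=
  [/\ lipschitz_curve 1 c, forall t, N (c t), 0 <= T & c 0 = x].

Local Open Scope ereal_scope.

Definition curve_cost (c : R -> X) (T : R) : \bar R :=
  phi (c T) + \int[leb]_(t in `[0%R, T]) gt (c t).

(** The value function of an optimal control problem. No curve is allowed from a point outside [N],
    so the value there is the cap 1. *)
Definition value (x : X) : \bar R :=
  mine 1 (ereal_inf [set y | exists c T, curve_in x c T /\ y = curve_cost c T]).

Lemma curve_cost_ge0 c T : 0 <= curve_cost c T.
Proof. by apply: adde_ge0 => //; exact: integral_ge0. Qed.

Lemma value_ge0 x : 0 <= value x.
Proof.
rewrite /value le_min lee01/=; apply: le_ereal_inf_tmp => _ [c [T [_ ->]]].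
exact: curve_cost_ge0.
Qed.

Lemma value_le1 x : value x <= 1.
Proof. by rewrite /value ge_min lexx. Qed.

Lemma value_fin x : value x \is a fin_num.
Proof.
by rewrite ge0_fin_numE ?value_ge0// (le_lt_trans (value_le1 x))// ltry.
Qed.

Lemma value_le_cost x c T : curve_in x c T -> value x <= curve_cost c T.
Proof.
move=> H; rewrite /value ge_min; apply/orP; right.
by apply: ereal_inf_lbound; exists c, T.
Qed.

Lemma value_lt x (a : R) : (a <= 1)%R -> value x < a%:E ->
  exists c T, curve_in x c T /\ curve_cost c T < a%:E.
Proof.
move=> a1; rewrite /value gt_min => /orP[|/ereal_inf_lt[_ [c [T [H ->]]] HT]].
  by rewrite lte_fin ltNge a1.
by exists c, T.
Qed.

Lemma value_le_phi x : N x -> value x <= phi x.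
Proof.
move=> Nx; apply: (@le_trans _ _ (curve_cost (fun=> x) 0)).
  apply: value_le_cost; split => // s t.
  by rewrite mdistxx mulr_ge0.
by rewrite /curve_cost set_itv1 integral_set1 adde0.
Qed.

Let mcomp L (c : R -> X) D : lipschitz_curve L c ->
  measurable_fun (D : set (measurableTypeR R)) (gt \o c).
Proof. by move=> lc; exact: measurable_comp_curve lc mgt. Qed.

(** Dynamic programming: prepend the arc of [c] up to time [tau] to an arbitrary curve from
    [c tau]. *)
Lemma value_prefix (c : R -> X) (tau : R) : lipschitz_curve 1 c ->
  (forall t, N (c t)) -> (0 <= tau)%R ->
  value (c 0%R) <= value (c tau) + \int[leb]_(t in `[0%R, tau]) gt (c t).
Proof.
move=> lc cN tau0; set I := integral _ _ _.
have I0 : 0 <= I by exact: integral_ge0.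
have [->|IN] := eqVneq I +oo.
  by rewrite addey ?leey// gt_eqF// (lt_le_trans (ltNyr 0))// value_ge0.
have If : I \is a fin_num by rewrite ge0_fin_numE// lt_neqAle IN leey.
rewrite -leeBlDr//.
rewrite [leRHS]/value le_min; apply/andP; split.
  by rewrite leeBlDr// (le_trans (value_le1 _))// leeDl.
apply: le_ereal_inf_tmp => _ [c2 [T [[lc2 c2N T0 c20] ->]]].
rewrite leeBlDr//.
pose e (t : R) := if (t <= tau)%R then c t else c2 (t - tau)%R.
have ec t : (t <= tau)%R -> e t = c t by rewrite /e => ->.
have ec2 t : (tau <= t)%R -> e t = c2 (t - tau)%R.
  rewrite le_eqVlt => /predU1P[<-|h]; first by rewrite ec// subrr c20.
  by rewrite /e leNgt h.
have le : lipschitz_curve 1 e.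
  have H s t : (s <= t)%R -> (mdist (e s) (e t) <= 1 * `|s - t|)%R.
    move=> st; have [ttau|taut] := leP t tau.
      by rewrite !ec// (le_trans st).
    have [stau|taus] := leP s tau; last first.
      rewrite (ec2 s (ltW taus)) (ec2 t (ltW taut)); apply: (le_trans (lc2 _ _)).
      by rewrite (_ : s - tau - (t - tau) = s - t)%R//; ring.
    apply: le_trans (metric_triangle _ (c tau) _) _.
    rewrite (ec s)// (ec2 t (ltW taut)).
    have h1 := lc s tau; have h2 := lc2 0%R (t - tau)%R.
    have e1 : (`|s - tau| = tau - s)%R by rewrite distrC ger0_norm ?subr_ge0.
    have e2 : (`|0 - (t - tau)| = t - tau)%R.
      by rewrite sub0r normrN ger0_norm// subr_ge0 ltW.
    have e3 : (`|s - t| = t - s)%R by rewrite distrC ger0_norm// subr_ge0.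
    by move: h1 h2; rewrite c20 e1 e2 e3; lra.
  move=> s t; have [/H//|/ltW/H] := leP s t.
  by rewrite metric_sym distrC.
have eN t : N (e t) by rewrite /e; case: ifP.
have eT : (0 <= tau + T)%R by rewrite addr_ge0.
apply: (@le_trans _ _ (curve_cost e (tau + T))).
  by apply: value_le_cost; split => //; rewrite ec.
rewrite /curve_cost ec2 ?lerDl// (addrC tau) addrK -addeA; apply: leeD2l.
have itvE : `[0%R, (T + tau)%R]%classic = `[0%R, tau] `|` `]tau, (T + tau)%R]%classic.
  apply/seteqP; split => t /=; rewrite !in_itv/=.
    by move=> /andP[t0 tT]; have [ttau|taut] := leP t tau; [left|right]; rewrite ?t0.
  move=> [/andP[-> ttau]|/andP[taut ->]]/=.
    by rewrite (le_trans ttau)// lerDr.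
  by rewrite (le_trans tau0)// ltW.
rewrite itvE ge0_integral_setU//; last 2 first.
- exact: (mcomp le).
- apply/disj_set2P; apply/seteqP; split => // t [] /=; rewrite !in_itv/=.
  by move=> /andP[_ h1] /andP[h2 _]; move: h1; rewrite leNgt h2.
rewrite addeC; apply: leeD.
  rewrite -[leLHS]mul1e -[leRHS]mul1e.
  rewrite [X in 1 * X](_ : _ = \int[leb]_(t in `]tau, (T + tau)%R]) gt (c2 (t - tau)%R)).
    apply: (@ge0_le_integral_substitution _ (fun t => t - tau)%R _ _ 1 1 (gt \o c2)) => //.
    - apply: measurable_funTS; apply: continuous_measurable_fun => x.
      by apply: cvgB; [exact: cvg_id|exact: cvg_cst].
    - by move=> t /=; rewrite !in_itv/= => /andP[h1 h2]; apply/andP; split; lra.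
    - exact: (mcomp lc2).
    - by move=> t _; exact: gt0.
    - move=> x y xy; rewrite !mul1e mul1r.
      apply: (@le_trans _ _ (leb `](x + tau)%R, (y + tau)%R]%classic)).
        apply: le_measure; rewrite ?inE.
        - apply: measurableI => //; rewrite -[X in measurable X]setTI.
          have ms : measurable_fun [set: measurableTypeR R] (fun t : R => t - tau)%R.
            apply: continuous_measurable_fun => z.
            by apply: cvgB; [exact: cvg_id|exact: cvg_cst].
          by apply: ms => //; exact: measurable_itv.
        - exact: measurable_itv.
        - by move=> t [_] /=; rewrite !in_itv/= => /andP[h1 h2]; apply/andP; split; lra.
      rewrite lebesgue_measure_itv/=.
      case: ifPn => _; last by rewrite lee_fin subr_ge0.
      by rewrite -EFinD lee_fin; lra.
  apply: eq_integral => t; rewrite inE/= in_itv/= => /andP[h1 _].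
  by rewrite ec2// ltW.
rewrite le_eqVlt; apply/orP; left; apply/eqP; apply: eq_integral => t.
by rewrite inE/= in_itv/= => /andP[_ h1]; rewrite ec.
Qed.

(** So [gt] acts as an upper gradient of [value] along arcs in [N]: dynamic programming is applied
    to the arc traversed in either direction, and [clamp] keeps the curve in [N] at other times. *)
Lemma value_arc (c : R -> X) (L a b : R) : lipschitz_curve L c -> (a <= b)%R ->
  (forall t, (a <= t <= b)%R -> N (c t)) ->
  `|value (c b) - value (c a)| <= L%:E * \int[leb]_(t in `[a, b]) gt (c t).
Proof.
move=> lc ab cN; have L0 := lipschitz_curve_ge0 lc.
have [L00|LN] := eqVneq L 0%R.
  have -> : c b = c a.
    apply: mdist_positivity; apply/eqP; rewrite eq_le mdist_ge0 andbT.
    by apply: le_trans (lc b a) _; rewrite L00 mul0r.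
  by rewrite subee ?value_fin// abse0 mule_ge0 ?lee_fin// integral_ge0.
have Lp : (0 < L)%R by rewrite lt_def LN.
set I := L%:E * _.
have I0 : 0 <= I by rewrite mule_ge0 ?lee_fin ?integral_ge0.
(* [s] runs through [[a, b]] at speed [1 / L], forwards or backwards *)
have K (e r : R) (s : R -> R) : s = (fun t => r + e * (t / L))%R -> (`|e| = 1)%R ->
    (e = 1 /\ r = a \/ e = -1 /\ r = b)%R ->
    value (c (clamp a b (s 0%R))) <= value (c (clamp a b (s (L * (b - a))%R))) + I.
  move=> sE e1 er; have tau0 : (0 <= L * (b - a))%R by rewrite mulr_ge0 ?subr_ge0.
  have ls : lipschitz_curve 1 (c \o (clamp a b \o s)).
    rewrite -(mulfV LN); apply: lipschitz_curve_comp => // x y.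
    apply: le_trans (clamp_lip _ _ _ _) _; rewrite sE.
    have -> : (r + e * (x / L) - (r + e * (y / L)) = e * (L^-1 * (x - y)))%R by ring.
    by rewrite normrM e1 mul1r normrM ger0_norm// invr_ge0.
  have sN t : N ((c \o (clamp a b \o s)) t) by apply: cN; exact: clamp_itv.
  have sab t : (0 <= t <= L * (b - a))%R -> (a <= s t <= b)%R.
    move=> /andP[t0 t1]; rewrite sE.
    have h0 : (0 <= t / L)%R by rewrite divr_ge0.
    have h1 : (t / L <= b - a)%R by rewrite ler_pdivrMr// mulrC.
    by case: er => -[-> ->]; apply/andP; split; lra.
  apply: le_trans (value_prefix ls sN tau0) _; rewrite /=; apply: leeD2l.
  rewrite -[leLHS]mul1e /I.
  rewrite [X in 1 * X](_ : _ = \int[leb]_(t in `[0%R, (L * (b - a))%R]) gt (c (s t))).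
    have ms : measurable_fun [set: measurableTypeR R] s.
      rewrite sE; apply: continuous_measurable_fun => z.
      apply: cvgD; first exact: cvg_cst.
      by apply: cvgMr; apply: cvgMl; exact: cvg_id.
    apply: (@ge0_le_integral_substitution _ s _ _ 1 L (gt \o c)) => //.
    - exact: measurable_funTS.
    - exact: (mcomp lc).
    - by move=> t _; exact: gt0.
    - move=> x y xy; rewrite mul1e.
      pose J : set (measurableTypeR R) := if (0 < e)%R then
        `](L * (x - r))%R, (L * (y - r))%R]%classic else
        `[(L * (r - y))%R, (L * (r - x))%R[%classic.
      have mJ : measurable J by rewrite /J; case: ifP => _; exact: measurable_itv.
      apply: (@le_trans _ _ (leb J)).
        apply: le_measure; rewrite ?inE//.
        - apply: measurableI => //; rewrite -[X in measurable X]setTI.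
          by apply: ms => //; exact: measurable_itv.
        - move=> t [_]; rewrite /J sE.
          case: er => -[-> _].
            rewrite ltr01 /= !in_itv/= mul1r => /andP[h1 h2].
            have h3 : (x - r < t / L)%R by lra.
            have h4 : (t / L <= y - r)%R by lra.
            rewrite ltr_pdivlMr// in h3; rewrite ler_pdivrMr// in h4.
            by rewrite mulrC h3 mulrC h4.
          rewrite (_ : (0 < -1 :> R)%R = false); last by rewrite oppr_gt0 ltr10.
          rewrite /= !in_itv/= mulN1r => /andP[h1 h2].
          have h3 : (r - y <= t / L)%R by lra.
          have h4 : (t / L < r - x)%R by lra.
          rewrite ler_pdivlMr// in h3; rewrite ltr_pdivrMr// in h4.
          by rewrite mulrC h3 mulrC h4.
      rewrite /J; case: ifP => _; rewrite lebesgue_measure_itv/=;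
        (case: ifPn => _; [rewrite -EFinD lee_fin; lra|by rewrite lee_fin mulr_ge0// subr_ge0]).
  apply: eq_integral => t; rewrite inE/= in_itv/= => /sab/clamp_id.
  by rewrite /= => ->.
have V1 : value (c a) <= value (c b) + I.
  have /= := K 1%R a (fun t => a + 1 * (t / L))%R erefl (normr1 R)
    (or_introl (conj erefl erefl)).
  rewrite mul0r mulr0 addr0 (_ : a + 1 * (L * (b - a) / L) = b)%R; last by field.
  by rewrite !clamp_id ?lexx ?ab.
have V2 : value (c b) <= value (c a) + I.
  have /= := K (-1)%R b (fun t => b + -1 * (t / L))%R erefl (normrN1 R)
    (or_intror (conj erefl erefl)).
  rewrite mul0r mulr0 addr0 (_ : b + -1 * (L * (b - a) / L) = a)%R; last by field.
  by rewrite !clamp_id ?lexx ?ab.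
have [->|IN] := eqVneq I +oo; first exact: leey.
have If : I \is a fin_num by rewrite ge0_fin_numE// lt_neqAle IN leey.
move: V1 V2; rewrite -(fineK If) -(fineK (value_fin (c a))) -(fineK (value_fin (c b))).
by rewrite -!EFinD !lee_fin /= ?lee_fin ler_norml; lra.
Qed.

End value_function.

(** * Limits along an ultrafilter *)

Lemma ultra_finite_union (I : eqType) (S : Type) (U : set_system S) (s : seq I)
    (P : I -> set S) : UltraFilter U ->
  U [set z | exists2 i, i \in s & P i z] -> exists2 i, i \in s & U (P i).
Proof.
move=> UU; elim: s => [|i s ih] H.
  have /filter_ex[z [j]] := H; by rewrite in_nil.
have [Hi|Hi] := in_ultra_setVsetC (P i) UU.
  by exists i; rewrite ?mem_head.
have [|j js Uj] := ih.
  apply: filterS2 H Hi => z [j]; rewrite inE => /predU1P[-> ? []//|js Pj _].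
  by exists j.
by exists j => //; rewrite inE js orbT.
Qed.

Lemma ultra_real_limit (R : realType) (U : set_system nat) (T : nat -> R) (B : R) :
  UltraFilter U -> (forall n, 0 <= T n <= B) ->
  exists2 l, 0 <= l <= B & forall d, 0 < d -> U [set n | `|T n - l| < d].
Proof.
move=> UU TB; pose S := [set r : R | U [set n | r <= T n]].
have S0 : S 0 by apply: filterS (@filterT _ U _) => n _ /=; case/andP: (TB n).
have SB : ubound S B.
  move=> r /filter_ex[n /= rT]; apply: (le_trans rT); by case/andP: (TB n).
have hS : has_sup S by split; [exists 0|exists B].
exists (sup S).
  apply/andP; split; first exact: ub_le_sup (proj2 hS) _ S0.
  by apply: sup_le_ub => //; exists 0.
move=> d d0.
have [r Sr rS] := sup_adherent d0 hS.
have H2 : U [set n | T n < sup S + d].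
  have [H|H] := in_ultra_setVsetC [set n | sup S + d <= T n] UU.
    have := ub_le_sup (proj2 hS) (H : S (sup S + d)); lra.
  by apply: filterS H => n /= /negP; rewrite -ltNge.
apply: filterS2 Sr H2 => n /= h1 h2; rewrite ltr_norml; apply/andP; split; lra.
Qed.

(** An ultrafilter selects one member of each finite cover: balls of arbitrarily small radius make
    the image filter Cauchy, and one complete set contains it. *)
Lemma ultra_metric_limit (R : realType) (X : pointedMetricType R) (U : set_system nat)
    (z : nat -> X) (A : X -> set X) (s : seq X) :
  UltraFilter U -> (forall q, q \in s -> complete_set (A q)) ->
  U [set n | exists2 q, q \in s & A q (z n)] ->
  (forall m, exists s' : seq X,
     U [set n | exists2 q, q \in s' & mdist q (z n) <= 2 / m.+1%:R]) ->
  exists y, forall d, 0 < d -> U [set n | mdist y (z n) < d].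
Proof.
move=> UU cA /ultra_finite_union[q qs UAq] H.
pose F : set_system X := z @ U.
have FP : ProperFilter F by exact: fmap_proper_filter.
have cF : cauchy F.
  apply: cauchy_exP => e e0.
  pose m := Num.truncn (2 / e).
  have [s' /ultra_finite_union[q' _ Uq']] := H m.
  have m_e : 2 / m.+1%:R < e :> R.
    by rewrite ltr_pdivrMr// mulrC -ltr_pdivrMr//; exact: truncnS_gt.
  have : U [set n | ball q' e (z n)].
    apply: filterS Uq' => n /= h; rewrite ballEmdist/=; exact: le_lt_trans h m_e.
  by exists q'.
have [y _ Fy] := cA q qs F FP UAq cF.
exists y => d d0; have := Fy (ball y d) (nbhsx_ballx y _ d0).
by rewrite ballEmdist.
Qed.

Section limit_curve.
Context {R : realType} {X : pointedMetricType R}.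
Variables (N : set X) (phi gt : X -> \bar R).
Hypothesis phi0 : forall x, (0 <= phi x)%E.
Hypothesis gt0 : forall x, (0 <= gt x)%E.
Hypothesis lphi : lower_semicontinuous phi.
Hypothesis lgt : lower_semicontinuous gt.
Hypothesis cN : closed N.
Variable kappa : R.
Hypothesis kappa0 : 0 < kappa.
Hypothesis kappa_gt : forall x, N x -> (kappa%:E <= gt x)%E.
(* [gt] is large off a finite union of small balls, so that a curve of bounded
   cost stays close to that union *)
Hypothesis gt_tight : forall m : nat, exists s : seq X, forall x, N x ->
  (forall q, q \in s -> m.+1%:R^-1 < mdist q x) -> ((2 * m.+1%:R)%:E <= gt x)%E.
Variables (A : X -> set X) (sA : seq X).
Hypothesis cA : forall q, q \in sA -> complete_set (A q).
Hypothesis NA : forall x, N x -> exists2 q, q \in sA & A q x.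
Local Notation leb := (@lebesgue_measure R).

Let mgt : measurable_fun [set: borelType X] (gt : borelType X -> \bar R).
Proof. exact: lower_semicontinuous_borel. Qed.

Let mcomp L (c : R -> X) (g : X -> \bar R) D : lower_semicontinuous g ->
  lipschitz_curve L c -> measurable_fun (D : set (measurableTypeR R)) (g \o c).
Proof.
by move=> lg lc; exact: measurable_comp_curve lc (lower_semicontinuous_borel lg).
Qed.

Let mreg L (c : R -> X) (g : X -> \bar R) k D : (forall x, (0 <= g x)%E) ->
  lipschitz_curve L c ->
  measurable_fun (D : set (measurableTypeR R)) (fun t => (lip_reg g k (c t))%:E).
Proof.
move=> g0 lc; apply: (@mcomp L c (fun x => (lip_reg g k x)%:E)) => // x a.
rewrite lte_fin => ax.
exists [set y | k.+1%:R * mdist x y < lip_reg g k x - a].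
  apply/nbhs_ballP; exists ((lip_reg g k x - a) / k.+1%:R) => /=.
    by rewrite divr_gt0// subr_gt0.
  by move=> y; rewrite ballEmdist/= ltr_pdivlMr// mulrC.
move=> y /=; rewrite lte_fin => h.
have := lip_reg_lip g0 k x y; rewrite ler_norml => /andP[_].
have : k%:R * mdist x y <= k.+1%:R * mdist x y.
  by rewrite ler_wpM2r ?mdist_ge0// ler_nat.
lra.
Qed.

Lemma integral_lower_bound (c : R -> X) (T a b r : R) : lipschitz_curve 1 c ->
  0 <= a -> a <= b -> b <= T -> 0 <= r ->
  (forall t, a <= t <= b -> (r%:E <= gt (c t))%E) ->
  ((r * (b - a))%:E <= \int[leb]_(t in `[0%R, T]) gt (c t))%E.
Proof.
move=> lc a0 ab bT r0 H.
apply: (@le_trans _ _ (\int[leb]_(t in `[a, b]) gt (c t))%E); last first.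
  apply: ge0_subset_integral => //; first exact: (mcomp lgt lc).
  move=> t /=; rewrite !in_itv/= => /andP[h1 h2].
  by rewrite (le_trans a0 h1) (le_trans h2 bT).
apply: (@le_trans _ _ (\int[leb]_(t in `[a, b]) r%:E)%E).
  rewrite integral_cst//= lebesgue_measure_itv/=.
  case: ifPn => [_|]; first by rewrite -EFinD -EFinM.
  rewrite lte_fin -leNgt => ba; have -> : a = b by apply/eqP; rewrite eq_le ab.
  by rewrite subrr mulr0 mule0.
apply: ge0_le_integral => //.
exact: (mcomp lgt lc).
Qed.

Variables (x : X) (xn : nat -> X) (c : nat -> R -> X) (T : nat -> R) (a : R).
Hypothesis a1 : a < 1.
Hypothesis xn_x : forall n, mdist x (xn n) < n.+1%:R^-1.
Hypothesis c_in : forall n, curve_in N (xn n) (c n) (T n).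
Hypothesis c_cost : forall n, (curve_cost phi gt (c n) (T n) < a%:E)%E.

Let int_lt n : (\int[leb]_(t in `[0%R, T n]) gt (c n t) < a%:E)%E.
Proof. by apply: le_lt_trans (c_cost n); rewrite /curve_cost leeDr. Qed.

Let T0 n : 0 <= T n. Proof. by case: (c_in n). Qed.
Let lc n : lipschitz_curve 1 (c n). Proof. by case: (c_in n). Qed.
Let cNn n t : N (c n t). Proof. by case: (c_in n). Qed.
Let c0 n : c n 0 = xn n. Proof. by case: (c_in n). Qed.

(** A curve of cost below 1 on which [gt] is at least [kappa] cannot last longer than [kappa^-1]. *)
Let TB n : 0 <= T n <= kappa^-1.
Proof.
rewrite T0/=.
have := @integral_lower_bound (c n) (T n) 0 (T n) kappa (lc n) (lexx 0) (T0 n) (lexx _)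
  (ltW kappa0) (fun t _ => kappa_gt (cNn n t)).
move=> /le_lt_trans/(_ (int_lt n)); rewrite lte_fin subr0 => h.
rewrite -[leRHS]mulr1 ler_pdivlMl//; exact: ltW (lt_trans h a1).
Qed.

Let cc n t : X := c n (clamp 0 (T n) t).

Let lcc n : lipschitz_curve 1 (cc n).
Proof. exact: lipschitz_curve_clamp. Qed.

(** Put [w = 1 / (m + 1)]. At a time when the curve is farther than [2 w] from the centres, it stays
    farther than [w] during [w / 2] before and after. If [T n >= w], one of these two intervals lies
    in the domain and costs at least [2 (m + 1) w / 2 = 1], too much. If [T n < w], the curve stays
    within [2 w] of [x], which is why [x] joins the centres and [n >= m] is asked. *)
Let cover m : exists s : seq X, forall n t, (m <= n)%N ->
  exists2 q, q \in s & mdist q (cc n t) <= 2 / m.+1%:R.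
Proof.
have [s Hs] := gt_tight m; exists (x :: s) => n t mn.
have m0 : 0 < m.+1%:R^-1 :> R by rewrite invr_gt0.
have h4 : n.+1%:R^-1 <= m.+1%:R^-1 :> R by rewrite lef_pV2 ?posrE// ler_nat.
have wE : 2 * m.+1%:R * (m.+1%:R^-1 / 2) = 1 :> R by field.
set w : R := m.+1%:R^-1 in Hs m0 h4 wE *.
have /andP[u0 u1] := clamp_itv t (T0 n); set u := clamp _ _ _ in u0 u1.
have -> : cc n t = c n u by [].
apply: contrapT => H.
have far q : q \in x :: s -> 2 * w < mdist q (c n u).
  by move=> qs; rewrite ltNge; apply/negP => h; apply: H; exists q.
have [hT|hT] := leP w (T n); last first.
  have := far x (mem_head _ _); apply/negP; rewrite -leNgt.
  have h1 := metric_triangle x (c n 0) (c n u).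
  have h2 := lc n 0 u; rewrite mul1r sub0r normrN ger0_norm// in h2.
  have h3 := lt_le_trans (xn_x n) h4; rewrite -c0 in h3.
  lra.
have big v : `|v - u| <= w / 2 -> ((2 * m.+1%:R)%:E <= gt (c n v))%E.
  move=> hv; apply: Hs => // q qs.
  have := far q; rewrite inE qs orbT => /(_ isT).
  have := metric_triangle q (c n v) (c n u); have := lc n v u; rewrite mul1r; lra.
have K al be : 0 <= al -> al <= be -> be <= T n -> be - al = w / 2 ->
    (forall v, al <= v <= be -> `|v - u| <= w / 2) -> False.
  move=> h1 h2 h3 k4 h5.
  have := @integral_lower_bound (c n) (T n) al be (2 * m.+1%:R) (lc n) h1 h2 h3.
  rewrite mulr_ge0// => /(_ isT) H'.
  have := H' (fun v hv => big v (h5 v hv)).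
  move=> /le_lt_trans/(_ (int_lt n)); rewrite lte_fin k4.
  rewrite wE.
  by rewrite ltNge (ltW a1).
have [hu|hu] := leP (T n / 2) u.
  apply: (K (u - w / 2) u); [lra|lra|lra|lra|].
  by move=> v /andP[? ?]; rewrite ler_norml; apply/andP; split; lra.
apply: (K u (u + w / 2)); [lra|lra|lra|lra|].
by move=> v /andP[? ?]; rewrite ler_norml; apply/andP; split; lra.
Qed.

(** The ultrafilter gives the limit at all times at once, so no subsequence is extracted.
    Semicontinuity of the cost is reduced to Lipschitz minorants of [phi] and [gt], followed by
    monotone convergence. *)
Lemma limit_curve : exists c' T', curve_in N x c' T' /\
  (curve_cost phi gt c' T' <= a%:E)%E.
Proof.
have [U [UU UE]] := @ultraFilterLemma nat \oo _.
have Uge m : U [set n | (m <= n)%N] by apply: UE; exists m.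
have [l l01 Tl] := ultra_real_limit UU TB.
have /choice[c' c'P] : forall t, exists y, forall d, 0 < d -> U [set n | mdist y (cc n t) < d].
  move=> t; apply: (ultra_metric_limit UU cA).
    by apply: filterS (@filterT _ U _) => n _ /=; apply: NA; exact: cNn.
  move=> m; have [s Hs] := cover m; exists s.
  by apply: filterS (Uge m) => n /= mn; exact: Hs.
have lc' : lipschitz_curve 1 c'.
  move=> s t; apply/ler_addgt0Pr => e e0; rewrite mul1r.
  have e20 : 0 < e / 2 by rewrite divr_gt0.
  have [n [/= h1 h2]] := filter_ex (filterI (c'P s _ e20) (c'P t _ e20)).
  have h3 := lcc n s t; rewrite mul1r in h3.
  have := metric_triangle (c' s) (cc n s) (c' t).
  have := metric_triangle (cc n s) (cc n t) (c' t).
  rewrite (metric_sym (cc n t)); lra.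
have c'N t : N (c' t).
  apply: cN => B /nbhs_ballP[d /= d0 dB].
  have [n /= h] := filter_ex (c'P t d d0).
  by exists (cc n t); split; [exact: cNn|apply: dB; rewrite ballEmdist].
have c'0 : c' 0 = x.
  apply: mdist_positivity; apply/eqP; rewrite eq_le mdist_ge0 andbT.
  apply/ler_addgt0Pr => e e0; rewrite add0r.
  have e20 : 0 < e / 2 by rewrite divr_gt0.
  have [n [/= h1 h2]] := filter_ex (filterI (c'P 0 _ e20) (Uge (Num.truncn (e / 2)^-1))).
  have h3 := xn_x n.
  have h4 : n.+1%:R^-1 < e / 2.
    rewrite invf_plt ?posrE//; apply: (lt_le_trans (truncnS_gt _)).
    by rewrite ler_nat.
  have cc0 : cc n 0 = xn n by rewrite /cc clamp_id ?lexx ?T0//.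
  rewrite cc0 in h1; have := metric_triangle (c' 0) (xn n) x.
  rewrite (metric_sym (xn n)); have := lt_trans h3 h4; lra.
have /andP[l0 l1] := l01.
exists c', l; split => //.
(* Convergence at the points of a grid of mesh [d] suffices, all curves being 1-Lipschitz. *)
have unif d : 0 < d -> U [set n | forall t, 0 <= t <= l -> mdist (c' t) (cc n t) < 3 * d].
  move=> d0; pose M := Num.truncn (l / d).
  have H : U [set n | forall i : 'I_M.+1, mdist (c' (i%:R * d)) (cc n (i%:R * d)) < d].
    by apply: filter_forall => i; exact: c'P.
  apply: filterS H => n /= H t /andP[t0 tl].
  pose i := Num.truncn (t / d).
  have iM : (i < M.+1)%N.
    by rewrite ltnS; apply: le_truncn; rewrite ler_pM2r ?invr_gt0.
  have := H (Ordinal iM) => /= h.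
  have td0 : 0 <= t / d by rewrite divr_ge0// ltW.
  have i1 : i%:R * d <= t by rewrite -ler_pdivlMr// truncn_le.
  have i2 : t < i.+1%:R * d by rewrite -ltr_pdivrMr// truncnS_gt.
  rewrite -natr1 mulrDl mul1r in i2.
  have e1 : `|t - i%:R * d| <= d by rewrite ger0_norm ?subr_ge0//; lra.
  have h1 := lc' t (i%:R * d); have h2 := lcc n (i%:R * d) t.
  rewrite mul1r in h1; rewrite mul1r distrC in h2.
  have := metric_triangle (c' t) (c' (i%:R * d)) (cc n t).
  have := metric_triangle (c' (i%:R * d)) (cc n (i%:R * d)) (cc n t).
  lra.
have reg_cost k : ((lip_reg phi k (c' l))%:E +
    \int[leb]_(t in `[0%R, l]) (lip_reg gt k (c' t))%:E <= a%:E)%E.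
  have K0 : 0 <= k%:R :> R by [].
  apply/lee_addgt0Pr => e e0.
  (* Errors: [4 k d] at the end point ([3 d] for the curve, [d] for the duration), [k d] where [l]
     exceeds [T n], and [3 k d l] in the integral. The summand 1 keeps the denominator positive. *)
  pose d := e / (k%:R * (5 + 3 * l) + 1).
  have D0 : 0 < k%:R * (5 + 3 * l) + 1 by rewrite ltr_wpDl// mulr_ge0// addr_ge0// mulr_ge0.
  have d0 : 0 < d by rewrite divr_gt0.
  have de : k%:R * d * (5 + 3 * l) <= e.
    rewrite /d (_ : _ * _ * _ = e * (k%:R * (5 + 3 * l) / (k%:R * (5 + 3 * l) + 1))).
      by apply: ler_piMr; [exact: ltW|rewrite ler_pdivrMr// mul1r lerDl].
    by field; rewrite gt_eqF.
  have [n [/= hu hT]] := filter_ex (filterI (unif d d0) (Tl d d0)).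
  have hl : mdist (c' l) (cc n l) < 3 * d by apply: hu; rewrite l0 lexx.
  have hc := lcc n l (T n); rewrite mul1r distrC in hc.
  have ccT : cc n (T n) = c n (T n) by rewrite /cc clamp_id// T0 lexx.
  have h1 : lip_reg phi k (c' l) <= lip_reg phi k (c n (T n)) + k%:R * (4 * d).
    have := lip_reg_lip phi0 k (c' l) (c n (T n)); rewrite ler_norml => /andP[_].
    have : k%:R * mdist (c' l) (c n (T n)) <= k%:R * (4 * d).
      apply: ler_wpM2l => //; rewrite -ccT.
      have := metric_triangle (c' l) (cc n l) (cc n (T n)); lra.
    lra.
  have kd0 : 0 <= k%:R * (3 * d) by rewrite mulr_ge0// mulr_ge0// ltW.
  have r0 (y : X) : (0 <= (lip_reg gt k y)%:E)%E by rewrite lee_fin lip_reg_ge0.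
  have mcc D := @mreg 1 (cc n) gt k D gt0 (lcc n).
  have I1 : (\int[leb]_(t in `[0%R, l]) (lip_reg gt k (c' t))%:E <=
      \int[leb]_(t in `[0%R, l]) (lip_reg gt k (cc n t))%:E + (k%:R * (3 * d) * l)%:E)%E.
    apply: (@le_trans _ _ (\int[leb]_(t in `[0%R, l])
        ((lip_reg gt k (cc n t))%:E + (k%:R * (3 * d))%:E))%E).
      apply: ge0_le_integral => //.
      - exact: (@mreg 1 c' gt k _ gt0 lc').
      - by apply: emeasurable_funD => //; exact: mcc.
      - move=> t; rewrite /= in_itv/= => tl; rewrite -EFinD lee_fin.
        have := lip_reg_lip gt0 k (c' t) (cc n t); rewrite ler_norml => /andP[_].
        have : k%:R * mdist (c' t) (cc n t) <= k%:R * (3 * d).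
          by apply: ler_wpM2l => //; apply: ltW; exact: hu.
        lra.
    rewrite ge0_integralD//.
    apply: leeD2l; rewrite integral_cst//= lebesgue_measure_itv/=.
    case: ifPn => _; last by rewrite mule0 lee_fin mulr_ge0.
    by rewrite oppr0 adde0 -EFinM.
  have I2 : (\int[leb]_(t in `[0%R, l]) (lip_reg gt k (cc n t))%:E <=
      \int[leb]_(t in `[0%R, T n]) gt (c n t) + (k%:R * d)%:E)%E.
    pose J1 : set (measurableTypeR R) := `[0%R, T n]%classic.
    pose J2 : set (measurableTypeR R) := `]T n, T n + d]%classic.
    have mJ1 : measurable J1 by exact: measurable_itv.
    have mJ2 : measurable J2 by exact: measurable_itv.
    apply: (@le_trans _ _ (\int[leb]_(t in J1 `|` J2) (lip_reg gt k (cc n t))%:E)%E).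
      apply: ge0_subset_integral => //.
      - exact: measurableU.
      - move=> t; rewrite /J1 /J2 /= !in_itv/= => /andP[t0 tl]; rewrite t0/=.
        have [|tT] := leP t (T n); first by left.
        right; move: hT; rewrite ltr_norml => /andP[]; lra.
    rewrite ge0_integral_setU//; last first.
      apply/disj_set2P; apply/seteqP; split => // t []; rewrite /J1 /J2 /= !in_itv/=.
      by move=> /andP[_ k1] /andP[k2 _]; move: k1; rewrite leNgt k2.
    apply: leeD.
      apply: (@le_trans _ _ (\int[leb]_(t in J1) gt (cc n t))%E).
        apply: ge0_le_integral => //.
          exact: (mcomp lgt (lcc n)).
        by move=> t _; exact: lip_reg_le.
      rewrite le_eqVlt; apply/orP; left; apply/eqP/eq_integral => t.
      by rewrite inE /J1/= in_itv/= => tT; rewrite /cc clamp_id.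
    apply: (@le_trans _ _ (\int[leb]_(t in J2) k%:R%:E)%E).
      apply: ge0_le_integral => //.
      by move=> t _; rewrite lee_fin lip_reg_le_nat.
    rewrite integral_cst//= /J2 lebesgue_measure_itv/=.
    case: ifPn => _; last by rewrite mule0 lee_fin mulr_ge0// ltW.
    by rewrite -EFinD -EFinM lee_fin; lra.
  have cost := c_cost n; rewrite /curve_cost in cost.
  apply: (@le_trans _ _ ((phi (c n (T n)) + \int[leb]_(t in `[0%R, T n]) gt (c n t)) + e%:E)%E); last first.
    by apply: leeD2r; exact: ltW.
  apply: (@le_trans _ _ ((phi (c n (T n)) + (k%:R * (4 * d))%:E) +
     (\int[leb]_(t in `[0%R, T n]) gt (c n t) + (k%:R * d)%:E + (k%:R * (3 * d) * l)%:E))%E).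
    apply: leeD.
      apply: (@le_trans _ _ ((lip_reg phi k (c n (T n)))%:E + (k%:R * (4 * d))%:E)%E).
        by rewrite -EFinD lee_fin.
      by apply: leeD2r; exact: lip_reg_le.
    by apply: (le_trans I1); apply: leeD2r.
  rewrite -[X in (_ + X)%E]addeA addeACA -!EFinD; apply: leeD2l.
  rewrite lee_fin; lra.
have mgc : measurable_fun `[0%R, l] (gt \o c') by exact: (mcomp lgt lc').
have cv1 := @lip_reg_cvg _ _ phi phi0 (c' l) lphi.
have cv2 : (\int[leb]_(t in `[0%R, l]) (lip_reg gt k (c' t))%:E @[k --> \oo] -->
    \int[leb]_(t in `[0%R, l]) gt (c' t))%E.
  have -> : (\int[leb]_(t in `[0%R, l]) gt (c' t) =
      \int[leb]_(t in `[0%R, l]) limn (fun k => (lip_reg gt k (c' t))%:E))%E.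
    by apply: eq_integral => t _; apply/esym/cvg_lim => //; exact: lip_reg_cvg.
  apply: (@cvg_monotone_convergence _ _ _ leb _ _ (fun k t => (lip_reg gt k (c' t))%:E)) => //.
  - by move=> k; exact: (@mreg 1 c' gt k _ gt0 lc').
  - by move=> k t _; rewrite lee_fin lip_reg_ge0.
  - by move=> t _ m n mn; rewrite lee_fin; exact: lip_reg_nd.
have df : (phi (c' l) +? \int[leb]_(t in `[0%R, l]) gt (c' t))%E.
  by apply: ge0_adde_def; rewrite inE//; exact: integral_ge0.
apply: (cvge_to_le (cvgeD df cv1 cv2)).
by apply: nearW => k; exact: reg_cost.
Qed.

End limit_curve.

Section value_lsc.
Context {R : realType} {X : pointedMetricType R}.
Variables (N : set X) (phi gt : X -> \bar R).
Hypothesis phi0 : forall x, (0 <= phi x)%E.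
Hypothesis gt0 : forall x, (0 <= gt x)%E.
Local Open Scope ereal_scope.

(** If it failed at [x], points tending to [x] would carry curves of cost below some [b < value x],
    and their limit curve would start at [x] with cost at most [b]. *)
Lemma value_lower_semicontinuous (kappa : R) (A : X -> set X) (sA : seq X) :
  lower_semicontinuous phi -> lower_semicontinuous gt -> closed N -> (0 < kappa)%R ->
  (forall x, N x -> kappa%:E <= gt x) ->
  (forall m : nat, exists s : seq X, forall x, N x ->
    (forall q, q \in s -> m.+1%:R^-1 < mdist q x)%R -> (2 * m.+1%:R)%:E <= gt x) ->
  (forall q, q \in sA -> complete_set (A q)) ->
  (forall x, N x -> exists2 q, q \in sA & A q x) ->
  lower_semicontinuous (value N phi gt).
Proof.
move=> lphi lgt cN k0 kgt tight cA NA x a ax.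
(* In particular [b < 1]: only below the cap is a small value witnessed by a curve. *)
pose b := ((a + fine (value N phi gt x)) / 2)%R.
have vf := value_fin N phi0 gt0 x.
have vE := fineK vf.
have [ab bv] : (a < b /\ b < fine (value N phi gt x))%R.
  by move: ax; rewrite -vE lte_fin /b; split; lra.
have b1 : (b < 1)%R.
  by apply: (lt_le_trans bv); rewrite -lee_fin vE value_le1.
apply: contrapT => H.
have /choice[xn xnP] : forall n : nat, exists y, (mdist x y < n.+1%:R^-1)%R /\ value N phi gt y < b%:E.
  move=> n; apply: contrapT => /forallNP Hn; apply: H.
  exists (ball x n.+1%:R^-1); first by apply: nbhsx_ballx; rewrite invr_gt0.
  move=> y; rewrite ballEmdist/= => xy; apply: (@lt_le_trans _ _ b%:E); first by rewrite lte_fin.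
  by rewrite leNgt; apply/negP => yb; apply: (Hn y).
have /choice[cT cTP] : forall n, exists cT : (R -> X) * R,
    curve_in N (xn n) cT.1 cT.2 /\ curve_cost phi gt cT.1 cT.2 < b%:E.
  move=> n; have [_ /(value_lt (ltW b1))[c [T [H1 H2]]]] := xnP n.
  by exists (c, T).
have [c' [T' [H1 H2]]] := @limit_curve R X N phi gt phi0 gt0 lphi lgt cN kappa k0 kgt
  tight A sA cA NA x xn (fun n => (cT n).1) (fun n => (cT n).2) b b1
  (fun n => (xnP n).1) (fun n => (cTP n).1) (fun n => (cTP n).2).
have := le_trans (value_le_cost phi gt H1) H2.
by rewrite -vE lee_fin leNgt bv.
Qed.

End value_lsc.

(** * Gluing two functions along an interval *)

Section glue.
Context {R : realType}.
Local Notation leb := (@lebesgue_measure R).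
Local Open Scope ereal_scope.

Let int_split (G : R -> \bar R) (s : R) : measurable_fun [set: measurableTypeR R] G ->
  (forall t, 0 <= G t) -> (0 <= s <= 1)%R ->
  \int[leb]_(t in `[0%R, 1%R]) G t =
  \int[leb]_(t in `[0%R, s]) G t + \int[leb]_(t in `[s, 1%R]) G t.
Proof.
move=> mG G0 /andP[s0 s1].
have itvE : `[0%R, 1%R]%classic = `[0%R, s] `|` `]s, 1%R]%classic.
  apply/seteqP; split => t /=; rewrite !in_itv/=.
    by move=> /andP[t0 t1]; have [ts|st] := leP t s; [left|right]; rewrite ?t0.
  move=> [/andP[-> ts]|/andP[st ->]]/=; first exact: le_trans s1.
  by rewrite (le_trans s0)// ltW.
rewrite itvE ge0_integral_setU//.
- by rewrite integral_itv_obnd_cbnd//; exact: measurable_funTS.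
- exact: measurable_funTS.
- apply/disj_set2P; apply/seteqP; split => // t [] /=; rewrite !in_itv/=.
  by move=> /andP[_ h1] /andP[h2 _]; move: h1; rewrite leNgt h2.
Qed.

(* A one-dimensional gluing principle: where [fz > fu], the variation of [fz] is
   controlled with an extra slope [K] that [G] accounts for; at the first
   time where [fz <= fu] one switches to [fu]. *)
Lemma max_variation_le (fu fz : R -> R) (G G1 : R -> \bar R) (P : set R) (K eta : R) :
  measurable_fun [set: measurableTypeR R] G ->
  measurable_fun [set: measurableTypeR R] G1 ->
  (forall t, 0 <= G t) -> (forall t, 0 <= G1 t) -> (0 <= K)%R -> (0 < eta)%R ->
  (forall a b, (0 <= a)%R -> (a <= b)%R -> (b <= 1)%R ->
     (fu a - fu b)%:E <= \int[leb]_(t in `[a, b]) G t) ->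
  (forall a b, (0 <= a)%R -> (a <= b)%R -> (b <= 1)%R ->
     (forall t, (a <= t <= b)%R -> P t) ->
     (fz a - fz b)%:E <= \int[leb]_(t in `[a, b]) G1 t + (K * (b - a))%:E) ->
  (forall t, (0 <= t <= 1)%R -> (fu t < fz t)%R -> G1 t + K%:E <= G t) ->
  (forall t, P t -> G1 t <= G t) ->
  (forall t t', 0 <= t <= 1 -> 0 <= t' <= 1 -> fu t < fz t -> `|t - t'| <= eta -> P t')%R ->
  (Num.max (fu 0%R) (fz 0%R) - Num.max (fu 1%R) (fz 1%R))%:E <=
  \int[leb]_(t in `[0%R, 1%R]) G t.
Proof.
move=> mG mG1 G0 G10 K0 eta0 Hu Hz H1 H2 H3.
have [h0|h0] := leP (fz 0%R) (fu 0%R).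
  apply: le_trans (Hu 0%R 1%R (lexx _) ler01 (lexx _)).
  by rewrite lee_fin lerD2l lerN2 le_max lexx.
apply/lee_addgt0Pr => e e0.
pose S : set R := [set t | (0 <= t <= 1 /\ (fz t <= fu t \/ t = 1))%R].
have S1 : S 1%R by split; [rewrite ler01 lexx|right].
have Slb : lbound S 0%R by move=> t [/andP[]].
(* Continuity of [fu] and [fz] is not assumed, so [tau] may fail to lie in [S]; a point [s] of [S]
   slightly to its right takes its place. *)
pose tau := inf S.
have tau0 : (0 <= tau)%R by apply: lb_le_inf => //; exists 1%R.
have tau1 : (tau <= 1)%R by apply: ge_inf => //; exists 0%R.
have ltau t : (0 <= t)%R -> (t < tau)%R -> (fu t < fz t)%R.
  move=> t0 tt; rewrite ltNge; apply/negP => h.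
  have : (tau <= t)%R.
    apply: ge_inf; first by exists 0%R.
    by split; [rewrite t0 (le_trans (ltW tt))|left].
  by rewrite leNgt tt.
(* The first bound keeps [[tau, s]] within reach of the last hypothesis, the second makes the slope
   [K] cost at most [e] there. *)
pose eta' := Num.min (eta / 2)%R (e / (K + 1))%R.
have K1 : (0 < K + 1)%R by lra.
have eta'0 : (0 < eta')%R by rewrite lt_min !divr_gt0.
have [s [/andP[s0 s1] Ss] stau] : exists2 s, S s & (s < tau + eta')%R.
  by apply: inf_lt; [exists 1%R|rewrite ltrDl].
have taus : (tau <= s)%R.
  by apply: ge_inf; [exists 0%R|split; rewrite ?s0].
have se1 : (s - tau <= eta / 2)%R.
  have : (eta' <= eta / 2)%R by rewrite ge_min lexx.
  lra.
have se2 : (K * (s - tau) <= e)%R.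
  have h : (eta' <= e / (K + 1))%R by rewrite ge_min lexx orbT.
  have h' : (s - tau <= e / (K + 1))%R by lra.
  apply: (@le_trans _ _ (K * (e / (K + 1)))%R); first exact: ler_wpM2l.
  rewrite mulrCA; apply: ler_piMr; first exact: ltW.
  by rewrite ler_pdivrMr// mul1r lerDl.
have Ps t : (0 <= t <= s)%R -> P t.
  move=> /andP[t0 ts]; have t1 := le_trans ts s1.
  have [tt|tt] := ltP t tau.
    apply: (H3 t t); rewrite ?t0 ?t1 ?ltau// subrr normr0; exact: ltW.
  (* A time at which [fu < fz], before [tau] or equal to 0, and within [eta] of every point of
     [[tau, s]]. *)
  pose t0' := Num.max 0%R (tau - eta / 2)%R.
  have a0 : (0 <= t0')%R by rewrite le_max lexx.
  have a1 : (t0' <= tau)%R by rewrite ge_max tau0 lerBlDr lerDl divr_ge0// ltW.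
  have a2 : (tau - eta / 2 <= t0')%R by rewrite le_max lexx orbT.
  apply: (H3 t0' t); rewrite ?t0 ?t1 ?a0 ?(le_trans a1)//.
    have [->//|tpos] := eqVneq t0' 0%R.
    apply: ltau => //; rewrite /t0'; rewrite gt_max; apply/andP; split; last first.
      by rewrite ltrBlDr ltrDl divr_gt0.
    by apply: lt_le_trans a1; rewrite lt_def tpos.
  by rewrite ler_norml; apply/andP; split; lra.
(* [G] pays for the slope [K] only before [tau]; the remaining [K (s - tau)] is absorbed by [e]. *)
have G1G t : (0 <= t <= s)%R -> G1 t + (K * \1_(`[0%R, tau[%classic) t)%:E <= G t.
  move=> /[dup] ts /andP[t0 ts']; rewrite indicE; have [tt|tt] := ltP t tau.
    rewrite mem_set/= ?in_itv/= ?t0// mulr1; apply: H1; last exact: ltau.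
    by rewrite t0 (le_trans ts').
  rewrite memNset/= ?mulr0 ?adde0; first exact: H2 (Ps _ ts).
  by rewrite in_itv/= t0/= ltNge tt.
have mJ : measurable (`[0%R, tau[%classic : set (measurableTypeR R)).
  exact: measurable_itv.
have mi : measurable_fun [set: measurableTypeR R] (\1_(`[0%R, tau[%classic) : R -> R).
  exact: measurable_indic.
have IG : \int[leb]_(t in `[0%R, s]) G1 t + (K * tau)%:E <= \int[leb]_(t in `[0%R, s]) G t.
  have mI : measurable_fun `[0%R, s] (fun t : measurableTypeR R => (K * \1_(`[0%R, tau[%classic) t)%:E).
    apply: measurable_funTS; apply/measurable_EFinP.
    by apply: measurable_funM; [exact: measurable_cst|exact: mi].
  have I0 t : 0 <= (K * \1_(`[0%R, tau[%classic) t)%:E by rewrite lee_fin mulr_ge0.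
  apply: (@le_trans _ _ (\int[leb]_(t in `[0%R, s])
      (G1 t + (K * \1_(`[0%R, tau[%classic) t)%:E))); last first.
    apply: ge0_le_integral => //.
    - by move=> t _; rewrite adde_ge0.
    - by apply: emeasurable_funD => //; exact: measurable_funTS.
    - exact: measurable_funTS.
  rewrite ge0_integralD//; last exact: measurable_funTS.
  apply: leeD2l; under eq_integral do rewrite EFinM.
  rewrite ge0_integralZl//; last first.
    by apply: measurable_funTS; apply/measurable_EFinP; exact: mi.
  rewrite integral_indic//.
  rewrite (_ : _ `&` _ = `[0%R, tau[%classic); last first.
    apply/setIidPl => t /=; rewrite !in_itv/= => /andP[-> h]/=.
    by rewrite (le_trans _ taus)// ltW.
  rewrite /= lebesgue_measure_itv/=.
  case: ifPn => [_|]; first by rewrite oppr0 adde0 -EFinM.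
  by rewrite lte_fin -leNgt => h; rewrite mule0 lee_fin mulr_ge0_le0.
have V1 : (fz 0 - fz s)%:E <= \int[leb]_(t in `[0%R, s]) G t + e%:E.
  apply: (le_trans (Hz 0%R s (lexx _) s0 s1 Ps)).
  have -> : (K * (s - 0) = K * tau + K * (s - tau))%R by ring.
  by rewrite EFinD addeA; apply: leeD.
rewrite (int_split mG G0 (s := s)) ?s0// addeAC.
case: Ss => [zu|s1']; last first.
  move: V1; rewrite s1' => V1.
  apply: (@le_trans _ _ (fz 0 - fz 1)%:E).
    by rewrite lee_fin lerD2l lerN2 le_max lexx orbT.
  by apply: (le_trans V1); rewrite leeDl// integral_ge0.
apply: (@le_trans _ _ ((fz 0 - fz s)%:E + (fu s - fu 1)%:E)).
  rewrite -EFinD lee_fin.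
  have : (fu 1 <= Num.max (fu 1) (fz 1))%R by rewrite le_max lexx.
  lra.
by apply: leeD => //; exact: Hu.
Qed.

End glue.

(** * Outer regularity on compact sets *)

Section metric_covers.
Context {R : realType} {X : pointedMetricType R}.

Lemma lipschitz_lower_semicontinuous (f : X -> R) (k : R) :
  (forall x y, `|f x - f y| <= k * mdist x y) -> lower_semicontinuous (EFin \o f).
Proof.
move=> fk x a; rewrite /= lte_fin => ax.
have k0 : 0 < `|k| + 1 by rewrite ltr_wpDl.
exists (ball x ((f x - a) / (`|k| + 1))).
  by apply: nbhsx_ballx; rewrite divr_gt0// subr_gt0.
move=> y; rewrite ballEmdist/= ltr_pdivlMr// lte_fin => xy.
have := ler_wpM2r (mdist_ge0 x y) (ler_norm k); have := mdist_ge0 x y.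
by have := fk x y; rewrite ler_norml => /andP[_]; lra.
Qed.

Lemma lipschitz_closed_le (f : X -> R) (k a : R) :
  (forall x y, `|f x - f y| <= k * mdist x y) -> closed [set x | f x <= a].
Proof.
move=> /lipschitz_lower_semicontinuous/lower_semicontinuousP/(_ a) fa.
rewrite (_ : [set _ | _] = ~` [set x | (a%:E < (f x)%:E)%E]); first exact: open_closedC.
by apply/seteqP; split => x /=; rewrite lte_fin leNgt => /negP.
Qed.

Lemma lipschitz_open_lt (f : X -> R) (k a : R) :
  (forall x y, `|f x - f y| <= k * mdist x y) -> open [set x | f x < a].
Proof.
move=> fk; have /lipschitz_lower_semicontinuous : forall x y,
    `|- f x - - f y| <= k * mdist x y by move=> x y; rewrite -opprB normrN opprK addrC.
move=> /lower_semicontinuousP/(_ (- a)); congr (open _).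
by apply/seteqP; split => x /=; rewrite lte_fin ltrN2.
Qed.

Lemma open_mdist_gt (q : X) (r : R) : open [set x | r < mdist q x].
Proof.
rewrite openE => x /= rx; apply/nbhs_ballP; exists (mdist q x - r) => /=.
  by rewrite subr_gt0.
move=> y; rewrite ballEmdist/= => xy.
have := metric_triangle q y x; rewrite (metric_sym y); lra.
Qed.

Lemma open_mdist_gt_seq (s : seq X) (r : R) :
  open [set x | forall q, q \in s -> r < mdist q x].
Proof.
elim: s => [|q s ih].
  by rewrite (_ : [set x | _] = setT); [exact: openT|apply/seteqP; split].
rewrite (_ : [set x | _] = [set x | r < mdist q x] `&`
   [set x | forall q, q \in s -> r < mdist q x]).
  by apply: openI => //; exact: open_mdist_gt.
apply/seteqP; split => x /=.
  move=> H; split; first by apply: H; rewrite mem_head.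
  by move=> q' q's; apply: H; rewrite inE q's orbT.
by move=> [h1 h2] q'; rewrite inE => /predU1P[->//|/h2].
Qed.

Lemma compact_cover_balls (K : set X) (r : X -> R) : compact K -> (forall q, 0 < r q) ->
  exists s : seq X, forall x, K x -> exists2 q, q \in s & mdist q x < r q.
Proof.
rewrite compact_cover => cK r0.
have [||D _ KD] := cK X K (fun q => (ball q (r q))°).
- by move=> q _; exact: open_interior.
- move=> x Kx; exists x => //; apply: nbhsx_ballx; exact: r0.
exists (finmap.enum_fset D) => x /KD[q /= qD /interior_subset]; rewrite ballEmdist.
by exists q.
Qed.

(** The sets left uncovered by finitely many closed balls around a dense sequence decrease to the
    empty set; this is the part of Ulam's tightness argument that uses separability alone. *)
Lemma separable_tight (nu : {finite_measure set (borelType X) -> \bar R}) (e r : R) :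
  separable_space X -> 0 < e -> 0 < r -> exists s : seq X,
    (nu [set x | forall q, q \in s -> (r < mdist q x)%R] <= e%:E)%E.
Proof.
move=> [D /countable_injP[f fI] dD] e0 r0.
have /choice[en enP] : forall n, exists y, (exists z, D z /\ f z = n) -> D y /\ f y = n.
  move=> n; have [[z Hz]|Hn] := pselect (exists z, D z /\ f z = n); first by exists z.
  by exists point.
have enD z : D z -> en (f z) = z.
  move=> Dz; have [|D1 D2] := enP (f z); first by exists z.
  by apply: fI; rewrite ?inE.
pose O J := [set x : X | forall q, q \in [seq en i | i <- iota 0 J] -> r < mdist q x].
have mO J : measurable (O J : set (borelType X)).
  by apply: open_borel; exact: open_mdist_gt_seq.
have O0 : \bigcap_J O J = set0.
  apply/seteqP; split => // x H.
  have [z [xz Dz]] : (ball x r)° `&` D !=set0.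
    by apply: dD; [exists x; exact: nbhsx_ballx|exact: open_interior].
  have zin : z \in [seq en i | i <- iota 0 (f z).+1].
    by rewrite -[X in X \in _](enD z Dz); apply: map_f; rewrite mem_iota leq0n add0n ltnSn.
  have := H (f z).+1 I z zin; have := interior_subset xz.
  by rewrite ballEmdist/= metric_sym => h1; rewrite ltNge (ltW h1).
have : (nu (O J) @[J --> \oo] --> nu (\bigcap_J O J))%E.
  apply: nonincreasing_cvg_mu => //.
  - by rewrite ltey_eq fin_num_measure.
  - exact: bigcapT_measurable.
  - move=> m n mn; apply/subsetPset => x H q /mapP[i]; rewrite mem_iota add0n => /andP[_ im] ->.
    by apply: H; apply: map_f; rewrite mem_iota add0n (leq_trans im).
rewrite O0 measure0 => /fine_cvgP[_ /cvgrPdist_lt /(_ e e0)[J _ /(_ J (leqnn J))]].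
rewrite /= sub0r normrN ger0_norm ?fine_ge0// => He.
exists [seq en i | i <- iota 0 J].
rewrite -[leLHS]/(nu (O J)) -(fineK (fin_num_measure nu _ (mO J))) lee_fin.
exact: ltW.
Qed.

(** The function is [min(1, (k + 1) dist(x, K))], written as a regularization of the indicator of
    the complement so that it also makes sense for empty [K]. *)
Lemma lip_bump (K : set X) (k : nat) : exists rho : X -> R,
  [/\ forall x y, `|rho x - rho y| <= k.+1%:R * mdist x y, forall x, 0 <= rho x,
      forall x, K x -> rho x = 0 &
      forall x, rho x < 1 -> exists2 y, K y & mdist x y < k.+1%:R^-1].
Proof.
pose f (x : X) : \bar R := (if x \in K then 0 else 1)%:E.
have f0 x : (0 <= f x)%E by rewrite /f; case: ifP; rewrite lee_fin.
exists (lip_reg f k.+1); split.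
- exact: lip_reg_lip.
- exact: lip_reg_ge0.
- move=> x Kx; apply/eqP; rewrite eq_le lip_reg_ge0// andbT -lee_fin.
  by apply: le_trans (lip_reg_le f0 _ _) _; rewrite /f mem_set.
- move=> x /(lip_reg_lt f0)[y]; rewrite /f; case: ifPn => yK.
    rewrite min_l ?lee_fin// add0e lte_fin => h.
    by exists y; [exact: set_mem|rewrite -[ltRHS]mulr1 ltr_pdivlMl].
  rewrite min_l; last by rewrite lee_fin ler1n.
  rewrite -EFinD lte_fin; have : 0 <= k.+1%:R * mdist x y by rewrite mulr_ge0// mdist_ge0.
  lra.
Qed.

End metric_covers.

(** * Localization near a compact set *)

Section localization.
Context {R : realType} {X : pointedMetricType R}.
Variable mu : {measure set (borelType X) -> \bar R}.
Hypothesis Xlc : locally_complete X.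
Hypothesis mu_ball : forall (x : X) (r : R), 0 < r -> (0 < mu (ball x r) < +oo)%E.

Lemma ball_borel (x : X) r : measurable (ball x r : set (borelType X)).
Proof.
apply: open_borel; rewrite ballEmdist openE => y /= xy; apply/nbhs_ballP.
exists (r - mdist x y) => /=; first by rewrite subr_gt0.
by move=> z; rewrite ballEmdist/=; have := metric_triangle x y z; lra.
Qed.

Lemma measure_cover_balls_lty (r : X -> R) (s : seq X) (N : set (borelType X)) :
  (forall q, 0 < r q) -> measurable N ->
  (forall x, N x -> exists2 q, q \in s & mdist q x < r q) -> (mu N < +oo)%E.
Proof.
move=> r0; elim: s N => [|q s ih] N mN H.
  rewrite (_ : N = set0) ?measure0//.
  by apply/seteqP; split => // x /H[q]; rewrite in_nil.
have mB := ball_borel q (r q).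
apply: (@le_lt_trans _ _ (mu (ball q (r q)) + mu (N `\` ball q (r q)))%E).
  apply: (@le_trans _ _ (mu ((ball q (r q) : set (borelType X)) `|` (N `\` ball q (r q))))).
    apply: le_measure; rewrite ?inE//.
      by apply: measurableU => //; exact: measurableD.
    by move=> x Nx; have [|] := pselect (ball q (r q) x); [left|right].
  by apply: measureU2 => //; exact: measurableD.
rewrite lte_add_pinfty//; first by case/andP: (mu_ball q (r0 q)).
apply: ih; first exact: measurableD.
move=> x [/H[q' + q'x] nx]; rewrite inE => /predU1P[qE|q's]; last by exists q'.
by exfalso; apply: nx; rewrite ballEmdist/= -qE.
Qed.

(** [1 / (k + 1)] acts as a Lebesgue number: a point with [rho <= 1/2] is within [r q / 2] of some
    point of [K] that is itself within [r q / 2] of the centre [q]. *)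
Lemma compact_localization (K : set X) : compact K ->
  exists (k : nat) (rho : X -> R) (A : X -> set X) (s : seq X),
    [/\ [/\ forall x y, `|rho x - rho y| <= k.+1%:R * mdist x y, forall x, 0 <= rho x &
            forall x, K x -> rho x = 0],
        (forall q, q \in s -> complete_set (A q)),
        (forall x, rho x <= 2^-1 -> exists2 q, q \in s & A q x) &
        (mu [set x | (rho x <= 2^-1)%R] < +oo)%E].
Proof.
move=> cK.
have /choice[A AP] : forall x : X, exists A : set X, nbhs x A /\ complete_set A.
  by move=> x; have [A] := Xlc x; exists A.
have /choice[r rP] : forall x : X, exists r : R, 0 < r /\ ball x r `<=` A x.
  by move=> x; have /nbhs_ballP[r /= r0 rA] := (AP x).1; exists r.
have r0 q : 0 < r q by exact: (rP q).1.
have r20 q : 0 < r q / 2 by rewrite divr_gt0.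
have [s sP] := compact_cover_balls cK r20.
have [k kP] : exists k : nat, forall q, q \in s -> k.+1%:R^-1 <= r q / 2.
  elim: (s) => [|q s' [k ih]]; first by exists 0%N => q; rewrite in_nil.
  exists (maxn k (Num.truncn (r q / 2)^-1)) => q'; rewrite inE => /predU1P[->|/ih h].
    apply: ltW; rewrite invf_plt ?posrE//; apply: (lt_le_trans (truncnS_gt _)).
    by rewrite ler_nat ltnS leq_maxr.
  by apply: le_trans h; rewrite lef_pV2 ?posrE// ler_nat ltnS leq_maxl.
have [rho [rlip rge0 rK r1]] := lip_bump K k.
exists k, rho, A, s.
have NB x : rho x <= 2^-1 -> exists2 q, q \in s & mdist q x < r q.
  move=> hx; have [|y Ky xy] := r1 x; first by apply: le_lt_trans hx _; lra.
  have [q qs qy] := sP y Ky; exists q => //.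
  have := metric_triangle q y x; have := kP q qs; rewrite (metric_sym y x).
  have := lt_le_trans xy (kP q qs); lra.
split => //.
- by move=> q _; exact: (AP q).2.
- by move=> x /NB[q qs qx]; exists q => //; apply: (rP q).2; rewrite ballEmdist.
- apply: (measure_cover_balls_lty r0) NB; apply: closed_borel.
  exact: lipschitz_closed_le rlip.
Qed.

End localization.

Section tight_majorant.
Context {R : realType} {X : pointedMetricType R}.
Variables (nu : {finite_measure set (borelType X) -> \bar R}) (p : R).
Hypothesis p0 : 0 < p.
Hypothesis Xsep : separable_space X.
Local Open Scope ereal_scope.

Let pN0 : p != 0%R. Proof. by rewrite gt_eqF. Qed.

(** The [p]-th power of [gt] is a sum of three terms: a lower semicontinuous majorant of that of
    [g], the constant [kappa ^ p], and large weights on the open sets [O m] far from finitely many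
    centres. Each adds at most [e] to the integral. *)
Lemma tight_lsc_majorant (g : borelType X -> \bar R) (e : R) :
  measurable_fun setT g -> (forall x, 0 <= g x) -> (0 < e)%R ->
  exists gt : X -> \bar R,
    [/\ lower_semicontinuous gt, forall x, g x <= gt x,
        exists2 kappa, (0 < kappa)%R & forall x, kappa%:E <= gt x,
        forall m : nat, exists s : seq X, forall x,
          (forall q, q \in s -> m.+1%:R^-1 < mdist q x)%R -> (2 * m.+1%:R)%:E <= gt x &
        \int[nu]_x gt x `^ p <= \int[nu]_x g x `^ p + (3 * e)%:E].
Proof.
move=> mg g0 e0.
have mgp : measurable_fun setT (fun x => g x `^ p).
  exact: (measurableT_comp (measurable_poweR p) mg).
have [G1 [D [lG1 gG1 _ _ IG1]]] := lsc_majorant nu mgp (fun x => poweR_ge0 _ _) e0 (@ltr01 R).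
have G10 x : 0 <= G1 x by apply: le_trans (gG1 x); exact: poweR_ge0.
pose M := fine (nu setT).
have ME : nu setT = M%:E by rewrite fineK// fin_num_measure.
have M0 : (0 <= M)%R by exact: fine_ge0.
pose kappa := ((e / (M + 1)) `^ p^-1)%R.
have M1 : (0 < M + 1)%R by lra.
have k0 : (0 < kappa)%R by rewrite powR_gt0// divr_gt0.
have kp : (kappa `^ p = e / (M + 1))%R.
  by rewrite -powRrM mulVf// powRr1// divr_ge0// ltW.
(* With this weight, a duration [1 / (2 (m + 1))] spent in [O m] costs at least 1. The measure of
   [O m] is made small relative to [w m]. *)
pose w m : R := ((2 * m.+1%:R) `^ p)%R.
have w0 m : (0 < w m)%R by rewrite powR_gt0// mulr_gt0.
have em0 m : (0 < e / (2 ^ m.+1)%:R / w m)%R by rewrite !divr_gt0// ltr0n expn_gt0.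
have inv0 (m : nat) : (0 < m.+1%:R^-1 :> R)%R by rewrite invr_gt0.
have /choice[s sP] := fun m : nat => separable_tight nu Xsep (em0 m) (inv0 m).
pose O m := [set x : X | forall q, q \in s m -> (m.+1%:R^-1 < mdist q x)%R].
have oO m : open (O m) by exact: open_mdist_gt_seq.
have mO m : measurable (O m : set (borelType X)) by exact: open_borel.
pose P (x : X) := \sum_(0 <= m <oo) (w m * \1_(O m) x)%:E.
have wi0 m (x : X) : 0 <= (w m * \1_(O m) x)%:E by rewrite lee_fin mulr_ge0// ltW.
have P0 x : 0 <= P x by apply: nneseries_ge0 => m _ _; exact: wi0.
have kpE0 : 0 <= (kappa `^ p)%:E by rewrite lee_fin powR_ge0.
pose gp (x : X) := G1 x + (kappa `^ p)%:E + P x.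
have gp0 x : 0 <= gp x by rewrite !adde_ge0.
have lP : lower_semicontinuous P.
  apply: lower_semicontinuous_nneseries => // m.
  by apply: lower_semicontinuous_indic => //; exact: ltW.
have lgp : lower_semicontinuous gp.
  apply: lower_semicontinuousD => //; first by move=> x; rewrite adde_ge0.
  by apply: lower_semicontinuousD => //; exact: lower_semicontinuous_cst.
have gpE x : (gp x `^ p^-1) `^ p = gp x by rewrite -poweRrM mulVf// poweRe1.
have le_gt (a : \bar R) x : 0 <= a -> a `^ p <= gp x -> a <= gp x `^ p^-1.
  move=> a0 h; have -> : a = (a `^ p) `^ p^-1 by rewrite -poweRrM mulfV// poweRe1.
  apply: gt0_ler_poweR; rewrite ?in_itv/= ?leey ?andbT ?poweR_ge0//.
  by rewrite invr_ge0 ltW.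
exists (fun x => gp x `^ p^-1); split.
- by apply: lower_semicontinuous_poweR => //; rewrite invr_gt0.
- move=> x; apply: le_gt => //; apply: le_trans (gG1 x) _.
  by rewrite /gp -addeA leeDl// adde_ge0.
- exists kappa => // x; apply: le_gt; first by rewrite lee_fin ltW.
  by rewrite poweR_EFin /gp -addeA addeCA leeDl// adde_ge0.
- move=> m; exists (s m) => x Hx; apply: le_gt; first by rewrite lee_fin mulr_ge0.
  rewrite poweR_EFin; apply: (@le_trans _ _ (P x)); last by rewrite /gp leeDr// adde_ge0.
  apply: (@le_trans _ _ (\sum_(0 <= i < m.+1) (w i * \1_(O i) x)%:E)).
    rewrite big_nat_recr//= indicE mem_set// mulr1 leeDr//.
    by apply: sume_ge0 => i _; exact: wi0.
  by apply: nneseries_lim_ge => i _ _; exact: wi0.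
under [X in X <= _]eq_integral => x _ do rewrite gpE.
have mP : measurable_fun [set: borelType X] (P : borelType X -> \bar R).
  exact: lower_semicontinuous_borel.
have mG1 : measurable_fun [set: borelType X] (G1 : borelType X -> \bar R).
  exact: lower_semicontinuous_borel.
rewrite ge0_integralD//; last 2 first.
- by move=> x _; rewrite adde_ge0.
- by apply: emeasurable_funD => //; exact: measurable_cst.
rewrite ge0_integralD//.
have Hk : \int[nu]_(x in [set: borelType X]) (kappa `^ p)%:E <= e%:E.
  rewrite integral_cst//= ME.
  rewrite -EFinM lee_fin kp mulrAC -mulrA; apply: ler_piMr; first exact: ltW.
  by rewrite ler_pdivrMr// mul1r lerDl.
have HP : \int[nu]_x P x <= e%:E.
  rewrite /P integral_nneseries//; last first.
    move=> m; apply/measurable_EFinP; apply: measurable_funM; first exact: measurable_cst.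
    exact: measurable_indic.
  apply: (@le_trans _ _ (\sum_(0 <= m <oo) (e / (2 ^ m.+1)%:R)%:E)).
    apply: lee_nneseries => [m _ _|m _]; first by apply: integral_ge0 => x _; exact: wi0.
    under eq_integral do rewrite EFinM.
    rewrite ge0_integralZl//; last 2 first.
    - by apply/measurable_EFinP; exact: measurable_indic.
    - by rewrite lee_fin ltW.
    rewrite integral_indic// setIT.
    apply: (@le_trans _ _ ((w m)%:E * (e / (2 ^ m.+1)%:R / w m)%:E)).
      by apply: lee_wpmul2l; [rewrite lee_fin ltW|exact: sP].
    by rewrite -EFinM lee_fin mulrC divfK// gt_eqF.
  by apply: epsilon_trick0; exact: ltW.
apply: (le_trans (leeD (leeD IG1 Hk) HP)); move: (\int[nu]_x g x `^ p) => I.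
rewrite -!addeA -!EFinD (_ : e + (e + e) = 3 * e)%R//; ring.
Qed.

End tight_majorant.

Section gradients.
Context {R : realType} {X : pointedMetricType R}.
Local Notation leb := (@lebesgue_measure R).
Local Open Scope ereal_scope.

(** Reversing the curve yields the other sign, so the one-sided estimate produced by the gluing
    suffices. *)
Lemma upper_gradient_lipschitz (w : X -> R) (G : borelType X -> \bar R) :
  measurable_fun setT G -> (forall x, 0 <= G x) ->
  (forall c L, lipschitz_curve L c ->
    (w (c 0%R) - w (c 1%R))%:E <= L%:E * \int[leb]_(t in `[0%R, 1%R]) G (c t)) ->
  upper_gradient (EFin \o w) G.
Proof.
move=> mG G0 H; split => // gam /constant_speed_curve[c [L [lc c0 c1 ->]]].
rewrite -c0 -c1 /=.
have [_|_] := ger0P (w (c 1%R) - w (c 0%R)); last by rewrite opprB; exact: H.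
pose s t : R := (1 - t)%R.
have ms : measurable_fun [set: measurableTypeR R] s.
  apply: continuous_measurable_fun => z.
  by apply: cvgB; [exact: cvg_cst|exact: cvg_id].
have ls : lipschitz_curve (L * 1) (c \o s).
  apply: lipschitz_curve_comp => // x y.
  by rewrite /s mul1r (_ : 1 - x - (1 - y) = y - x)%R 1?distrC//; ring.
have := H _ _ ls; rewrite /= /s subr0 subrr mulr1 => /le_trans; apply.
have L0 := lipschitz_curve_ge0 lc.
apply: (@ge0_le_integral_substitution _ s `[0%R, 1%R] `[0%R, 1%R] L L (G \o c)) => //.
- exact: measurable_funTS.
- by move=> t /=; rewrite !in_itv/= /s => /andP[t0 t1]; apply/andP; split; lra.
- exact: measurable_comp_curve lc mG.
- by move=> t _; exact: G0.
- move=> x y xy; rewrite EFinM; apply: lee_wpmul2l; first by rewrite lee_fin.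
  apply: (@le_trans _ _ (leb `[(1 - y)%R, (1 - x)%R]%classic)).
    apply: le_measure; rewrite ?inE.
    + apply: measurableI => //; rewrite -[X in measurable X]setTI.
      by apply: ms => //; exact: measurable_itv.
    + exact: measurable_itv.
    + by move=> t [_]; rewrite /= !in_itv/= /s => /andP[h1 h2]; apply/andP; split; lra.
  rewrite lebesgue_measure_itv/=; case: ifPn => _; last by rewrite lee_fin subr_ge0.
  by rewrite -EFinD lee_fin; lra.
Qed.

Lemma upper_gradientZ (a : R) (u : X -> R) (g : borelType X -> \bar R) : (0 <= a)%R ->
  upper_gradient (EFin \o u) g ->
  upper_gradient (EFin \o (fun x => a * u x)%R) (fun x => a%:E * g x).
Proof.
move=> a0 ug; have [mg g0 _] := ug.
apply: upper_gradient_lipschitz.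
- by apply: emeasurable_funM => //; exact: measurable_cst.
- by move=> x; rewrite mule_ge0.
move=> c L lc.
rewrite ge0_integralZl//; last exact: measurable_comp_curve lc mg.
rewrite muleCA -mulrBr EFinM; apply: lee_wpmul2l; first by rewrite lee_fin.
have := arc_upper_gradient ug lc ler01; apply: le_trans.
by rewrite /= lee_fin distrC ler_norm.
Qed.

End gradients.

Section energy_scale.
Context {R : realType} {X : pointedMetricType R}.
Variables (mu : {measure set (borelType X) -> \bar R}) (p : R).
Local Open Scope ereal_scope.

Lemma energyZ (a : R) (u : X -> R) (g : borelType X -> \bar R) : (0 <= a)%R ->
  (forall x, 0 <= u x)%R -> mu_measurable mu (EFin \o u) ->
  measurable_fun setT g -> (forall x, 0 <= g x) ->
  mu_measurable mu (EFin \o (fun x => a * u x)%R) /\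
  energy mu p (fun x => a * u x)%R (fun x => a%:E * g x) =
  (a `^ p)%:E * energy mu p u g.
Proof.
move=> a0 u0 mu_u mg g0.
have [h [N0 [mh h0 mN0 N00 uh]]] := mu_measurable_version u0 mu_u.
have mah : measurable_fun [set: borelType X] (fun x => a%:E * h x).
  by apply: emeasurable_funM => //; exact: measurable_cst.
have auh x : ~ N0 x -> (a * u x)%:E = a%:E * h x by move=> /uh <-.
have aE (f : X -> \bar R) x : 0 <= f x -> (a%:E * f x) `^ p = (a `^ p)%:E * f x `^ p.
  by move=> f0; rewrite poweRM.
have ap0 : (0 <= a `^ p)%R by exact: powR_ge0.
split.
  exists (fun x => a%:E * h x) => //; exists N0; split => // x /=.
  by apply: contra_notP => /auh.
rewrite (energy_version p g u0 h0 mh mN0 N00 uh).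
rewrite (energy_version _ _ _ _ mah mN0 N00 auh)//; last 2 first.
- by move=> x; rewrite mulr_ge0.
- by move=> x; rewrite mule_ge0.
rewrite ge0_muleDr; try by apply: integral_ge0 => x _; exact: poweR_ge0.
under eq_integral do rewrite aE//.
under [X in _ + X = _]eq_integral do rewrite aE//.
rewrite !ge0_integralZl//.
- exact: measurable_poweR_comp.
- by move=> x _; exact: poweR_ge0.
- exact: measurable_poweR_comp.
- by move=> x _; exact: poweR_ge0.
Qed.

End energy_scale.

(** * The glued competitor *)

Section obstacle.
Context {R : realType} {X : pointedMetricType R}.
Variable mu : {measure set (borelType X) -> \bar R}.
Variables (u rho : X -> R) (g : borelType X -> \bar R) (k : nat) (delta : R).
Variables (phi gt : X -> \bar R) (E : set (borelType X)).
Hypothesis u01 : forall x, 0 <= u x <= 1.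
Hypothesis ug : upper_gradient (EFin \o u) g.
Hypothesis rho_lip : forall x y, `|rho x - rho y| <= k.+1%:R * mdist x y.
Hypothesis rho_ge0 : forall x, 0 <= rho x.
Hypothesis delta0 : 0 < delta.
Hypothesis delta1 : delta < 1.
Hypothesis phi0 : forall x, (0 <= phi x)%E.
Hypothesis mgt : measurable_fun [set: borelType X] (gt : borelType X -> \bar R).
Hypothesis ggt : forall x, (g x <= gt x)%E.
Hypothesis mE : measurable E.
Local Notation leb := (@lebesgue_measure R).

Definition sublevel : set (borelType X) := [set x | rho x <= 2^-1].

Local Notation N := sublevel.

(** Subtracting [delta] puts it below [u] at points of [N] where [phi <= u + delta]. The coefficient
    4 makes it positive only where [rho < 1/4], at a distance from the edge of [N], across which
    [value] is not controlled. The factor [1 - delta] leaves room in the gradient for the slope of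
    [4 rho]. *)
Definition obstacle (x : X) : R :=
  (1 - delta) * fine (value N phi gt x) - delta - 4 * rho x.

Definition glued_slope : R := 4 * k.+1%:R / delta.

Definition glued_gradient (x : borelType X) : \bar R :=
  if x \in N then maxe (gt x) (glued_slope * \1_E x)%:E else g x.

Let g0 x : (0 <= g x)%E. Proof. by case: ug. Qed.
Let gt0 x : (0 <= gt x)%E. Proof. exact: le_trans (ggt x). Qed.
Let slope0 : 0 <= glued_slope.
Proof. by rewrite /glued_slope divr_ge0// ?mulr_ge0// ltW. Qed.

Let value01 x : 0 <= fine (value N phi gt x) <= 1.
Proof.
rewrite fine_ge0/=; last exact: value_ge0.
by rewrite -lee_fin fineK ?value_le1//; exact: value_fin.
Qed.

Let mN : measurable N.
Proof. by apply: closed_borel; exact: lipschitz_closed_le rho_lip. Qed.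

Lemma obstacle_lt1 x : 0 < obstacle x -> rho x < 4^-1 /\ obstacle x <= 1.
Proof.
rewrite /obstacle; have := value01 x; move: (fine _) => v /andP[v0 v1].
have := rho_ge0 x; have : (1 - delta) * v <= 1 - delta.
  by rewrite ler_piMr// subr_ge0 ltW.
by move: delta0 => ? ? ? ?; split; lra.
Qed.

Lemma glued_gradient_ge x : (g x <= glued_gradient x)%E.
Proof.
by rewrite /glued_gradient; case: ifP => // _; rewrite le_max ggt.
Qed.

Let G0 x : (0 <= glued_gradient x)%E.
Proof. by apply: le_trans (glued_gradient_ge x). Qed.

Let mG : measurable_fun [set: borelType X] glued_gradient.
Proof.
have [mg _ _] := ug.
apply: measurable_fun_if_in => //; apply: measurable_maxe => //.
apply/measurable_EFinP; apply: measurable_funM; first exact: measurable_cst.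
exact: measurable_indic.
Qed.

Lemma glued_gradient_energy (p e : R) : 0 < p ->
  (\int[mu]_(x in N) gt x `^ p <= \int[mu]_(x in N) g x `^ p + e%:E ->
   \int[mu]_x glued_gradient x `^ p <=
   \int[mu]_x g x `^ p + e%:E + (glued_slope `^ p)%:E * mu E)%E.
Proof.
move=> p0 H; have [mg _ _] := ug.
have mgp := measurable_poweR_comp p mg.
have mgtp := measurable_poweR_comp p mgt.
have mGp := measurable_poweR_comp p mG.
have mNC : measurable (~` N : set (borelType X)) by exact: measurableC.
have NNC : [disjoint N & ~` N] by apply/disj_set2P; exact: setICr.
have split_int (f : borelType X -> \bar R) : measurable_fun setT f ->
    (forall x, 0 <= f x)%E ->
    (\int[mu]_x f x = \int[mu]_(x in N) f x + \int[mu]_(x in ~` N) f x)%E.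
  by move=> mf f0; rewrite -ge0_integral_setU ?setUv//; exact: measurable_funTS.
rewrite !split_int; try (by move=> x; exact: poweR_ge0); try by [].
have -> : (\int[mu]_(x in ~` N) glued_gradient x `^ p = \int[mu]_(x in ~` N) g x `^ p)%E.
  by apply: eq_integral => x; rewrite inE => /= Nx; rewrite /glued_gradient memNset.
have AC (a1 a2 a3 a4 : \bar R) : (a1 + a2 + a3 + a4 = a1 + a4 + a2 + a3)%E.
  by rewrite (addeAC _ a3) (addeAC _ a2).
rewrite -AC; apply: leeD => //.
apply: (@le_trans _ _ ((\int[mu]_(x in N) gt x `^ p) + (glued_slope `^ p)%:E * mu E)%E); last exact: leeD.
have mI : measurable_fun [set: borelType X] (fun x => (\1_E x : R)%:E).
  by apply/measurable_EFinP; exact: measurable_indic.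
have bp0 : (0 <= (glued_slope `^ p)%:E)%E by rewrite lee_fin powR_ge0.
have mbI : measurable_fun [set: borelType X] (fun x => (glued_slope `^ p)%:E * (\1_E x)%:E)%E.
  by apply: emeasurable_funM => //; exact: measurable_cst.
apply: (@le_trans _ _ (\int[mu]_(x in N) (gt x `^ p + (glued_slope `^ p)%:E * (\1_E x)%:E))%E).
  apply: ge0_le_integral => //.
  - by move=> x _; exact: poweR_ge0.
  - exact: measurable_funTS.
  - by apply: measurable_funTS; exact: emeasurable_funD.
  - move=> x Nx; rewrite /glued_gradient mem_set//.
    have [_|_] := leP (gt x) (glued_slope * \1_E x)%:E.
      rewrite indicE; case: (x \in E); rewrite ?mulr1 ?mule1 ?mulr0 ?mule0 ?adde0.
        by rewrite poweR_EFin leeDr// poweR_ge0.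
      by rewrite poweR_EFin powR0 ?gt_eqF// poweR_ge0.
    by rewrite leeDl// mule_ge0.
rewrite ge0_integralD//; last 4 first.
- by move=> x _; exact: poweR_ge0.
- exact: measurable_funTS.
- by move=> x _; rewrite mule_ge0.
- exact: measurable_funTS.
apply: leeD => //; rewrite ge0_integralZl//; last exact: measurable_funTS.
apply: lee_wpmul2l => //; rewrite integral_indic//.
by apply: le_measure; rewrite ?inE//; exact: measurableI.
Qed.

(** On [E] the obstacle, where positive, is at most 1, so replacing [h] by it costs at most the
    measure of [E]. *)
Lemma glued_function_energy (p : R) (h : borelType X -> \bar R) : 0 < p ->
  measurable_fun setT h -> (forall x, 0 <= h x)%E ->
  (forall x, ~ E x -> (obstacle x)%:E <= h x)%E ->
  (\int[mu]_x (maxe (h x) (obstacle x)%:E) `^ p <= \int[mu]_x h x `^ p + mu E)%E.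
Proof.
move=> p0 mh h0 zh.
have -> : mu E = (\int[mu]_x (\1_E x)%:E)%E by rewrite integral_indic// setIT.
rewrite -ge0_integralD//; last 3 first.
- by move=> x _; exact: poweR_ge0.
- exact: measurable_poweR_comp.
- by apply/measurable_EFinP; exact: measurable_indic.
apply: ge0_le_integral_nomeas => x; first exact: poweR_ge0.
have [hz|_] := leP (h x) (obstacle x)%:E; last by rewrite leeDl// lee_fin.
rewrite indicE; have [Ex|Ex] := boolP (x \in E); last first.
  rewrite adde0; suff -> : h x = (obstacle x)%:E by [].
  by apply/eqP; rewrite eq_le hz zh// => Ex'; move: Ex; rewrite mem_set.
apply: (@le_trans _ _ 1%E); last by rewrite leeDr// poweR_ge0.
have := le_trans (h0 x) hz; rewrite lee_fin => z0; rewrite poweR_EFin lee_fin.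
move: z0; rewrite le_eqVlt => /predU1P[<-|z0]; first by rewrite powR0 ?gt_eqF.
have -> : 1 = 1 `^ p :> R by rewrite powR1.
apply: ge0_ler_powR; rewrite ?nnegrE//; [exact: ltW|exact: ltW|].
exact: (obstacle_lt1 z0).2.
Qed.

Hypothesis zu : forall x, ~ E x -> obstacle x <= u x.

Let slopeE : delta * glued_slope = 4 * k.+1%:R.
Proof. by rewrite /glued_slope mulrC divfK// gt_eqF. Qed.

(* The gradient [max gt b] beats the convex combination
   [(1 - delta) gt + delta b], where [delta b] is the slope of [4 rho]. *)
Let glued_gradient_convex x : u x < obstacle x ->
  ((1 - delta)%:E * gt x + (4 * k.+1%:R)%:E <= glued_gradient x)%E.
Proof.
move=> ux; have Ex : E x by apply: contrapT => /zu; rewrite leNgt ux.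
have [r4 _] : rho x < 4^-1 /\ obstacle x <= 1.
  by apply: obstacle_lt1; apply: le_lt_trans ux; case/andP: (u01 x).
have Nx : N x by rewrite /sublevel/=; lra.
rewrite /glued_gradient mem_set// indicE mem_set// mulr1 -slopeE.
have := gt0 x; case: (gt x) => [r|_|]//; last by rewrite max_l ?leey.
rewrite lee_fin => r0; rewrite -EFin_max lee_fin.
move: delta0 delta1 slopeE => d0 d1 _; have := slope0; move: glued_slope => b b0.
have [rb|br] := leP r b.
  by have := ler_wpM2l (_ : 0 <= 1 - delta) rb; rewrite subr_ge0 => /(_ (ltW d1)); lra.
by have := ler_wpM2l (ltW d0) (ltW br); lra.
Qed.

Let glued_gradient_ge_gt x : N x -> ((1 - delta)%:E * gt x <= glued_gradient x)%E.
Proof.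
move=> Nx; rewrite /glued_gradient mem_set// le_max; apply/orP; left.
by rewrite -[leRHS]mul1e; apply: lee_wpmul2r => //; rewrite lee_fin gerBl ltW.
Qed.

(** Along a curve the obstacle is controlled only inside [N], and the slope of [4 rho] is paid only
    where the obstacle exceeds [u]: this is the situation of [max_variation_le]. *)
Lemma glued_upper_gradient :
  upper_gradient (EFin \o (fun x => Num.max (u x) (obstacle x))) glued_gradient.
Proof.
apply: upper_gradient_lipschitz => // c L lc; have L0 := lipschitz_curve_ge0 lc.
have kL0 : (0 < (L + 1) * k.+1%:R)%R by rewrite mulr_gt0// ltr_wpDl.
have mgc : measurable_fun [set: measurableTypeR R] (gt \o c).
  exact: measurable_comp_curve lc mgt.
have mGc : measurable_fun [set: measurableTypeR R] (glued_gradient \o c).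
  exact: measurable_comp_curve lc mG.
have d1 : (0 <= 1 - delta)%R by rewrite subr_ge0 ltW.
rewrite -ge0_integralZl//; last exact: measurable_funTS.
(* Within the time given last, [rho] changes by at most [1/4], so from below [1/4] it cannot leave
   [N]; [L + 1] avoids a division by 0. *)
apply: (@max_variation_le R (u \o c) (obstacle \o c) (fun t => L%:E * glued_gradient (c t))%E
  (fun t => L%:E * ((1 - delta)%:E * gt (c t)))%E [set t | N (c t)]
  (L * (4 * k.+1%:R)) (4 * ((L + 1) * k.+1%:R))^-1).
- by apply: emeasurable_funM => //; exact: measurable_cst.
- apply: emeasurable_funM; first exact: measurable_cst.
  by apply: emeasurable_funM => //; exact: measurable_cst.
- by move=> t; rewrite mule_ge0.
- by move=> t; rewrite !mule_ge0 ?lee_fin.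
- by rewrite !mulr_ge0.
- by rewrite invr_gt0 mulr_gt0.
- move=> a b a0 ab b1.
  apply: (@le_trans _ _ (L%:E * \int[leb]_(t in `[a, b]) g (c t))%E).
    apply: le_trans (arc_upper_gradient ug lc ab).
    by rewrite /= lee_fin distrC ler_norm.
  rewrite ge0_integralZl//; last exact: measurable_funTS.
  apply: lee_wpmul2l; first by rewrite lee_fin.
  apply: ge0_le_integral => //.
  + by apply: measurable_comp_curve lc _; case: ug.
  + exact: measurable_funTS.
  + by move=> t _; exact: glued_gradient_ge.
- move=> a b a0 ab b1 cN.
  have := value_arc phi0 gt0 mgt lc ab cN.
  have va := value01 (c a); have vb := value01 (c b).
  rewrite ge0_integralZl//; last 2 first.
  + by apply: measurable_funTS; apply: emeasurable_funM => //; exact: measurable_cst.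
  + by move=> t _; rewrite mule_ge0.
  rewrite ge0_integralZl//; last exact: measurable_funTS.
  move=> H; apply: (@le_trans _ _ ((1 - delta)%:E * `|value N phi gt (c b) - value N phi gt (c a)|
    + (L * (4 * k.+1%:R) * (b - a))%:E)%E); last first.
    by apply: leeD => //; rewrite muleCA; apply: lee_wpmul2l.
  rewrite -[value N phi gt (c b)]fineK ?value_fin// -[value N phi gt (c a)]fineK ?value_fin//.
  rewrite /= -EFinM -EFinD lee_fin /obstacle.
  have rl : `|rho (c a) - rho (c b)| <= k.+1%:R * (L * (b - a)).
    apply: le_trans (rho_lip _ _) _; apply: ler_wpM2l => //.
    by apply: le_trans (lc _ _) _; rewrite distrC ger0_norm// subr_ge0.
  have := ler_wpM2l d1 (ler_norm (fine (value N phi gt (c a)) - fine (value N phi gt (c b)))).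
  rewrite (distrC (fine (value N phi gt (c a)))).
  have := ler_norm (rho (c b) - rho (c a)); rewrite (distrC (rho (c b))) => /le_trans/(_ rl).
  lra.
- move=> t _ /= /glued_gradient_convex H.
  rewrite EFinM -ge0_muleDr ?lee_fin ?mulr_ge0// ?mule_ge0//.
  by apply: lee_wpmul2l; rewrite ?lee_fin.
- by move=> t /= /glued_gradient_ge_gt H; apply: lee_wpmul2l; rewrite ?lee_fin.
- move=> t t' _ _ /= ut tt'.
  have [r4 _] : rho (c t) < 4^-1 /\ obstacle (c t) <= 1.
    by apply: obstacle_lt1; apply: le_lt_trans ut; case/andP: (u01 (c t)).
  have := le_trans (rho_lip (c t') (c t)) (ler_wpM2l (ler0n _ _) (lc t' t)).
  have : k.+1%:R * (L * `|t' - t|) <= 4^-1.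
    apply: (@le_trans _ _ (k.+1%:R * ((L + 1) * `|t - t'|))).
      apply: ler_wpM2l => //; rewrite distrC; apply: ler_wpM2r => //; lra.
    apply: (@le_trans _ _ ((L + 1) * k.+1%:R * (4 * ((L + 1) * k.+1%:R))^-1)).
      by rewrite mulrCA mulrA; apply: ler_wpM2l => //; exact: ltW.
    by rewrite invfM mulrCA mulfV ?mulr1// gt_eqF.
  by rewrite /sublevel/= ler_norml => h1 /andP[_]; lra.
Qed.

End obstacle.

Section outer.
Context {R : realType} {X : pointedMetricType R}.
Variables (mu : {measure set (borelType X) -> \bar R}) (p : R).
Hypothesis Xlc : locally_complete X.
Hypothesis Xsep : separable_space X.
Hypothesis mu_ball : forall (x : X) (r : R), 0 < r -> (0 < mu (ball x r) < +oo)%E.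
Hypothesis p1 : 1 < p.

Let p0 : 0 < p. Proof. exact: lt_trans p1. Qed.

(** [u] is a subsolution: along every curve from [x], [u x] is at most the final value of [u] plus
    the integral of [g]. *)
Lemma le_value (N : set X) (phi gt : X -> \bar R) (u : X -> R) (g : borelType X -> \bar R) :
  upper_gradient (EFin \o u) g -> (forall x, u x <= 1) ->
  (forall x, (u x)%:E <= phi x)%E -> (forall x, (g x <= gt x)%E) ->
  measurable_fun [set: borelType X] (gt : borelType X -> \bar R) ->
  forall x, ((u x)%:E <= value N phi gt x)%E.
Proof.
move=> ug u1 uphi ggt mgt x; have [mg g0 _] := ug.
rewrite /value le_min lee_fin u1/=; apply: le_ereal_inf_tmp => _ [c [T [[lc cN T0 cx] ->]]].
have := arc_upper_gradient ug lc T0; rewrite mul1e /= cx => H.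
apply: (@le_trans _ _ ((u (c T))%:E + `|u (c T) - u x|%:E)%E).
  by rewrite -EFinD lee_fin -lerBlDl distrC ler_norm.
apply: leeD => //; apply: le_trans H _; apply: ge0_le_integral => //.
- exact: measurable_comp_curve lc mg.
- exact: measurable_comp_curve lc mgt.
Qed.

Lemma Cap_compact_open (K : set X) (M : R) : compact K -> (Cap mu p K < M%:E)%E ->
  exists W, [/\ open W, K `<=` W & (Cap mu p W <= M%:E)%E].
Proof.
move=> cK KM.
have [u [g [[u01 uK mu_u ug] JM]]] := Cap_lt_energy p1 KM.
have [mg g0 _] := ug.
have u0 x : 0 <= u x by case/andP: (u01 x).
have u1 x : u x <= 1 by case/andP: (u01 x).
have [h [N0 [mh h0 mN0 N00 uh]]] := mu_measurable_version u0 mu_u.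
have Jfin : energy mu p u g \is a fin_num.
  by rewrite ge0_fin_numE ?energy_ge0// (lt_trans JM)// ltry.
have JE : (fine (energy mu p u g))%:E = energy mu p u g by exact: fineK.
set J := fine _ in JE.
have J0 : 0 <= J by rewrite -lee_fin JE energy_ge0.
have {}JM : J < M by rewrite -lte_fin JE.
(* Half of the gap pays for the construction, the other half for the final rescaling by [a]. *)
pose M1 := (J + M) / 2.
have M10 : 0 < M1 by rewrite /M1; lra.
have M1M : M1 < M by rewrite /M1; lra.
pose a := (M / M1) `^ p^-1.
have a1 : 1 < a.
  have <- : 1 `^ p^-1 = 1 :> R by rewrite powR1.
  apply: gt0_ltr_powR; rewrite ?invr_gt0 ?nnegrE//; first by rewrite divr_ge0// ltW// (lt_trans M10).
  by rewrite ltr_pdivlMr// mul1r.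
have ap : a `^ p = M / M1.
  by rewrite /a -powRrM mulVf ?gt_eqF// powRr1// divr_ge0// ltW// (lt_trans M10).
(* Then [1 / a = 1 - 4 delta], while on the open set [w] is at least [(1 - delta)^2 - 2 delta],
   which is larger. *)
pose delta := (1 - a^-1) / 4.
have a0 : 0 < a by exact: lt_trans a1.
have ai : 0 < a^-1 < 1 by rewrite invr_gt0 a0 invf_lt1.
have delta0 : 0 < delta by rewrite /delta; case/andP: ai; lra.
have delta1 : delta < 1 by rewrite /delta; case/andP: ai; lra.
(* Three parts go to the majorant [gt] and one to [E], whose measure [e1] counts once for the
   function and [bp] times for the gradient. *)
pose e := (M1 - J) / 4.
have e0 : 0 < e by rewrite /e /M1; lra.
have [k [rho [A [s [[rlip r0 rK] cA NA muN]]]]] := compact_localization Xlc mu_ball cK.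
pose N := sublevel rho.
have cN : closed (N : set X) by exact: lipschitz_closed_le rlip.
have mN : measurable N by exact: closed_borel.
pose nu : {finite_measure set (borelType X) -> \bar R} := mfrestr mN muN.
have nuE (f : borelType X -> \bar R) : measurable_fun setT f -> (forall x, 0 <= f x)%E ->
    (\int[nu]_x f x = \int[mu]_(x in N) f x)%E by exact: ge0_integral_mrestr.
pose bp := (glued_slope k delta : R) `^ p.
have bp0 : 0 <= bp by exact: powR_ge0.
pose e1 := e / (1 + bp).
have e10 : 0 < e1 by rewrite divr_gt0// ltr_wpDr.
have e1E : e1 + bp * e1 = e by rewrite -[X in X + _]mul1r -mulrDl mulrC divfK// gt_eqF// ltr_wpDr.
(* The value [+oo] on the null set makes the majorant dominate [u] everywhere: a curve may charge a
   null set. *)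
pose hh (x : borelType X) := if x \in N0 then +oo%E else h x.
have mhh : measurable_fun setT hh by exact: measurable_fun_if_in.
have hh0 x : (0 <= hh x)%E by rewrite /hh; case: ifP.
have uhh x : ((u x)%:E <= hh x)%E.
  by rewrite /hh; case: ifPn => [_|/negP]; [exact: leey|rewrite in_setE => /uh ->].
have [phi [D [lphi hphi mD [nuD Dphi] _]]] := lsc_majorant nu mhh hh0 e10 delta0.
have phi0 x : (0 <= phi x)%E by exact: le_trans (hphi x).
have uphi x : ((u x)%:E <= phi x)%E by apply: le_trans (hphi x); exact: uhh.
have [gt [lgt ggt [kappa kappa0 kgt] tight Igt]] := tight_lsc_majorant nu p0 Xsep mg g0 e0.
have gt0 x : (0 <= gt x)%E by exact: le_trans (ggt x).
have mgt : measurable_fun [set: borelType X] (gt : borelType X -> \bar R).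
  exact: lower_semicontinuous_borel.
(* The measure of [D] is controlled only inside [N], and off [N] the obstacle is at most 0. [N0] is
   added because [phi] is infinite there. *)
pose E := (D `&` N) `|` N0.
have mDN : measurable (D `&` N) by exact: measurableI.
have mE : measurable E by exact: measurableU.
have muE : (mu E <= e1%:E)%E.
  apply: (le_trans (measureU2 _ _ _)) => //.
  by rewrite [X in (_ + X)%E](_ : _ = 0%E)// adde0.
pose V := value N phi gt.
pose z := obstacle rho delta phi gt.
have Vfin x : V x \is a fin_num by exact: value_fin.
have V0 x : 0 <= fine (V x) by rewrite fine_ge0// value_ge0.
have V1 x : fine (V x) <= 1 by rewrite -lee_fin fineK// value_le1.
have zE x : z x = (1 - delta) * fine (V x) - delta - 4 * rho x by [].
have zu x : ~ E x -> z x <= u x.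
  move=> nE; have [Nx|Nx] := pselect (N x); last first.
    rewrite leNgt; apply/negP => uz; apply: Nx.
    have [|] := @obstacle_lt1 _ _ u rho g delta phi gt ug r0 delta0 delta1 phi0 ggt x.
      exact: le_lt_trans uz.
    by rewrite /N /sublevel/=; lra.
  have nD : ~ D x by move=> Dx; apply: nE; left.
  have nN0 : ~ N0 x by move=> Nx0; apply: nE; right.
  have : (V x <= (u x + delta)%:E)%E.
    apply: (le_trans (value_le_phi _ _ Nx)); apply: (le_trans (Dphi _ nD)).
    by rewrite /hh memNset// -uh.
  rewrite -[V x]fineK// lee_fin zE; have := r0 x.
  by have := mulr_ge0 (ltW delta0) (V0 x); lra.
have lV : lower_semicontinuous V.
  apply: (value_lower_semicontinuous phi0 gt0 lphi lgt cN kappa0 _ _ cA) => //.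
  by move=> m; have [s' H] := tight m; exists s' => x _; exact: H.
have Vu x : u x <= fine (V x).
  by rewrite -lee_fin fineK//; exact: (le_value _ ug u1 uphi ggt mgt).
pose w x := Num.max (u x) (z x).
pose G := glued_gradient rho g k delta gt E.
have wG : upper_gradient (EFin \o w) G by exact: (glued_upper_gradient).
have [mG G0 _] := wG.
have w0 x : 0 <= w x by rewrite /w le_max u0.
have mz : measurable_fun [set: borelType X] (EFin \o z).
  apply/measurable_EFinP; apply: measurable_funB; last first.
    apply: measurable_funM; first exact: measurable_cst.
    apply/measurable_EFinP; apply: lower_semicontinuous_borel.
    exact: lipschitz_lower_semicontinuous rlip.
  apply: measurable_funB; last exact: measurable_cst.
  apply: measurable_funM; first exact: measurable_cst.
  apply: measurableT_comp; first exact: fine_measurable.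
  exact: lower_semicontinuous_borel.
pose h1 (x : borelType X) := maxe (h x) (z x)%:E.
have mh1 : measurable_fun setT h1 by exact: measurable_maxe.
have h10 x : (0 <= h1 x)%E by rewrite /h1 le_max h0.
have wh x : ~ N0 x -> (w x)%:E = h1 x by move=> nx; rewrite /h1 -uh// EFin_max.
have mw : mu_measurable mu (EFin \o w).
  exists h1 => //; exists N0; split => // x /=.
  by apply: contra_notP => /wh.
have Ew : (energy mu p w G <= M1%:E)%E.
  rewrite (energy_version p G w0 h10 mh1 mN0 N00 wh).
  have Hg : (\int[mu]_(x in N) gt x `^ p <= \int[mu]_(x in N) g x `^ p + (3 * e)%:E)%E.
    move: Igt; rewrite !nuE//; try (by move=> x; exact: poweR_ge0);
      exact: measurable_poweR_comp.
  have HG := glued_gradient_energy delta ug rlip mgt mE p0 Hg.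
  have zh x : ~ E x -> ((z x)%:E <= h x)%E.
    move=> nE; rewrite -uh; first by rewrite lee_fin; exact: zu.
    by move=> Nx; apply: nE; right.
  have Hh := glued_function_energy mu ug r0 delta0 delta1 phi0 ggt mE p0 mh h0 zh.
  have := JE; rewrite (energy_version p g u0 h0 mh mN0 N00 uh).
  set Ih := (\int[mu]_x h x `^ p)%E in Hh *; set Ig := (\int[mu]_x g x `^ p)%E in HG *.
  move=> IJ; have /andP[fh fg] : (Ih \is a fin_num) && (Ig \is a fin_num).
    by rewrite -fin_numD -IJ.
  have H1 : ((glued_slope k delta `^ p)%:E * mu E <= (bp * e1)%:E)%E.
    by rewrite EFinM; apply: lee_wpmul2l.
  apply: (le_trans (leeD (le_trans Hh (leeD (lexx _) muE))
    (le_trans HG (leeD (lexx _) H1)))).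
  have {}IJ : J = fine Ih + fine Ig by apply: EFin_inj; rewrite IJ EFinD !fineK.
  rewrite -[Ih]fineK// -[Ig]fineK// -!EFinD lee_fin.
  by move: e1E; rewrite /e; lra.
have aw0 x : 0 <= a * w x by rewrite mulr_ge0// ltW.
have [maw EaE] := energyZ p (ltW a0) w0 mw mG G0.
exists ([set x | (1 - delta)%:E < V x]%E `&` [set x | rho x < delta / 4]); split.
- apply: openI; last exact: lipschitz_open_lt rlip.
  by move/lower_semicontinuousP : lV; exact.
- move=> x Kx; split => /=; last by rewrite rK// divr_gt0.
  rewrite -[V x]fineK// lte_fin; apply: lt_le_trans (Vu x).
  by rewrite uK//; lra.
- apply: (@le_trans _ _ (energy mu p (fun x => a * w x)%R (fun x => a%:E * G x)%E)).
    apply: (Cap_le_energy p1 aw0) => //; last exact: (upper_gradientZ (ltW a0) wG).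
    move=> x [/=]; rewrite -[V x]fineK// lte_fin => Vx rx.
    rewrite -ler_pdivrMl// mulr1 /w le_max; apply/orP; right; rewrite zE.
    have -> : a^-1 = 1 - 4 * delta by rewrite /delta; lra.
    have d1 : 0 <= 1 - delta by rewrite subr_ge0 ltW.
    have := mulr_ge0 (ltW delta0) (ltW delta0).
    by have := ler_wpM2l d1 (ltW Vx); lra.
  rewrite EaE ap; apply: (@le_trans _ _ ((M / M1)%:E * M1%:E)%E).
    by apply: lee_wpmul2l => //; rewrite lee_fin divr_ge0// ltW// (lt_trans M10).
  by rewrite -EFinM lee_fin divfK// gt_eqF.
Qed.

End outer.

(** Points of [K n] outside [W] would cluster at a point lying in every [K n] and outside [W]. *)
Lemma decreasing_compact_open {R : realType} {X : pointedMetricType R}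
    (K : (set X)^nat) (W : set X) : (forall n, compact (K n)) ->
  (forall n, K n.+1 `<=` K n) -> open W -> \bigcap_n K n `<=` W ->
  exists n, K n `<=` W.
Proof.
move=> cK dK oW KW; apply: contrapT => /forallNP H.
have /choice[x xP] : forall n, exists x, K n x /\ ~ W x.
  move=> n; have /existsNP[x] := H n; rewrite not_implyE => Hx.
  by exists x.
have mK n m : (n <= m)%N -> K m `<=` K n.
  move=> nm; apply: (@homo_leq _ K (fun A B => B `<=` A)) nm => //.
  - exact: subset_refl.
  - by move=> A B C AB CA; exact: subset_trans AB.
have xK n : \forall m \near \oo, K n (x m).
  by exists n => // m /= nm; apply: (mK n m nm); exact: (xP m).1.
have [y [K0y]] := cK 0%N (x @ \oo) _ (xK 0%N).
rewrite clusterE => cy; have /KW Wy : (\bigcap_n K n) y.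
  move=> n _; rewrite [X in X y](closure_id (K n)).1; last first.
    by apply: compact_closed => //; exact: metric_hausdorff.
  by apply: cy; exact: xK.
have [] : ((~` W : set X) y); last by [].
rewrite [X in X y](closure_id _).1; last exact: open_closedC.
by apply: cy; exists 0%N => // m _; exact: (xP m).2.
Qed.

Theorem corollary1p9 (R : realType) (X : pointedMetricType R)
    (mu : {measure set (borelType X) -> \bar R}) (p : R)
    (Xlc : locally_complete X) (Xsep : separable_space X)
    (mu_ball : forall (x : X) (r : R), 0 < r ->
       (0 < mu (ball x r) < +oo)%E)
    (p1 : 1 < p) :
  choquet_capacity (fun E : set X => Cap mu p E).
Proof.
split.
- by move=> E; exact: Cap_ge0.
- by move=> A B; exact: Cap_le.
- move=> A iA.
  have nd : nondecreasing_seq (fun n => Cap mu p (A n)).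
    by apply/nondecreasing_seqP => n; apply: Cap_le; exact: iA.
  suff -> : Cap mu p (\bigcup_n A n) = ereal_sup (range (fun n => Cap mu p (A n))).
    exact: ereal_nondecreasing_cvgn.
  set s := ereal_sup _.
  apply/eqP; rewrite eq_le; apply/andP; split; last first.
    by apply: ge_ereal_sup => _ [n _ <-]; apply: Cap_le; exact: bigcup_sup.
  have As n : (Cap mu p (A n) <= s)%E by apply: ereal_sup_ubound; exists n.
  have [->|sN] := eqVneq s +oo%E; first exact: leey.
  have s0 : (0 <= s)%E by apply: le_trans (As 0%N); exact: Cap_ge0.
  have sfin : s \is a fin_num by rewrite ge0_fin_numE// lt_neqAle sN leey.
  rewrite -(fineK sfin); apply: Cap_bigcup_le => //; first by move=> n; rewrite fineK.
  move=> t t0; have := @ub_ereal_sup_adherent _ _ _ t0 sfin.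
  by move=> [_ [n _ <-] /ltW h]; exists n; rewrite EFinB fineK.
- move=> K cK dK.
  have ni : nonincreasing_seq (fun n => Cap mu p (K n)).
    by apply/nonincreasing_seqP => n; apply: Cap_le; exact: dK.
  suff -> : Cap mu p (\bigcap_n K n) = ereal_inf (range (fun n => Cap mu p (K n))).
    exact: ereal_nonincreasing_cvgn.
  apply/eqP; rewrite eq_le; apply/andP; split.
    by apply: le_ereal_inf_tmp => _ [n _ <-]; apply: Cap_le; exact: bigcap_inf.
  have [->|cN] := eqVneq (Cap mu p (\bigcap_n K n)) +oo%E; first exact: leey.
  have cfin : Cap mu p (\bigcap_n K n) \is a fin_num.
    by rewrite ge0_fin_numE ?Cap_ge0// lt_neqAle cN leey.
  apply/lee_addgt0Pr => e e0.
  have cKK : compact (\bigcap_n K n).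
    apply: (subclosed_compact _ (cK 0%N)); last exact: bigcap_inf.
    by apply: closed_bigI => n _; apply: compact_closed => //; exact: metric_hausdorff.
  have ltM : (Cap mu p (\bigcap_n K n) < (fine (Cap mu p (\bigcap_n K n)) + e)%:E)%E.
    by rewrite EFinD fineK// lteDl.
  have [W [oW KW CW]] := Cap_compact_open Xlc Xsep mu_ball p1 cKK ltM.
  have [n KnW] := decreasing_compact_open cK dK oW KW.
  apply: (@le_trans _ _ (Cap mu p (K n))); first by apply: ereal_inf_lbound; exists n.
  by apply: le_trans (Cap_le _ _ KnW) _; rewrite -[X in (X + _)%E]fineK.
Qed.
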